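(* Let $n\ge 2$, $d\ge 1$, and let $f_1,\dots,f_n:\mathbb{R}^d\to\mathbb{R}$ be $\mu$-strongly convex and $L$-smooth ($0<\mu\le L$). Let $\mathcal{E}$ be a connected graph on $\{1,\dots,n\}$ with communication rates $(\lambda_{ij})_{(i,j)\in\mathcal{E}}$, expected Laplacian $\Lambda$, and let $\chi_1=\chi_1[\Lambda]<\infty$, $\chi_2=\chi_2[\Lambda]$. Let $(N_i)_{1\le i\le n}$ be Poisson point processes of rate $1$ and $(M_{ij})_{(i,j)\in\mathcal{E}}$ Poisson point processes of rates $\lambda_{ij}$, all independent. Assume $2\chi_1\chi_2\le 1$. Then there exist real parameters, namely $$\nu=\tfrac{\mu}{2},\quad \eta=\tilde\eta=\tilde\alpha=\tfrac18\sqrt{\tfrac{\nu}{L}},\quad \alpha=\delta=\tfrac14\sqrt{\tfrac{\nu}{L}},\quad \gamma=\tfrac1{4L},\quad \tilde\gamma=\tfrac{1}{4\sqrt{\nu L}},\quad \tilde\delta=1,\quad \theta=\tfrac12\sqrt{\tfrac{L}{\nu}},\quad \beta=\tfrac12,\quad \tilde\beta=2\chi_1\sqrt{\tfrac{L}{\nu}},$$ such that the process $(x_t,\tilde x_t,\tilde y_t,y_t,z_t,\tilde z_t)_{t\ge0}$ with values in $(\mathbb{R}^{n\times d})^6$ solving \begin{align*} dx_t&=\eta(\tilde x_t-x_t)\,dt-\gamma(\nabla f(x_t)-\nu x_t-\tilde y_t)\,d\mathbf{N}(t)\\ d\tilde x_t&=\tilde\eta(x_t-\tilde x_t)\,dt-\tilde\gamma(\nabla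 f(x_t)-\nu x_t-\tilde y_t)\,d\mathbf{N}(t)\\ d\tilde y_t&=-\theta(y_t+z_t+\nu\tilde x_t)\,dt+(\delta+\tilde\delta)(\nabla f(x_t)-\nu x_t-\tilde y_t)\,d\mathbf{N}(t)\\ dy_t&=\alpha(\tilde y_t-y_t)\,dt\\ dz_t&=\alpha(\tilde z_t-z_t)\,dt-\beta\sum_{(i,j)\in\mathcal{E}}(\mathbf{e}_i-\mathbf{e}_j)(\mathbf{e}_i-\mathbf{e}_j)^{\mathsf T}(y_t+z_t)\,dM_{ij}(t)\\ d\tilde z_t&=\tilde\alpha(z_t-\tilde z_t)\,dt-\tilde\beta\sum_{(i,j)\in\mathcal{E}}(\mathbf{e}_i-\mathbf{e}_j)(\mathbf{e}_i-\mathbf{e}_j)^{\mathsf T}(y_t+z_t)\,dM_{ij}(t) \end{align*} from any (deterministic) initialization $x_0\in\ker(\pi)$, $\tilde x_0=x_0$, $y_0=\tilde y_0=\nabla f(x_0)-\frac{\mu}{2}x_0$, $z_0=\tilde z_0=-\pi y_0$, satisfies for all $t\ge 0$ $$\mathbb{E}\big[\|x_t-x^*\|^2\big]\le\Big(\frac12+\frac{23}{8}\frac{L}{\mu}+2\frac{L^2}{\mu^2}\Big)\|x_0-x^*\|^2\,e^{-\frac{t}{8\sqrt2}\sqrt{\frac{\mu}{L}}}.$$ Moreover, the expected number of gradient oracle calls $\mathbb{E}[\sum_{i=1}^nN_i(t)]$ up to time $t$ is $nt$, and the expected number of edges activated $\mathbb{E}[\sum_{(i,j)\in\mathcal{E}}M_{ij}(t)]$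 up to time $t$ is $\frac t2\mathrm{Tr}\,\Lambda$.
   Context: Graph and rates: $\mathcal{E}$ is a set of ordered pairs $(i,j)$, $i\ne j$, in $\{1,\dots,n\}^2$; each $(i,j)\in\mathcal{E}$ carries a rate $0<\lambda_{ij}<\infty$ (the rate is $0$ if $(i,j)\notin\mathcal{E}$). ''Connected'' means that the underlying undirected graph is connected. With $(e_i)$ the canonical basis of $\mathbb{R}^n$, $$\Lambda=\sum_{(i,j)\in\mathcal{E}}\lambda_{ij}(e_i-e_j)(e_i-e_j)^{\mathsf T},\quad \chi_1[\Lambda]=\sup_{\|x\|=1,\,x\perp\mathbf{1}}\frac{1}{x^{\mathsf T}\Lambda x},\quad \chi_2[\Lambda]=\frac12\sup_{(i,j)\in\mathcal{E}}(e_i-e_j)^{\mathsf T}\Lambda^+(e_i-e_j),$$ where $\Lambda^+$ is the pseudo-inverse and $\mathbf{1}$ the all-ones vector. Notation on $\mathbb{R}^{n\times d}$: an element $x$ has rows $x_1,\dots,x_n\in\mathbb{R}^d$; $\|\cdot\|$ is the Euclidean (Frobenius) norm. $\mathbf{e}_i=e_i\otimes\mathbf{I}$, so $(\mathbf{e}_i-\mathbf{e}_j)(\mathbf{e}_i-\mathbf{e}_j)^{\mathsf T}x$ has $i$-th row $x_i-x_j$, $j$-th row $x_j-x_i$, and other rows $0$. $\pi=\mathbf{I}-\frac1n\mathbf{1}\mathbf{1}^{\mathsf T}$ acts on $\mathbb{R}^{n\times d}$ by subtracting from each row the average of the rows, so $\ker\pi$ is the set of $x$ with all rows equal. $f(x)=\sum_{i=1}^nf_i(x_i)$,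 so $\nabla f(x)$ has $i$-th row $\nabla f_i(x_i)$. $x^*\in\mathbb{R}^{n\times d}$ is the element all of whose rows equal the unique minimizer over $\mathbb{R}^d$ of $u\mapsto\sum_{i=1}^nf_i(u)$. Dynamics: $\mathbf{N}(t)=(N_i(t))_{i\le n}$, and $g\,d\mathbf{N}(t)$ has $i$-th row $g_i\,dN_i(t)$. Between events the process follows the linear ODE given by the $dt$ terms; at a jump of $N_i$ (resp. $M_{ij}$) the corresponding increment, evaluated at the left limit, is added. *)

(* Defs.v *)
From HB Require Import structures.
From mathcomp Require Import all_boot all_order all_algebra.
From mathcomp Require Import all_classical all_reals all_analysis.

Set Implicit Arguments.
Unset Strict Implicit.
Unset Printing Implicit Defensive.

Import Order.TTheory GRing.Theory Num.Theory.
Import numFieldNormedType.Exports.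

Local Open Scope classical_set_scope.
Local Open Scope ring_scope.

(* The library norm `|A| on matrices is the maximum norm, hence this one. *)
Definition frob (R : realType) (m n : nat) (A : 'M[R]_(m, n)) : R :=
  Num.sqrt (\sum_(i < m) \sum_(j < n) A i j ^+ 2).

Definition gradient (R : realType) (d : nat) (f : 'rV[R]_d -> R)
    (u : 'rV[R]_d) : 'rV[R]_d :=
  \row_(j < d) 'D_(delta_mx 0 j) f u.

Definition strongly_convex (R : realType) (d : nat) (mu : R)
    (f : 'rV[R]_d -> R) : Prop :=
  forall (u v : 'rV[R]_d) (s : R), 0 <= s <= 1 ->
    f (s *: u + (1 - s) *: v) <=
      s * f u + (1 - s) * f v - mu / 2 * (s * (1 - s)) * frob (u - v) ^+ 2.

Definition smooth (R : realType) (d : nat) (L : R)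
    (f : 'rV[R]_d -> R) : Prop :=
  (forall u, differentiable f u) /\
  (forall u v, frob (gradient f u - gradient f v) <= L * frob (u - v)).

(* The gradient at x of x |-> \sum_i f_i(x_i). *)
Definition gradient_rows (R : realType) (n d : nat)
    (f : 'I_n -> 'rV[R]_d -> R) (x : 'M[R]_(n, d)) : 'M[R]_(n, d) :=
  \matrix_(i < n) gradient (f i) (row i x).

Section Graph.
Variables (R : realType) (n : nat).

Definition connected_graph (E : {set 'I_n * 'I_n}) : Prop :=
  forall i j : 'I_n,
    connect [rel a b | ((a, b) \in E) || ((b, a) \in E)] i j.

Definition ones : 'cV[R]_n := const_mx 1.

Definition edge_vec (e : 'I_n * 'I_n) : 'cV[R]_n :=
  delta_mx e.1 0 - delta_mx e.2 0.

Definition edge_mx (e : 'I_n * 'I_n) : 'M[R]_n := edge_vec e *m (edge_vec e)^T.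

Definition laplacian (E : {set 'I_n * 'I_n}) (lam : 'I_n * 'I_n -> R)
    : 'M[R]_n :=
  \sum_(e in E) lam e *: edge_mx e.

Definition centering : 'M[R]_n := 1%:M - n%:R^-1 *: (ones *m ones^T).

(* The inverse is taken in \bar R, where 0^-1 = +oo. *)
Definition chi1 (Lam : 'M[R]_n) : \bar R :=
  ereal_sup [set (((x^T *m Lam *m x) 0 0)%:E^-1)%E |
             x in [set x : 'cV[R]_n | frob x = 1 /\ (ones^T *m x) 0 0 = 0]].

End Graph.
Arguments ones : clear implicits.
Arguments centering : clear implicits.
Arguments edge_vec R {n} e.
Arguments edge_mx R {n} e.

Definition penrose (R : realType) (m n : nat) (A : 'M[R]_(m, n))
    (B : 'M[R]_(n, m)) : Prop :=
  [/\ A *m B *m A = A, B *m A *m B = B,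
      (A *m B)^T = A *m B & (B *m A)^T = B *m A].

(* The Moore-Penrose pseudo-inverse; mathcomp's pinvmx is only a partial
   inverse. *)
Definition pseudo_inverse (R : realType) (m n : nat) (A : 'M[R]_(m, n))
    : 'M[R]_(n, m) :=
  xget 0 [set B | penrose A B].

Lemma gram_unitmx (R : realType) (m n : nat) (A : 'M[R]_(m, n)) :
  row_free A -> A *m A^T \in unitmx.
Proof.
move=> fA; rewrite -row_free_unit -kermx_eq0; apply/rowV0P => v.
move=> /sub_kermxP; rewrite mulmxA => vAA.
have : (v *m A) *m (v *m A)^T = 0 by rewrite trmx_mul mulmxA vAA mul0mx.
move=> /matrixP/(_ 0 0); rewrite mxE [RHS]mxE => /eqP.
rewrite psumr_eq0 => [|i _]; last by rewrite [X in _ * X]mxE -expr2 sqr_ge0.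
move=> /allP vA0; apply/eqP; rewrite -(mulmx_free_eq0 _ fA); apply/eqP/rowP => j.
have := vA0 j (mem_index_enum _) => /=.
by rewrite [X in _ * X]mxE -expr2 sqrf_eq0 => /eqP ->; rewrite mxE.
Qed.

Lemma pseudo_inverseP (R : realType) (m n : nat) (A : 'M[R]_(m, n)) :
  penrose A (pseudo_inverse A).
Proof.
apply: xgetPex.
have [r [C [F [<- uF uC]]]] :
    exists (r : nat) (C : 'M[R]_(m, r)) (F : 'M[R]_(r, n)),
    [/\ C *m F = A, F *m F^T \in unitmx & C^T *m C \in unitmx].
  exists (\rank A), (col_base A), (row_base A); rewrite mulmx_base; split=> //.
    exact/gram_unitmx/row_base_free.
  rewrite -{2}(trmxK (col_base A)); apply/gram_unitmx.
  by rewrite /row_free mxrank_tr; exact: col_base_full.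
pose G := invmx (F *m F^T); pose H := invmx (C^T *m C).
have GT : G^T = G by rewrite trmx_inv trmx_mul trmxK.
have HT : H^T = H by rewrite trmx_inv trmx_mul trmxK.
pose B := F^T *m G *m H *m C^T.
have AB : C *m F *m B = C *m H *m C^T.
  by rewrite /B !mulmxA -(mulmxA C F) -(mulmxA C _ G) mulmxV// mulmx1.
have BA : B *m (C *m F) = F^T *m G *m F.
  by rewrite /B !mulmxA -(mulmxA _ C^T C) -(mulmxA _ H) mulVmx// mulmx1.
exists B; split.
- by rewrite AB !mulmxA -(mulmxA _ C^T C) -(mulmxA _ H) mulVmx// mulmx1.
- by rewrite BA /B !mulmxA -(mulmxA _ F F^T) -(mulmxA F^T) mulVmx// mulmx1.
- by rewrite AB !trmx_mul trmxK HT mulmxA.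
- by rewrite BA !trmx_mul trmxK GT mulmxA.
Qed.

Lemma penrose_unique (R : realType) (m n : nat) (A : 'M[R]_(m, n))
    (B B' : 'M[R]_(n, m)) :
  penrose A B -> penrose A B' -> B = B'.
Proof.
move=> [ABA BAB ABT BAT] [AB'A B'AB' AB'T B'AT].
have h1 : A *m B = A *m B'.
  rewrite -ABT -[in LHS]AB'A -mulmxA trmx_mul ABT AB'T mulmxA.
  by rewrite ABA.
have h2 : B *m A = B' *m A.
  rewrite -BAT -[in LHS]AB'A -mulmxA mulmxA trmx_mul B'AT BAT.
  by rewrite -mulmxA (mulmxA A) ABA.
by rewrite -BAB -mulmxA h1 mulmxA h2.
Qed.

Definition chi2 (R : realType) (n : nat) (E : {set 'I_n * 'I_n})
    (Lam : 'M[R]_n) : R :=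
  2^-1 * sup [set ((edge_vec R e)^T *m pseudo_inverse Lam *m edge_vec R e) 0 0 |
              e in [set` E]].

Section Paths.
Variables (R : realType) (V : normedModType R).
Implicit Types u drift incr : R -> V.

Definition left_limit u (t : R) : V := lim (u s @[s --> t^'-]).

Definition jump u (t : R) : V := u t - left_limit u t.

Definition cadlag u : Prop :=
  (forall t, 0 <= t -> u s @[s --> t^'+] --> u t) /\
  (forall t, 0 < t -> cvg (u s @[s --> t^'-])).

Definition jump_ode (event : R -> Prop) u drift incr : Prop :=
  [/\ cadlag u,
      forall t, 0 < t -> ~ event t -> is_derive t 1 u (drift t)
    & forall t, 0 < t -> jump u t = incr t].

End Paths.

Section Poisson.
Variables (R : realType) (dT : measure_display) (T : measurableType dT).
Variable P : probability T R.

(* Mutual independence of the classes of events (F i) for i in D. *)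
Definition mutually_independent (I : finType) (D : {set I})
    (F : I -> set (set T)) : Prop :=
  forall (J : {set I}) (A : I -> set T),
    J \subset D -> (forall i, i \in J -> F i (A i)) ->
    P (\bigcap_(i in [set` J]) A i) = (\prod_(i in J) P (A i))%E.

Definition generated_by (X : T -> nat) : set (set T) :=
  preimage_set_system setT X measurable.

Definition generated_by_process (N : R -> T -> nat) : set (set T) :=
  <<s \bigcup_(t in [set t : R | 0 <= t]) generated_by (N t) >>.

Definition real_path (N : R -> T -> nat) (w : T) (t : R) : R := (N t w)%:R.

(* N t is the number of points in the interval ]0, t]. *)
Definition poisson_process (rate : R) (N : R -> T -> nat) : Prop :=
  [/\ forall t, 0 <= t -> measurable_fun setT (N t),
      forall w, [/\ N 0 w = 0%N,
                    forall s t, 0 <= s -> s <= t -> (N s w <= N t w)%N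
                  & cadlag (real_path N w)],
      forall s t (k : nat), 0 <= s -> s < t ->
        P [set w | (N t w - N s w)%N = k] =
          (poisson_pmf (rate * (t - s)) k)%:E
    & forall (k : nat) (s : nat -> R), 0 <= s 0%N ->
        {homo s : i j / (i <= j)%N >-> i <= j} ->
        mutually_independent [set: 'I_k]%SET
          (fun l : 'I_k =>
             generated_by (fun w => (N (s l.+1) w - N (s l) w)%N))].

Definition random_matrices (n d : nat) (X : R -> T -> 'M[R]_(n, d)) : Prop :=
  forall t, 0 <= t -> forall i j, measurable_fun setT (fun w => X t w i j).

Section Clocks.
Variables (n : nat) (E : {set 'I_n * 'I_n}) (lam : 'I_n * 'I_n -> R).
Variables (N : 'I_n -> R -> T -> nat) (M : 'I_n * 'I_n -> R -> T -> nat).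

Definition poisson_clocks : Prop :=
  [/\ forall i, poisson_process 1 (N i),
      forall e, e \in E -> poisson_process (lam e) (M e)
    & mutually_independent
        [set c : 'I_n + 'I_n * 'I_n | if c is inr e then e \in E else true]%SET
        (fun c => match c with
                  | inl i => generated_by_process (N i)
                  | inr e => generated_by_process (M e)
                  end)].

End Clocks.

End Poisson.

Record params (R : realType) := Params {
  p_nu : R;
  p_eta : R; p_eta' : R;
  p_gamma : R; p_gamma' : R;
  p_theta : R;
  p_delta : R; p_delta' : R;
  p_alpha : R; p_alpha' : R;
  p_beta : R; p_beta' : R }.

(* Pathwise meaning of the stochastic differential system; nf and mf are the
   paths of the counting processes, and a primed name stands for a tilde. *)
Definition dadao_path (R : realType) (n d : nat) (p : params R)
    (f : 'I_n -> 'rV[R]_d -> R) (E : {set 'I_n * 'I_n})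
    (nf : 'I_n -> R -> R) (mf : 'I_n * 'I_n -> R -> R)
    (x x' y' y z z' : R -> 'M[R]_(n, d)) : Prop :=
  let event t := (exists i, jump (nf i) t != 0) \/
                 (exists2 e, e \in E & jump (mf e) t != 0) in
  let dN t (g : 'M[R]_(n, d)) : 'M[R]_(n, d) :=
    \matrix_(i < n) (jump (nf i) t *: row i g) in
  let oracle t := gradient_rows f (left_limit x t)
                  - p_nu p *: left_limit x t - left_limit y' t in
  let gossip t := \sum_(e in E) jump (mf e) t *:
                    (edge_mx R e *m (left_limit y t + left_limit z t)) in
  jump_ode event x
      (fun t => p_eta p *: (x' t - x t))
      (fun t => - (p_gamma p *: dN t (oracle t))) /\
  jump_ode event x'
      (fun t => p_eta' p *: (x t - x' t))
      (fun t => - (p_gamma' p *: dN t (oracle t))) /\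
  jump_ode event y'
      (fun t => - (p_theta p *: (y t + z t + p_nu p *: x' t)))
      (fun t => (p_delta p + p_delta' p) *: dN t (oracle t)) /\
  jump_ode event y
      (fun t => p_alpha p *: (y' t - y t))
      (fun t => 0) /\
  jump_ode event z
      (fun t => p_alpha p *: (z' t - z t))
      (fun t => - (p_beta p *: gossip t)) /\
  jump_ode event z'
      (fun t => p_alpha' p *: (z t - z' t))
      (fun t => - (p_beta' p *: gossip t)).

Section Process.
Variables (R : realType) (dT : measure_display) (T : measurableType dT).
Variables (P : probability T R) (n d : nat).

Definition dadao_process (p : params R) (mu : R)
    (f : 'I_n -> 'rV[R]_d -> R) (E : {set 'I_n * 'I_n})
    (N : 'I_n -> R -> T -> nat) (M : 'I_n * 'I_n -> R -> T -> nat)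
    (x0 : 'M[R]_(n, d)) (x x' y' y z z' : R -> T -> 'M[R]_(n, d)) : Prop :=
  let y0 := gradient_rows f x0 - (mu / 2) *: x0 in
  let z0 := - (centering R n *m y0) in
  [/\ random_matrices x /\ random_matrices x' /\ random_matrices y' /\
      random_matrices y /\ random_matrices z /\ random_matrices z',
      {ae P, forall w,
         x 0 w = x0 /\ x' 0 w = x0 /\ y 0 w = y0 /\ y' 0 w = y0 /\
         z 0 w = z0 /\ z' 0 w = z0}
    & {ae P, forall w,
         dadao_path p f E (fun i => real_path (N i) w)
           (fun e => real_path (M e) w)
           (x ^~ w) (x' ^~ w) (y' ^~ w) (y ^~ w) (z ^~ w) (z' ^~ w)}].

End Process.

(* Main.v *)
(* With q = sqrt(nu / L), a quadratic-plus-Bregman Lyapunov function [pot] of the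
   deviation from the fixed point has generator at most - (q / 8) pot, as long as
   z and z' have zero mean row. No stochastic calculus is needed to integrate
   this: cut [0, t] into 2^k cells and replace the process by the Markov chain
   which, in each cell, performs the jump of c if c is the only clock ringing and
   rings once, and an Euler step of the drift otherwise. The law of the counts on
   the grid is explicit, so the expectation of pot along the chain is a finite
   sum, bounded by exp(- q t / 8 + o(1)) pot(0) for a suitable Euler step.
   Almost surely every cell of a fine enough grid contains at most one event, and
   then the chain converges to the process at time t because drift and jumps are
   Lipschitz. Fatou's lemma concludes. *)
Require Import Defs.
From HB Require Import structures.
From mathcomp Require Import all_boot all_order all_algebra.
From mathcomp Require Import all_classical all_reals all_analysis.
From mathcomp Require Import measurable_realfun.
From mathcomp Require Import ring lra zify.

Set Implicit Arguments.
Unset Strict Implicit.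
Unset Printing Implicit Defensive.

Import Order.TTheory GRing.Theory Num.Theory.
Import numFieldNormedType.Exports.

Local Open Scope classical_set_scope.
Local Open Scope ring_scope.

(** * Convexity *)

(** With [q] = sqrt(nu / L), that is nu = L q^2, all parameters are rational in [q], [L] and
    [chi_1], and the rate q / 8 equals sqrt(mu / L) / (8 sqrt 2). The prefactor of the final bound
    is a quotient of two constants: an explicit multiple of |x0 - xs|^2 dominates [pot] at the
    start, and [pot] dominates 4 nu L |x - xs|^2 at any state. The process is known only through its
    paths: no filtration is given, so independence of its present state from future clock increments
    cannot be invoked. The chain has this independence by construction, being a function of the
    counts, and the pathwise limit carries its bound over to the process. Two errors have to vanish
    with the mesh. An Euler step adds a second-order term to [pot], which is harmless because
    [pot_quad] of the drift is itself at most a multiple of [pot]. A cell with an event makes an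
    error of first order in the mesh, which is harmless because a path has finitely many events
    before time t. The assumption on [chi_1] and [chi2] enters through a single coefficient: it
    keeps the second-order effect of gossip on [z'] below the contraction that gossip exerts on y +
    z. *)

Section Dot.
Variable R : realType.

Definition dot (m n : nat) (A B : 'M[R]_(m, n)) : R :=
  \sum_(i < m) \sum_(j < n) A i j * B i j.

Lemma frob_sqr m n (A : 'M[R]_(m, n)) : frob A ^+ 2 = dot A A.
Proof.
rewrite /frob sqr_sqrtr; last first.
  by apply: sumr_ge0 => i _; apply: sumr_ge0 => j _; exact: sqr_ge0.
by apply: eq_bigr => i _; apply: eq_bigr => j _; rewrite expr2.
Qed.

Lemma frob_ge0 m n (A : 'M[R]_(m, n)) : 0 <= frob A.
Proof. exact: sqrtr_ge0. Qed.

Lemma dot_ge0 m n (A : 'M[R]_(m, n)) : 0 <= dot A A.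
Proof. by rewrite -frob_sqr sqr_ge0. Qed.

Lemma dotC m n (A B : 'M[R]_(m, n)) : dot A B = dot B A.
Proof. by apply: eq_bigr => i _; apply: eq_bigr => j _; rewrite mulrC. Qed.

Lemma dotDl m n (A B C : 'M[R]_(m, n)) : dot (A + B) C = dot A C + dot B C.
Proof.
rewrite /dot -big_split; apply: eq_bigr => i _.
by rewrite -big_split; apply: eq_bigr => j _; rewrite mxE mulrDl.
Qed.

Lemma dotZl m n a (A B : 'M[R]_(m, n)) : dot (a *: A) B = a * dot A B.
Proof.
rewrite /dot mulr_sumr; apply: eq_bigr => i _; rewrite mulr_sumr.
by apply: eq_bigr => j _; rewrite mxE mulrA.
Qed.

Lemma dotDr m n (A B C : 'M[R]_(m, n)) : dot C (A + B) = dot C A + dot C B.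
Proof. by rewrite dotC dotDl !(dotC C). Qed.

Lemma dotZr m n a (A B : 'M[R]_(m, n)) : dot A (a *: B) = a * dot A B.
Proof. by rewrite dotC dotZl dotC. Qed.

Lemma dotNl m n (A B : 'M[R]_(m, n)) : dot (- A) B = - dot A B.
Proof. by rewrite -scaleN1r dotZl mulN1r. Qed.

Lemma dotNr m n (A B : 'M[R]_(m, n)) : dot A (- B) = - dot A B.
Proof. by rewrite dotC dotNl dotC. Qed.

Lemma dotBl m n (A B C : 'M[R]_(m, n)) : dot (A - B) C = dot A C - dot B C.
Proof. by rewrite dotDl dotNl. Qed.

Lemma dot0l m n (A : 'M[R]_(m, n)) : dot 0 A = 0.
Proof. by rewrite -(scale0r A) dotZl mul0r. Qed.

Lemma dot0r m n (A : 'M[R]_(m, n)) : dot A 0 = 0.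
Proof. by rewrite dotC dot0l. Qed.

Definition dotE := (dotDl, dotDr, dotNl, dotNr, dotZl, dotZr).

Lemma dot_eq0 m n (A : 'M[R]_(m, n)) : (dot A A == 0) = (A == 0).
Proof.
apply/eqP/eqP => [A0|->]; last exact: dot0l.
have P i : 0 <= \sum_(j < n) A i j * A i j.
  by apply: sumr_ge0 => j _; rewrite -expr2 sqr_ge0.
apply/matrixP => i j; rewrite mxE; apply/eqP.
move: A0 => /eqP; rewrite psumr_eq0 // => /allP/(_ i (mem_index_enum _)) /=.
rewrite psumr_eq0 => [|k _]; last by rewrite -expr2 sqr_ge0.
by move=> /allP/(_ j (mem_index_enum _)) /=; rewrite mulf_eq0 orbb.
Qed.

Lemma dot_suml m n (I : Type) (r : seq I) (Q : pred I)
    (A : I -> 'M[R]_(m, n)) (B : 'M[R]_(m, n)) :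
  dot (\sum_(i <- r | Q i) A i) B = \sum_(i <- r | Q i) dot (A i) B.
Proof.
apply: (big_morph (fun A => dot A B)) => [C D|]; first exact: dotDl.
exact: dot0l.
Qed.

Lemma dot_sumr m n (I : Type) (r : seq I) (Q : pred I)
    (A : I -> 'M[R]_(m, n)) (B : 'M[R]_(m, n)) :
  dot B (\sum_(i <- r | Q i) A i) = \sum_(i <- r | Q i) dot B (A i).
Proof. by rewrite dotC dot_suml; apply: eq_bigr => i _; rewrite dotC. Qed.

Lemma dot_tr m n (A B : 'M[R]_(m, n)) : dot A B = \tr (A^T *m B).
Proof.
rewrite /dot exchange_big; apply: eq_bigr => j _.
by rewrite !mxE; apply: eq_bigr => i _; rewrite mxE.
Qed.

Lemma dot_mulmxl m n p (K : 'M[R]_(m, p)) (A : 'M[R]_(p, n)) (B : 'M[R]_(m, n)) :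
  dot (K *m A) B = dot A (K^T *m B).
Proof. by rewrite !dot_tr trmx_mul mulmxA. Qed.

Lemma dot_rows m n (A B : 'M[R]_(m, n)) :
  dot A B = \sum_(i < m) dot (row i A) (row i B).
Proof.
apply: eq_bigr => i _; rewrite /dot big_ord1.
by apply: eq_bigr => j _; rewrite !mxE.
Qed.

Lemma dot_cols m n (A B : 'M[R]_(m, n)) :
  dot A B = \sum_(j < n) dot (col j A) (col j B).
Proof.
rewrite /dot exchange_big; apply: eq_bigr => j _.
by apply: eq_bigr => i _; rewrite big_ord1 !mxE.
Qed.

Lemma dotDD_le m n (A B : 'M[R]_(m, n)) :
  dot (A + B) (A + B) <= 2 * (dot A A + dot B B).
Proof. by have := dot_ge0 (A - B); rewrite !dotE (dotC B A); lra. Qed.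

Lemma dotBB_le m n (A B : 'M[R]_(m, n)) :
  dot (A - B) (A - B) <= 2 * (dot A A + dot B B).
Proof. by have := dotDD_le A (- B); rewrite [dot (- B) _]dotNl dotNr opprK. Qed.

(** Expanding |A - c B|^2 >= 0 gives Cauchy-Schwarz in the form needed later, without square roots;
    [dot_coco] rests on the same expansion. *)
Lemma dot_le_scale m n (A B : 'M[R]_(m, n)) (c : R) : 0 < c ->
  dot A A <= c ^+ 2 * dot B B -> dot A B <= c * dot B B.
Proof.
move=> c0 AB; have := dot_ge0 (A - c *: B); rewrite !dotE (dotC B A) => h.
by rewrite -(ler_pM2l c0); lra.
Qed.

Lemma dot_coco m n (A B : 'M[R]_(m, n)) (c : R) : 0 < c ->
  dot A A <= c * dot A B -> dot A A <= c ^+ 2 * dot B B.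
Proof.
by move=> c0 AB; have := dot_ge0 (A - c *: B); rewrite !dotE (dotC B A); lra.
Qed.

Lemma dot_subC m n (A B : 'M[R]_(m, n)) :
  dot (A - B) (A - B) = dot (B - A) (B - A).
Proof. by rewrite -opprB dotNl dotNr opprK. Qed.

Lemma dot_young m n (A B : 'M[R]_(m, n)) : 2 * dot A B <= dot A A + dot B B.
Proof. by have := dot_ge0 (A - B); rewrite !dotE (dotC B A); lra. Qed.

End Dot.

Section Convex.
Variables (R : realType) (d : nat).
Implicit Types (f : 'rV[R]_d -> R) (u v w : 'rV[R]_d).

(** [gradient] only collects derivatives along the canonical basis; linearity of the differential
    extends them to all directions. *)
Lemma deriv_gradient f u w : differentiable f u ->
  is_derive u w f (dot (gradient f u) w).
Proof.
move=> df; apply: DeriveDef; first exact: diff_derivable.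
rewrite deriveE //.
rewrite [in LHS](row_sum_delta w) linear_sum /dot big_ord1.
by apply: eq_bigr => j _; rewrite linearZ /= mxE deriveE // mulrC.
Qed.

Lemma is_derive_along f u w (t : R) : (forall u, differentiable f u) ->
  is_derive t 1 (fun s => f (u + s *: w)) (dot (gradient f (u + t *: w)) w).
Proof.
move=> df.
have [h1 h2] := deriv_gradient w (df (u + t *: w)).
(* Both derivatives have the same difference quotient, so no chain rule is needed. *)
have eqf : (fun h => h^-1 *: (f (h *: w + (u + t *: w)) - f (u + t *: w))) =
  (fun h => h^-1 *: (f (u + (h *: 1 + t) *: w) - f (u + t *: w))).
  apply/funext => h; congr (_ *: (f _ - _)).
  by rewrite [h *: 1]mulr1 scalerDl; exact: addrCA.
apply: DeriveDef.
  by move: h1; rewrite /derivable /= eqf.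
by rewrite -h2 /derive /= eqf.
Qed.

(** The defining inequality on the segment from [u] to [v], divided by the weight [h] of [v], passes
    to the limit as [h] decreases to 0. *)
Lemma strongly_convex_gradient mu f : strongly_convex mu f ->
    (forall u, differentiable f u) ->
  forall u v, f u + dot (gradient f u) (v - u) + mu / 2 * dot (v - u) (v - u)
    <= f v.
Proof.
move=> cf df u v.
set w := v - u.
have [h1 h2] := is_derive_along u w 0 df.
rewrite scale0r addr0 in h2.
have hc : (h^-1 * (f (u + h *: w) - f u)) @[h --> 0^'] --> dot (gradient f u) w.
  move: h1; rewrite -h2 /derivable /derive /=.
  rewrite scale0r addr0.
  by under eq_fun do rewrite [_ *: 1]mulr1 addr0.
have hc2 := cvg_dnbhs_at_right hc.
have hr : (f v - f u - mu / 2 * (1 - h) * dot w w) @[h --> (0:R)^'+] -->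
    f v - f u - mu / 2 * (1 - 0) * dot w w.
  apply: cvg_at_right_filter.
  apply: cvgB; first exact: cvg_cst.
  apply: cvgM; last exact: cvg_cst.
  apply: cvgM; first exact: cvg_cst.
  by apply: cvgB; [exact: cvg_cst|exact: cvg_id].
suff: dot (gradient f u) w <= f v - f u - mu / 2 * (1 - 0) * dot w w by lra.
apply: (ler_cvg_to hc2 hr).
near=> h.
have h0 : 0 < h by [].
have h1' : h <= 1 by near: h; exact: nbhs_right_le.
have h01 : 0 <= h <= 1 by rewrite ltW.
have := cf v u h h01.
have -> : h *: v + (1 - h) *: u = u + h *: w.
  by rewrite /w scalerBl scale1r scalerBr addrCA addrA.
rewrite frob_sqr -/w => Hf.
by rewrite mulrC ler_pdivrMr //; lra.
Unshelve. all: by end_near.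
Qed.

Lemma descent L f : smooth L f -> 0 < L -> forall u v,
  f v <= f u + dot (gradient f u) (v - u) + L / 2 * dot (v - u) (v - u).
Proof.
move=> [df sf] L0 u v; set w := v - u.
(* The claim is [psi 1 <= psi 0]; the Lipschitz gradient makes the derivative [dpsi] nonpositive at
   positive times. *)
pose psi (t : R) := f (u + t *: w) - t * dot (gradient f u) w
  - L / 2 * t ^+ 2 * dot w w.
pose dpsi (t : R) := dot (gradient f (u + t *: w)) w - dot (gradient f u) w
  - L * t * dot w w.
have dP (t : R) : is_derive t 1 psi (dpsi t).
  have h := is_derive_along u w t df.
  rewrite /psi; apply: is_derive_eq.
  by rewrite /dpsi /GRing.scale /=; lra.
have dle (t : R) : 0 < t -> dpsi t <= 0.
  move=> t0.
  set A := gradient f (u + t *: w) - gradient f u.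
  have hA : dot A A <= (L * t) ^+ 2 * dot w w.
    rewrite -!frob_sqr.
    have := sf (u + t *: w) u; rewrite -/A addrAC subrr add0r => h.
    have h2 : frob (t *: w) = t * frob w.
      apply: (pexpIrn (n := 2)); rewrite ?nnegrE ?frob_ge0 //.
        by rewrite mulr_ge0 ?frob_ge0 // ltW.
      by rewrite exprMn !frob_sqr dotZl dotZr mulrA -expr2.
    rewrite h2 in h.
    rewrite -exprMn -mulrA; apply: lerXn2r h; rewrite nnegrE ?frob_ge0 //.
    by rewrite !mulr_ge0 ?frob_ge0 // ltW.
  have Lt0 : 0 < L * t by rewrite mulr_gt0.
  by rewrite /dpsi -dotBl -/A subr_le0; exact: dot_le_scale.
have : psi 1 <= psi 0.
  have cpsi : {within `[0, 1], continuous psi}.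
    by apply: derivable_within_continuous => x _; have [] := dP x.
  have [c] := MVT ltr01 (fun x _ => dP x) cpsi.
  rewrite in_itv /= => /andP[c0 _] E.
  by rewrite -subr_le0 E subr0 mulr1; exact: dle.
rewrite /psi scale1r scale0r addr0.
have -> : u + w = v by rewrite addrC subrK.
lra.
Qed.

End Convex.

(** * Bregman divergence of the objective minus half of its strong convexity *)

Section Bregman.
Variables (R : realType) (n d : nat) (mu nu L : R).
Variable f : 'I_n -> 'rV[R]_d -> R.
Hypothesis mu_nu : mu = 2 * nu.
Hypothesis nu0 : 0 < nu.
Hypothesis L0 : 0 < L.
Hypothesis convex_f : forall i, strongly_convex mu (f i).
Hypothesis smooth_f : forall i, smooth L (f i).
Implicit Types x y u : 'M[R]_(n, d).

(** Since mu = 2 nu, half of the strong convexity is left after the subtraction. The oracle of the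
    dynamics is the gradient of this function minus [y']. *)
Definition shifted x : R := \sum_(i < n) f i (row i x) - nu / 2 * dot x x.

Definition shifted_grad x : 'M[R]_(n, d) := gradient_rows f x - nu *: x.

Definition bregman x y : R :=
  shifted x - shifted y - dot (shifted_grad y) (x - y).

Lemma bregman_3points x y u :
  bregman u y =
  bregman u x + bregman x y + dot (shifted_grad x - shifted_grad y) (u - x).
Proof. rewrite /bregman !dotE; ring. Qed.

Lemma bregman_sum x y :
  bregman x y = \sum_(i < n)
    (f i (row i x) - f i (row i y)
     - dot (gradient (f i) (row i y)) (row i x - row i y))
  - nu / 2 * dot (x - y) (x - y).
Proof.
rewrite !big_split /= !sumrN.
have -> : \sum_(i < n) dot (gradient (f i) (row i y)) (row i x - row i y) =
    dot (gradient_rows f y) (x - y).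
  by rewrite dot_rows; apply: eq_bigr => i _; rewrite rowK linearB.
rewrite /bregman /shifted /shifted_grad !dotE (dotC y x); lra.
Qed.

Lemma bregman_lb x y : nu / 2 * dot (x - y) (x - y) <= bregman x y.
Proof.
have : mu / 2 * dot (x - y) (x - y) <= \sum_(i < n)
    (f i (row i x) - f i (row i y)
     - dot (gradient (f i) (row i y)) (row i x - row i y)).
  rewrite dot_rows mulr_sumr; apply: ler_sum => i _.
  have [df _] := smooth_f i.
  have := strongly_convex_gradient (convex_f i) df (row i y) (row i x).
  by rewrite linearB; lra.
by rewrite bregman_sum mu_nu; lra.
Qed.

Lemma bregman_ge0 x y : 0 <= bregman x y.
Proof.
apply: le_trans (bregman_lb x y).
by rewrite mulr_ge0 ?dot_ge0 // divr_ge0 // ltW.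
Qed.

Lemma bregman_ub x y : bregman x y <= L / 2 * dot (x - y) (x - y).
Proof.
rewrite bregman_sum.
have h : 0 <= nu / 2 * dot (x - y) (x - y).
  by rewrite mulr_ge0 ?dot_ge0 // divr_ge0 // ltW.
rewrite lerBlDr; apply: ler_wpDr => //.
rewrite dot_rows mulr_sumr; apply: ler_sum => i _.
have := descent (smooth_f i) L0 (row i y) (row i x).
by rewrite linearB; lra.
Qed.

(** The three-point identity gives the exact first-order change, and smoothness bounds the
    remainder. Both the jumps and the Euler steps of [x] are controlled this way. *)
Lemma bregmanB x y u :
  bregman (x - u) y <=
  bregman x y - dot (shifted_grad x - shifted_grad y) u + L / 2 * dot u u.
Proof.
rewrite (bregman_3points x); have := bregman_ub (x - u) x.
have -> : x - u - x = - u by rewrite addrAC subrr add0r.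
by rewrite (dotNl u) !dotNr opprK; lra.
Qed.

(** With g the gradient difference, the divergence is still nonnegative at x - g / L, the point that
    minimises the quadratic upper bound of [bregmanB]. *)
Lemma bregman_coco x y :
  dot (shifted_grad x - shifted_grad y) (shifted_grad x - shifted_grad y) <=
  2 * L * bregman x y.
Proof.
have := bregmanB x y (L^-1 *: (shifted_grad x - shifted_grad y)).
move: (shifted_grad x - shifted_grad y) (bregman_ge0
  (x - L^-1 *: (shifted_grad x - shifted_grad y)) y) => g h0 h1.
have := le_trans h0 h1; rewrite !(dotZl, dotZr) => h.
have : 0 <= 2 * L * (bregman x y - L^-1 * dot g g
    + L / 2 * (L^-1 * (L^-1 * dot g g))).
  by rewrite mulr_ge0 // mulr_ge0 // ltW.
have -> : 2 * L * (bregman x y - L^-1 * dot g g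
    + L / 2 * (L^-1 * (L^-1 * dot g g))) = 2 * L * bregman x y - dot g g.
  by field; rewrite gt_eqF.
by lra.
Qed.

Lemma bregman_sym x y :
  bregman x y + bregman y x = dot (shifted_grad x - shifted_grad y) (x - y).
Proof. by rewrite /bregman !dotE; ring. Qed.

(** Adding [bregman_coco] in both directions gives |g|^2 <= L <g, x - y> for the gradient difference
    g, and Cauchy-Schwarz concludes. *)
Lemma shifted_grad_lip x y :
  dot (shifted_grad x - shifted_grad y) (shifted_grad x - shifted_grad y) <=
  L ^+ 2 * dot (x - y) (x - y).
Proof.
have h1 := bregman_coco x y; have h2 := bregman_coco y x.
rewrite -opprB dotNl dotNr opprK in h2.
have h3 := bregman_sym x y.
by apply: dot_coco => //; rewrite -h3; lra.
Qed.

End Bregman.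

(** A small gradient step from the minimizer would lower the sum unless the total gradient
    vanishes. *)
Lemma minimizer_gradient (R : realType) (n d : nat) (L : R)
    (f : 'I_n -> 'rV[R]_d -> R) (ustar : 'rV[R]_d) : 0 < L ->
    (forall i, smooth L (f i)) ->
    (forall u, \sum_(i < n) f i ustar <= \sum_(i < n) f i u) ->
  \sum_(i < n) gradient (f i) ustar = 0.
Proof.
move=> L0 sf min; set g := \sum_(i < n) _.
apply/eqP; rewrite -dot_eq0; apply/eqP/le_anti; rewrite dot_ge0 andbT.
have nL0 : 0 < n.+1%:R * L by rewrite mulr_gt0.
(* With [n.+1] in place of [n] the step is defined for [n] = 0 too; n L s <= 1 still holds, so the
   quadratic term uses up at most half of the decrease. *)
pose s := (n.+1%:R * L)^-1.
have s0 : 0 < s by rewrite invr_gt0.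
have h : \sum_(i < n) f i (ustar - s *: g) <=
    \sum_(i < n) f i ustar - s * dot g g + n%:R * (L / 2 * (s * (s * dot g g))).
  have -> : \sum_(i < n) f i ustar - s * dot g g
      + n%:R * (L / 2 * (s * (s * dot g g))) =
    \sum_(i < n) (f i ustar - s * dot (gradient (f i) ustar) g
      + L / 2 * (s * (s * dot g g))).
    rewrite !big_split /= sumr_const card_ord sumrN -mulr_sumr.
    by rewrite -dot_suml mulr_natl.
  apply: ler_sum => i _.
  have := descent (sf i) L0 ustar (ustar - s *: g).
  have -> : ustar - s *: g - ustar = - (s *: g) by rewrite addrAC subrr add0r.
  by rewrite (dotNl (s *: g)) !dotNr opprK !dotZl !dotZr.
have := le_trans (min _) h.
have h2 : n%:R * (L / 2 * (s * (s * dot g g))) <= s / 2 * dot g g.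
  have -> : n%:R * (L / 2 * (s * (s * dot g g))) =
    (n%:R * L * s) * (s / 2 * dot g g) by ring.
  rewrite -[leRHS]mul1r ler_wpM2r //.
    by rewrite mulr_ge0 ?dot_ge0 // divr_ge0 // ltW.
  by rewrite /s ler_pdivrMr // mul1r ler_pM2r // ler_nat.
move=> h3; have : 0 <= s * (- dot g g) by lra.
by rewrite pmulr_rge0 // oppr_ge0.
Qed.

(** * Graph Laplacian and its pseudo-inverse *)

Section Graph.
Variables (R : realType) (n : nat) (E : {set 'I_n * 'I_n}).
Variable lam : 'I_n * 'I_n -> R.
Hypothesis hE : forall e, e \in E -> e.1 != e.2.
Hypothesis hlam : forall e, e \in E -> 0 < lam e.
Let Lam := laplacian E lam.
Let Lp := pseudo_inverse Lam.

Lemma edge_vecE (e : 'I_n * 'I_n) i j :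
  edge_vec R e i j = (i == e.1)%:R - (i == e.2)%:R.
Proof. by rewrite !mxE !ord1 !eqxx !andbT. Qed.

Lemma edge_mx_tr e : (edge_mx R (n := n) e)^T = edge_mx R e.
Proof. by rewrite /edge_mx trmx_mul trmxK. Qed.

Lemma laplacian_tr : Lam^T = Lam.
Proof.
rewrite /Lam /laplacian linear_sum; apply: eq_bigr => e _.
by rewrite linearZ /= edge_mx_tr.
Qed.

Lemma edge_vec_ones e : (edge_vec R e)^T *m ones R n = 0.
Proof.
apply/matrixP => i j; rewrite mxE.
under eq_bigr do rewrite mxE edge_vecE mxE mulr1.
rewrite sumrB [X in _ - X](bigD1 e.2) //= [X in X - _](bigD1 e.1) //= !eqxx.
rewrite big1 ?big1 ?addr0 ?subrr ?mxE // => k /negPf -> //.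
Qed.

Lemma laplacian_ones : Lam *m ones R n = 0.
Proof.
rewrite /Lam /laplacian mulmx_suml big1 // => e _.
by rewrite -scalemxAl /edge_mx -mulmxA edge_vec_ones mulmx0 scaler0.
Qed.

Lemma ones_laplacian : (ones R n)^T *m Lam = 0.
Proof. by apply: trmx_inj; rewrite trmx_mul trmxK laplacian_tr laplacian_ones trmx0. Qed.

Lemma ones_edge_mx e : (ones R n)^T *m edge_mx R e = 0.
Proof.
rewrite /edge_mx mulmxA.
have -> : (ones R n)^T *m edge_vec R e = 0.
  by apply: trmx_inj; rewrite trmx_mul trmxK edge_vec_ones trmx0.
by rewrite mul0mx.
Qed.

Lemma edge_vec_sqr (e : 'I_n * 'I_n) : e.1 != e.2 ->
  (edge_vec R e)^T *m edge_vec R e = 2%:M.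
Proof.
move=> ne; apply/matrixP => i j; rewrite !mxE !ord1 eqxx mulr1n.
under eq_bigr do rewrite mxE !edge_vecE.
rewrite (bigD1 e.1) //= (bigD1 e.2) /=; last by rewrite eq_sym.
rewrite big1 => [|k /andP[/negPf -> /negPf ->]]; last by rewrite subrr mul0r.
by rewrite !eqxx (negPf ne) [e.2 == e.1]eq_sym (negPf ne) /=; ring.
Qed.

Lemma edge_mx_sqr e : e.1 != e.2 ->
  edge_mx R (n := n) e *m edge_mx R e = 2 *: edge_mx R e.
Proof.
move=> ne; rewrite /edge_mx mulmxA -(mulmxA (edge_vec R e)).
rewrite edge_vec_sqr //.
by rewrite mul_mx_scalar scalemxAl.
Qed.

Lemma dot_laplacian d (U V : 'M[R]_(n, d)) :
  dot U (Lam *m V) = \sum_(e in E) lam e * dot U (edge_mx R e *m V).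
Proof.
rewrite /Lam /laplacian mulmx_suml dot_sumr; apply: eq_bigr => e _.
by rewrite -scalemxAl dotZr.
Qed.

Lemma dot_edge_mx e d (U V : 'M[R]_(n, d)) : dot U (edge_mx R e *m V) =
  dot ((edge_vec R e)^T *m U) ((edge_vec R e)^T *m V).
Proof. by rewrite /edge_mx -mulmxA dotC dot_mulmxl dotC. Qed.

Lemma dot_edge_mx_sqr e d (U : 'M[R]_(n, d)) : e.1 != e.2 ->
  dot (edge_mx R e *m U) (edge_mx R e *m U) = 2 * dot U (edge_mx R e *m U).
Proof.
by move=> ne; rewrite dot_mulmxl edge_mx_tr mulmxA edge_mx_sqr // -scalemxAl dotZr.
Qed.

Lemma dot_laplacian_ge0 d (U : 'M[R]_(n, d)) : 0 <= dot U (Lam *m U).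
Proof.
rewrite dot_laplacian; apply: sumr_ge0 => e eE.
by rewrite dot_edge_mx mulr_ge0 ?dot_ge0 // ltW // hlam.
Qed.

(** Jensen's inequality would give the factor [\sum_(i in A) c i]; adding 1 makes it positive, so
    that it can be cancelled. The size of the factor is irrelevant: it only ends up in the constant
    of the Euler remainder. *)
Lemma dot_sum_scale d (I : finType) (A : {set I}) (c : I -> R) (F : I -> 'M[R]_(n, d)) :
  (forall i, i \in A -> 0 <= c i) ->
  dot (\sum_(i in A) c i *: F i) (\sum_(i in A) c i *: F i) <=
    (1 + \sum_(i in A) c i) * \sum_(i in A) c i * dot (F i) (F i).
Proof.
move=> c0; set s := \sum_(i in A) c i.
have [S SE] : exists S, S = \sum_(i in A) c i *: F i by eexists.
rewrite -SE.
have s0 : 0 <= s by apply: sumr_ge0.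
have s1 : 0 < 1 + s by rewrite ltr_pwDl.
have h : 2 * (1 + s) * dot S S <=
    (1 + s) ^+ 2 * (\sum_(i in A) c i * dot (F i) (F i)) + s * dot S S.
  rewrite {1}SE dot_suml mulr_sumr mulr_sumr /s mulr_suml -/s -big_split /=.
  apply: ler_sum => i iA; rewrite dotZl.
  have := dot_young ((1 + s) *: F i) S; rewrite !dotZl dotZr => h.
  have := ler_wpM2l (c0 _ iA) h; lra.
rewrite -(ler_pM2l s1).
have := dot_ge0 S; lra.
Qed.

Definition rate_bound : R := 2 * (1 + \sum_(e in E) lam e).

Lemma laplacian_bound d (U : 'M[R]_(n, d)) :
  dot (Lam *m U) (Lam *m U) <= rate_bound * dot U (Lam *m U).
Proof.
have -> : Lam *m U = \sum_(e in E) lam e *: (edge_mx R e *m U).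
  by rewrite mulmx_suml; apply: eq_bigr => e _; rewrite -scalemxAl.
apply: (le_trans (dot_sum_scale _ _)); first by move=> e /hlam /ltW.
rewrite dot_sumr /rate_bound -mulrA [leRHS]mulrCA ler_wpM2l //.
  by rewrite addr_ge0 // sumr_ge0 // => e /hlam /ltW.
rewrite mulr_sumr; apply: ler_sum => e eE.
by rewrite dot_edge_mx_sqr ?hE // dotZr; lra.
Qed.

Variable chi_1 : R.
Hypothesis hchi1 : chi1 Lam = chi_1%:E.

(** Scaling to the unit sphere turns the supremum into a spectral gap on the orthogonal complement
    of the all-ones vector. *)
Lemma chi1_vec (x : 'cV[R]_n) : (ones R n)^T *m x = 0 ->
  dot x x <= chi_1 * dot x (Lam *m x).
Proof.
move=> x1; have [->|x0] := eqVneq x 0; first by rewrite !dot0l mulr0.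
have qE (y : 'cV[R]_n) : (y^T *m Lam *m y) 0 0 = dot y (Lam *m y).
  by rewrite dot_tr mulmxA /mxtrace big_ord1.
have r0 : 0 < frob x.
  rewrite lt_neqAle frob_ge0 andbT eq_sym -sqrf_eq0 frob_sqr dot_eq0 //.
set r := frob x in r0.
have : ((((r^-1 *: x)^T *m Lam *m (r^-1 *: x)) 0 0)%:E^-1 <= chi_1%:E)%E.
  rewrite -hchi1; apply: ereal_sup_ubound; exists (r^-1 *: x) => //; split.
    have : frob (r^-1 *: x) ^+ 2 = 1.
      rewrite frob_sqr dotZl dotZr -frob_sqr -/r; field.
      by rewrite gt_eqF.
    move/eqP; rewrite sqrf_eq1 => /orP[/eqP //|/eqP h].
    by have := frob_ge0 (r^-1 *: x); rewrite h oppr_ge0 ler10.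
  by rewrite -scalemxAr x1 scaler0 mxE.
rewrite qE -scalemxAr dotZl dotZr inver.
(* A vanishing quadratic form would have inverse +oo, which is not below the real number [chi_1]:
   this is where finiteness of [chi1] acts. *)
case: eqP => // /eqP a0; rewrite lee_fin.
have D0 := dot_laplacian_ge0 x.
have a1 : 0 < r^-1 * (r^-1 * dot x (Lam *m x)).
  rewrite lt_neqAle eq_sym a0 /= mulr_ge0 // ?mulr_ge0 // invr_ge0 ltW //.
move=> h; have := ler_wpM2r (ltW a1) h; rewrite mulVf ?gt_eqF // => {}h.
have := ler_wpM2l (sqr_ge0 r) h; rewrite mulr1 -{1}frob_sqr -/r => {}h.
apply: (le_trans h); rewrite le_eqVlt; apply/orP; left; apply/eqP.
by field; rewrite gt_eqF.
Qed.

Lemma chi1_dot d (U : 'M[R]_(n, d)) : (ones R n)^T *m U = 0 ->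
  dot U U <= chi_1 * dot U (Lam *m U).
Proof.
move=> U1; rewrite !dot_cols mulr_sumr; apply: ler_sum => j _.
rewrite !colE -mulmxA; apply: chi1_vec.
by rewrite mulmxA U1 mul0mx.
Qed.

(** The spectral gap is tested on a difference of two basis vectors, a nonzero vector orthogonal to
    the all-ones vector that exists as soon as [n] is at least 2. *)
Lemma chi1_gt0 : (2 <= n)%N -> 0 < chi_1.
Proof.
move=> n2.
have n0 : (0 < n)%N by apply: leq_trans n2.
pose e := (Ordinal n0, Ordinal n2).
have ne : e.1 != e.2 by rewrite -val_eqE.
have e1 : (ones R n)^T *m edge_vec R e = 0.
  by apply: trmx_inj; rewrite trmx_mul trmxK edge_vec_ones trmx0.
have h := chi1_vec e1.
have e0 : 0 < dot (edge_vec R e) (edge_vec R e).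
  rewrite lt_neqAle dot_ge0 andbT eq_sym dot_eq0; apply/eqP => /matrixP.
  move=> /(_ e.1 0); rewrite edge_vecE eqxx (negPf ne) subr0 mxE => /eqP.
  by rewrite oner_eq0.
have := lt_le_trans e0 h; rewrite pmulr_lgt0 //.
rewrite lt_neqAle dot_laplacian_ge0 andbT eq_sym.
apply/eqP => h0; move: h; rewrite h0 mulr0 => h.
by move: (lt_le_trans e0 h); rewrite ltxx.
Qed.

Let LpP : penrose Lam Lp := pseudo_inverseP Lam.

(** The Laplacian being symmetric, the transpose solves the same Penrose equations. *)
Lemma pseudo_inverse_tr : Lp^T = Lp.
Proof.
have [h1 h2 h3 h4] := LpP; have lt := laplacian_tr.
apply: (@penrose_unique _ _ _ Lam) => //; split.
- by apply: trmx_inj; rewrite !trmx_mul trmxK lt mulmxA h1.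
- by rewrite -[in RHS]h2 !trmx_mul lt mulmxA.
- by rewrite trmx_mul trmxK lt -[in RHS]lt -trmx_mul h4.
- by rewrite trmx_mul trmxK lt -[in RHS]lt -trmx_mul h3.
Qed.

Lemma pseudo_inverse_comm : Lp *m Lam = Lam *m Lp.
Proof.
have [_ _ _ h4] := LpP.
by rewrite -h4 trmx_mul pseudo_inverse_tr laplacian_tr.
Qed.

Lemma pseudo_inverse_ones : (ones R n)^T *m Lp = 0.
Proof.
have [_ h2 _ _] := LpP.
by rewrite -h2 pseudo_inverse_comm !mulmxA ones_laplacian !mul0mx.
Qed.

(** The difference of the two sides is centered and killed by the Laplacian, so the spectral gap
    forces it to vanish. *)
Lemma pseudo_inverseK d (Z : 'M[R]_(n, d)) : (ones R n)^T *m Z = 0 ->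
  Lp *m (Lam *m Z) = Z.
Proof.
move=> Z1; have [h1 _ _ _] := LpP.
have v1 : (ones R n)^T *m (Z - Lp *m (Lam *m Z)) = 0.
  by rewrite mulmxBr Z1 !mulmxA pseudo_inverse_ones !mul0mx subr0.
have := chi1_dot v1; rewrite [Lam *m (_ - _)]mulmxBr !mulmxA h1 subrr dot0r mulr0.
rewrite -mulmxA => h; apply/esym/eqP; rewrite -subr_eq0 -dot_eq0.
by apply/eqP/le_anti; rewrite h dot_ge0.
Qed.

Definition dual_dot d (U V : 'M[R]_(n, d)) := dot U (Lp *m V).

Lemma dual_dotC d (U V : 'M[R]_(n, d)) : dual_dot U V = dual_dot V U.
Proof. by rewrite /dual_dot dotC dot_mulmxl pseudo_inverse_tr. Qed.

Lemma dual_dotE d (U V : 'M[R]_(n, d)) :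
  dual_dot U V = dot (Lp *m U) (Lam *m (Lp *m V)).
Proof.
have [_ h2 _ _] := LpP.
by rewrite dot_mulmxl pseudo_inverse_tr !mulmxA h2.
Qed.

Lemma dual_dot_ge0 d (U : 'M[R]_(n, d)) : 0 <= dual_dot U U.
Proof. by rewrite dual_dotE dot_laplacian_ge0. Qed.

Lemma dual_dotBB_le d (U V : 'M[R]_(n, d)) :
  dual_dot (U - V) (U - V) <= 2 * (dual_dot U U + dual_dot V V).
Proof.
have := dual_dot_ge0 (U + V); have := dual_dotC V U.
by rewrite /dual_dot mulmxBr mulmxDr !dotE => ->; lra.
Qed.

Lemma dual_dot_laplacian d (U V : 'M[R]_(n, d)) : (ones R n)^T *m U = 0 ->
  dual_dot U (Lam *m V) = dot U V.
Proof.
move=> U1; rewrite /dual_dot mulmxA pseudo_inverse_comm -mulmxA.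
rewrite dotC dot_mulmxl laplacian_tr dot_mulmxl pseudo_inverse_tr.
by rewrite pseudo_inverseK // dotC.
Qed.

(** For V = [Lp *m U] the spectral gap reads |V|^2 <= chi_1 <V, U>; hence |V| <= chi_1 |U|, and
    Cauchy-Schwarz bounds <U, V>. *)
Lemma dual_dot_ub d (U : 'M[R]_(n, d)) : 0 < chi_1 -> (ones R n)^T *m U = 0 ->
  dual_dot U U <= chi_1 * dot U U.
Proof.
move=> c0 U1.
have p1 : (ones R n)^T *m (Lp *m U) = 0 by rewrite mulmxA pseudo_inverse_ones mul0mx.
have := chi1_dot p1; rewrite -dual_dotE /dual_dot => h.
rewrite dotC; apply: dot_le_scale => //; apply: dot_coco => //.
by rewrite [dot _ U]dotC.
Qed.

Lemma dual_dot_lb d (U : 'M[R]_(n, d)) : (ones R n)^T *m U = 0 ->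
  dot U U <= rate_bound * dual_dot U U.
Proof.
move=> U1; have := laplacian_bound (Lp *m U); rewrite -dual_dotE.
by rewrite mulmxA -pseudo_inverse_comm -mulmxA pseudo_inverseK.
Qed.

Lemma chi2_edge e : e \in E ->
  ((edge_vec R e)^T *m Lp *m edge_vec R e) 0 0 <= 2 * chi2 E Lam.
Proof.
move=> eE; rewrite /chi2 mulrA divff // mul1r.
pose F e := ((edge_vec R e)^T *m Lp *m edge_vec R e) 0 0.
apply: ub_le_sup; last by exists e.
(* [sup] dominates the elements only of a bounded set; for this finite set the sum of absolute
   values is a convenient bound. *)
exists (\sum_(e in E) `|F e|) => _ [e' e'E <-].
rewrite (bigD1 e') //=; apply: ler_wpDr; last exact: ler_norm.
by apply: sumr_ge0.
Qed.

(** [edge_mx] has the rank-one form v v^T, so one factor v^T [Lp] v, the effective resistance of the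
    edge, comes out of the dual square; [chi2] bounds it. *)
Lemma dual_dot_edge_mx d e (U : 'M[R]_(n, d)) : e \in E ->
  dual_dot (edge_mx R e *m U) (edge_mx R e *m U) <=
    2 * chi2 E Lam * dot U (edge_mx R e *m U).
Proof.
move=> eE; rewrite /dual_dot dot_mulmxl edge_mx_tr.
have -> : edge_mx R e *m (Lp *m (edge_mx R e *m U)) =
    ((edge_vec R e)^T *m Lp *m edge_vec R e) 0 0 *: (edge_mx R e *m U).
  have := mx11_scalar ((edge_vec R e)^T *m Lp *m edge_vec R e).
  move: (_ 0 0) => c hc.
  by rewrite /edge_mx -!mulmxA (mulmxA _ Lp) (mulmxA (_ *m Lp)) hc
    mul_scalar_mx -scalemxAr.
by rewrite dotZr ler_wpM2r ?chi2_edge // dot_edge_mx dot_ge0.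
Qed.

End Graph.

(** * Lyapunov function *)

Definition state (R : realType) (n d : nat) : Type :=
  ('M[R]_(n, d) * 'M[R]_(n, d) * 'M[R]_(n, d) * 'M[R]_(n, d) * 'M[R]_(n, d)
   * 'M[R]_(n, d))%type.

Notation st_x S := (S.1.1.1.1.1) (only parsing).
Notation st_x' S := (S.1.1.1.1.2) (only parsing).
Notation st_y' S := (S.1.1.1.2) (only parsing).
Notation st_y S := (S.1.1.2) (only parsing).
Notation st_z S := (S.1.2) (only parsing).
Notation st_z' S := (S.2) (only parsing).

Section Dynamics.
Variables (R : realType) (n d : nat) (p : params R).
Variable f : 'I_n -> 'rV[R]_d -> R.
Implicit Types S : state R n d.

Definition drift S : state R n d :=
  (p_eta p *: (st_x' S - st_x S),
   p_eta' p *: (st_x S - st_x' S),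
   - (p_theta p *: (st_y S + st_z S + p_nu p *: st_x' S)),
   p_alpha p *: (st_y' S - st_y S),
   p_alpha p *: (st_z' S - st_z S),
   p_alpha' p *: (st_z S - st_z' S)).

Definition oracle S : 'M[R]_(n, d) :=
  gradient_rows f (st_x S) - p_nu p *: st_x S - st_y' S.

(** A ring of clock [i] changes row [i] only. Written as left multiplication by a projector, the
    restriction is linear, its images for distinct [i] are orthogonal, and the projectors add up to
    the identity. *)
Definition row_only (i : 'I_n) (g : 'M[R]_(n, d)) : 'M[R]_(n, d) :=
  delta_mx i i *m g.

Definition oracle_jump (i : 'I_n) S : state R n d :=
  (- (p_gamma p *: row_only i (oracle S)),
   - (p_gamma' p *: row_only i (oracle S)),
   (p_delta p + p_delta' p) *: row_only i (oracle S), 0, 0, 0).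

Definition gossip_jump (e : 'I_n * 'I_n) S : state R n d :=
  (0, 0, 0, 0,
   - (p_beta p *: (edge_mx R e *m (st_y S + st_z S))),
   - (p_beta' p *: (edge_mx R e *m (st_y S + st_z S)))).

Definition clock_jump (c : 'I_n + 'I_n * 'I_n) S : state R n d :=
  match c with inl i => oracle_jump i S | inr e => gossip_jump e S end.

End Dynamics.

Section RowOnly.
Variables (R : realType) (n d : nat).
Implicit Types g h : 'M[R]_(n, d).

Lemma row_onlyE i g : row_only i g = \matrix_(k < n) ((k == i)%:R *: row k g).
Proof.
apply/matrixP => k j; rewrite !mxE (bigD1 i) //= big1 => [|l /negPf li].
  rewrite !mxE eqxx andbT addr0; case: eqP => [->|_] //.
  by rewrite !mul0r.
by rewrite mxE li andbF mul0r.
Qed.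

Lemma sum_row_only g : \sum_(i < n) row_only i g = g.
Proof.
rewrite /row_only -mulmx_suml -[RHS]mul1mx; congr (_ *m _).
by rewrite [RHS]matrix_sum_delta; apply: eq_bigr => i _;
  rewrite (bigD1 i) //= mxE eqxx scale1r big1 ?addr0 // => j ji;
  rewrite mxE eq_sym (negPf ji) scale0r.
Qed.

Lemma dot_row_only i g : dot (row_only i g) (row_only i g) = dot g (row_only i g).
Proof.
by rewrite /row_only dot_mulmxl trmx_delta mulmxA mul_delta_mx.
Qed.

Lemma sum_dot_row_only g h : \sum_(i < n) dot h (row_only i g) = dot h g.
Proof. by rewrite -dot_sumr sum_row_only. Qed.

End RowOnly.

Lemma rate_bounds (R : realType) (q : R) : 0 < q -> q <= 1 ->
  q / 4 * (1 + q / 4) <= 5 / 8 /\ q / 16 <= 3 / (4 * q).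
Proof.
move=> q0 q1; have q2 : q ^+ 2 <= 1 by rewrite expr_le1 // ltW.
split; first by lra.
by rewrite ler_pdivlMr ?mulr_gt0 //; lra.
Qed.

Section Lyapunov.
Variables (R : realType) (n d : nat) (L q chi_1 : R).
Variable f : 'I_n -> 'rV[R]_d -> R.
Variable E : {set 'I_n * 'I_n}.
Variable lam : 'I_n * 'I_n -> R.
Variable ustar : 'rV[R]_d.
Let nu := L * q ^+ 2.
Let Lam := laplacian E lam.
Hypothesis n2 : (2 <= n)%N.
Hypothesis L0 : 0 < L.
Hypothesis q0 : 0 < q.
Hypothesis q1 : q <= 1.
Hypothesis convex_f : forall i, strongly_convex (2 * nu) (f i).
Hypothesis smooth_f : forall i, smooth L (f i).
Hypothesis hE : forall e, e \in E -> e.1 != e.2.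
Hypothesis hlam : forall e, e \in E -> 0 < lam e.
Hypothesis hchi1 : chi1 Lam = chi_1%:E.
Hypothesis hchi : 2 * chi_1 * chi2 E Lam <= 1.
Hypothesis min_ustar : forall u, \sum_(i < n) f i ustar <= \sum_(i < n) f i u.

Implicit Types S I : state R n d.

(** Taking [q] as primitive and nu = L q^2 removes the square roots of the parameters, so that
    [field] can settle all identities between coefficients. *)
Definition dadao_params : params R :=
  {| p_nu := nu; p_eta := q / 8; p_eta' := q / 8; p_gamma := (4 * L)^-1;
     p_gamma' := (4 * L * q)^-1; p_theta := (2 * q)^-1; p_delta := q / 4;
     p_delta' := 1; p_alpha := q / 4; p_alpha' := q / 8; p_beta := 2^-1;
     p_beta' := 2 * chi_1 / q |}.
Let p := dadao_params.

(** The stationary point is x = x' = [xs], y = y' = [ys], z = z' = [zs]: the oracle vanishes there,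
    and ys + zs = - nu xs both stops the drift of [y'] and has equal rows, so that no edge acts on
    it. Optimality of [ustar] makes [zs] centered. *)
Definition xs : 'M[R]_(n, d) := \matrix_(i < n) ustar.
Definition ys : 'M[R]_(n, d) := shifted_grad nu f xs.
Definition zs : 'M[R]_(n, d) := - gradient_rows f xs.

Lemma yzs : ys + zs = - (nu *: xs).
Proof. by rewrite /ys /zs /shifted_grad addrAC subrr add0r. Qed.

Lemma xs_ones : xs = ones R n *m ustar.
Proof. by apply/matrixP => i j; rewrite !mxE big_ord1 !mxE mul1r. Qed.

Lemma ones_zs : (ones R n)^T *m zs = 0.
Proof.
rewrite /zs mulmxN; apply/eqP; rewrite oppr_eq0; apply/eqP.
rewrite -[RHS](minimizer_gradient L0 smooth_f min_ustar).
apply/rowP => j; rewrite mxE summxE; apply: eq_bigr => i _.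
rewrite !mxE mul1r; congr ('D_(delta_mx 0 j) (f i) _).
by apply/rowP => k; rewrite !mxE.
Qed.

(* The last term uses Lam^+ as inner product: the mean gossip increment of z' is
   proportional to Lam (y + z), so its cross term becomes <z', y + z>. *)
Definition pot S : R :=
  2 * nu * L * dot (st_x' S - xs) (st_x' S - xs)
  + 8 * L * bregman nu f (st_x S) xs
  + dot (st_y' S - ys) (st_y' S - ys)
  + 2^-1 * dot (st_y S - ys) (st_y S - ys)
  + 2 / q ^+ 2 * dot (st_y S + st_z S - (ys + zs)) (st_y S + st_z S - (ys + zs))
  + (4 * chi_1)^-1 * dual_dot E lam (st_z' S - zs) (st_z' S - zs).

(** [pot_lin] is the differential of [pot] and [pot_quad] its second-order part, in which the
    Bregman term is replaced by its smoothness bound, 8 L times L / 2. This replacement is the only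
    inequality behind [potD]. *)
Definition pot_lin S I : R :=
  4 * nu * L * dot (st_x' S - xs) (st_x' I)
  + 8 * L * dot (shifted_grad nu f (st_x S) - ys) (st_x I)
  + 2 * dot (st_y' S - ys) (st_y' I)
  + dot (st_y S - ys) (st_y I)
  + 4 / q ^+ 2 * dot (st_y S + st_z S - (ys + zs)) (st_y I + st_z I)
  + (2 * chi_1)^-1 * dual_dot E lam (st_z' S - zs) (st_z' I).

Definition pot_quad I : R :=
  2 * nu * L * dot (st_x' I) (st_x' I)
  + 4 * L ^+ 2 * dot (st_x I) (st_x I)
  + dot (st_y' I) (st_y' I)
  + 2^-1 * dot (st_y I) (st_y I)
  + 2 / q ^+ 2 * dot (st_y I + st_z I) (st_y I + st_z I)
  + (4 * chi_1)^-1 * dual_dot E lam (st_z' I) (st_z' I).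

Lemma potD S I : pot (S + I) <= pot S + pot_lin S I + pot_quad I.
Proof.
have dotDD m k (A B C : 'M[R]_(m, k)) : dot (A + B - C) (A + B - C) =
    dot (A - C) (A - C) + 2 * dot (A - C) B + dot B B.
  by rewrite addrAC; move: (A - C) => D; rewrite !dotDl !dotDr (dotC B); lra.
have dualDD (A B C : 'M[R]_(n, d)) :
    dual_dot E lam (A + B - C) (A + B - C) = dual_dot E lam (A - C) (A - C)
      + 2 * dual_dot E lam (A - C) B + dual_dot E lam B B.
  rewrite addrAC; move: (A - C) => D.
  have := dual_dotC E lam B D.
  by rewrite /dual_dot mulmxDr !dotDl !dotDr; lra.
have nu0 : 0 < nu by rewrite mulr_gt0 // exprn_gt0.
have := bregmanB nu0 L0 smooth_f (st_x S) xs (- st_x I).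
rewrite -/ys !dotNr dotNl !opprK => hb.
rewrite /pot /pot_lin /pot_quad /= (addrACA (st_y S)) !dotDD dualDD.
have L8 : 0 <= 8 * L by rewrite mulr_ge0 // ltW.
have := ler_wpM2l L8 hb.
rewrite !invfM; lra.
Qed.

Let nu0 : 0 < nu. Proof. by rewrite mulr_gt0 // exprn_gt0. Qed.

Let chi0 : 0 < chi_1.
Proof. exact: (chi1_gt0 hlam hchi1 n2). Qed.

(** The increments are orthogonal projections of one matrix, so the linear and the quadratic terms
    both add up to those of the full oracle. In 3 / 8, the part 2 nu L (p_gamma')^2 = 1 / 8 comes
    from [x'] and 4 L^2 (p_gamma)^2 = 1 / 4 from [x]. *)
Lemma sum_oracle_jump S :
  let g := oracle p f S in
  \sum_(i < n) (pot_lin S (oracle_jump p f i S) + pot_quad (oracle_jump p f i S))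
  = - (4 * nu * L) * (4 * L * q)^-1 * dot (st_x' S - xs) g
    - 2 * dot (shifted_grad nu f (st_x S) - ys) g
    + 2 * (1 + q / 4) * dot (st_y' S - ys) g
    + (3 / 8 + (1 + q / 4) ^+ 2) * dot g g.
Proof.
move=> g; rewrite -(sum_dot_row_only g (st_x' S - xs)).
rewrite -(sum_dot_row_only g (_ - ys)) -(sum_dot_row_only g (st_y' S - ys)).
rewrite -[X in _ = _ + _ * X](sum_dot_row_only g g).
rewrite !mulr_sumr -sumrB -!big_split /=; apply: eq_bigr => i _.
rewrite /pot_lin /pot_quad /= -/g addr0 /dual_dot mulmx0 !dot0r !dotNr !dotNl.
rewrite !dotZl !dotZr !dot_row_only /nu.
by field; rewrite !gt_eqF.
Qed.

Lemma edge_mx_yzs e : edge_mx R e *m (ys + zs) = 0.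
Proof.
rewrite yzs mulmxN -scalemxAr xs_ones /edge_mx -mulmxA (mulmxA _ (ones R n)).
by rewrite edge_vec_ones mul0mx mulmx0 scaler0 oppr0.
Qed.

(** Per edge, with b = <W, [edge_mx R e *m W]>, the step 1 / 2 changes the y + z term by (- 2 + 1) b
    / q^2, as the square of [edge_mx] is twice itself. The second-order term of [z'] has coefficient
    chi_1 / q^2 and costs at most 2 chi_1 chi2 b / q^2. *)
Lemma sum_gossip_jump S : (ones R n)^T *m st_z' S = 0 ->
  forall W, W = st_y S + st_z S - (ys + zs) ->
  \sum_(e in E) lam e *
    (pot_lin S (gossip_jump p e S) + pot_quad (gossip_jump p e S))
  <= - q^-1 * dot W (st_z' S - zs)
    - q ^- 2 * (1 - 2 * chi_1 * chi2 E Lam) * dot W (Lam *m W).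
Proof.
move=> z'1 W WE.
(* Since z' - zs is centered, the pseudo-inverse undoes the Laplacian; the inner product becomes a
   sum over edges, to be compared term by term. *)
have -> : dot W (st_z' S - zs) =
    \sum_(e in E) lam e * dual_dot E lam (st_z' S - zs) (edge_mx R e *m W).
  rewrite dotC -(dual_dot_laplacian hlam hchi1); last first.
    by rewrite mulmxBr z'1 ones_zs subr0.
  have -> : laplacian E lam *m W = \sum_(e in E) lam e *: (edge_mx R e *m W).
    by rewrite mulmx_suml; apply: eq_bigr => e _; rewrite -scalemxAl.
  rewrite {1}/dual_dot mulmx_sumr dot_sumr.
  by apply: eq_bigr => e _; rewrite -scalemxAr dotZr.
rewrite dot_laplacian !mulr_sumr -sumrN -big_split /=; apply: ler_sum => e eE.
have eW : edge_mx R e *m (st_y S + st_z S) = edge_mx R e *m W.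
  by rewrite WE mulmxBr edge_mx_yzs subr0.
have h := dual_dot_edge_mx lam W eE; rewrite -/Lam in h.
rewrite [leRHS](_ : _ = lam e *
  (- q^-1 * dual_dot E lam (st_z' S - zs) (edge_mx R e *m W)
   - q ^- 2 * (1 - 2 * chi_1 * chi2 E Lam) * dot W (edge_mx R e *m W)));
  last by ring.
rewrite ler_pM2l ?hlam // /pot_lin /pot_quad /= eW -WE /dual_dot !add0r.
rewrite !(mulmx0, mulmxN, dot0r, dot0l, dotNr, dotNl) -!scalemxAr.
rewrite !(dotZl, dotZr) dot_edge_mx_sqr ?hE //.
move: h; rewrite /dual_dot.
set a := dot (edge_mx R e *m W) _; set b := dot W (edge_mx R e *m W).
set c := dot (st_z' S - zs) _ => h.
have c1 : 0 <= chi_1 / q ^+ 2 by rewrite divr_ge0 ?ltW // exprn_gt0.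
have {}h := ler_wpM2l c1 h.
apply: (@le_trans _ _ (- q^-1 * c - b / q ^+ 2 + chi_1 / q ^+ 2 * a)).
  rewrite le_eqVlt; apply/orP; left; apply/eqP.
  by field; rewrite !gt_eqF.
apply: (@le_trans _ _ (- q^-1 * c - b / q ^+ 2 +
   chi_1 / q ^+ 2 * (2 * chi2 E Lam * b))); first by rewrite lerD2l.
by rewrite le_eqVlt; apply/orP; left; apply/eqP; field; rewrite !gt_eqF.
Qed.

(** This is the infinitesimal generator applied to [pot], except that the change at a jump is
    replaced by its upper bound from [potD]. *)
Definition generator S : R :=
  pot_lin S (drift p S)
  + \sum_(i < n) (pot_lin S (oracle_jump p f i S) + pot_quad (oracle_jump p f i S))
  + \sum_(e in E) lam e *
      (pot_lin S (gossip_jump p e S) + pot_quad (gossip_jump p e S)).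

Definition centered S : Prop :=
  (ones R n)^T *m st_z S = 0 /\ (ones R n)^T *m st_z' S = 0.

(** [pot] has no term for [z] alone; z - zs is recovered as the deviation of y + z minus that of y,
    and being centered it has dual norm controlled through [chi_1]. *)
Lemma dual_dot_le S : centered S ->
  dual_dot E lam (st_z S - zs) (st_z S - zs) <= 2 * chi_1 *
    (dot (st_y S + st_z S - (ys + zs)) (st_y S + st_z S - (ys + zs))
     + dot (st_y S - ys) (st_y S - ys)).
Proof.
move=> [z1 _].
have Z1 : (ones R n)^T *m (st_z S - zs) = 0 by rewrite mulmxBr z1 ones_zs subr0.
apply: (le_trans (dual_dot_ub hlam hchi1 chi0 Z1)).
rewrite -mulrA mulrCA ler_pM2l //.
have -> : st_z S - zs = (st_y S + st_z S - (ys + zs)) - (st_y S - ys).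
  rewrite (_ : st_y S + st_z S - (ys + zs) = (st_y S - ys) + (st_z S - zs)).
    by rewrite addrAC subrr add0r.
  by rewrite opprD addrACA.
exact: dotBB_le.
Qed.

(** Write X, X', Y', W, Z' for the deviations of x, x', y', y + z, z' and G for that of the shifted
    gradient at x. The parameters pair up the cross terms: the drifts of [y'] and of y + z cancel in
    <Y', W>, gossip removes <W, Z'>, the oracle step of [x'] removes <X', Y'>, and the drift of [x]
    removes <X', G>. What is left is - L q <G, X>, the sum of two Bregman divergences with opposite
    arguments. One is the decay of the Bregman term of [pot]; half of the other pays for |G|^2 by
    cocoercivity, and half pays for |X|^2 by strong convexity. The dual norm of z - zs, produced by
    the drift of [z'], is paid for through [dual_dot_le]. *)
Lemma generator_le S : centered S -> generator S <= - (q / 8) * pot S.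
Proof.
move=> cS; have [z1 z'1] := cS.
have hdual := dual_dot_le cS.
have hgossip := sum_gossip_jump z'1 erefl.
rewrite /generator sum_oracle_jump.
apply: (@le_trans _ _ (pot_lin S (drift p S)
  + (- (4 * nu * L) * (4 * L * q)^-1 * dot (st_x' S - xs) (oracle p f S)
    - 2 * dot (shifted_grad nu f (st_x S) - ys) (oracle p f S)
    + 2 * (1 + q / 4) * dot (st_y' S - ys) (oracle p f S)
    + (3 / 8 + (1 + q / 4) ^+ 2) * dot (oracle p f S) (oracle p f S))
  + (- q^-1 * dot (st_y S + st_z S - (ys + zs)) (st_z' S - zs)
    - q ^- 2 * (1 - 2 * chi_1 * chi2 E Lam) *
      dot (st_y S + st_z S - (ys + zs)) (Lam *m (st_y S + st_z S - (ys + zs)))))).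
  by rewrite lerD2l.
have hlap := dot_laplacian_ge0 hlam (st_y S + st_z S - (ys + zs)); rewrite -/Lam in hlap.
have hb1 := bregman_lb erefl convex_f smooth_f xs (st_x S).
have hb2 := bregman_coco erefl nu0 L0 convex_f smooth_f xs (st_x S).
have hb3 := bregman_sym nu f (st_x S) xs.
have subsub (A B C : 'M[R]_(n, d)) : A - B = (A - C) - (B - C).
  by rewrite opprB addrA subrK.
have hgE : oracle p f S = (shifted_grad nu f (st_x S) - ys) - (st_y' S - ys).
  exact: subsub.
have dx : st_x' S - st_x S = (st_x' S - xs) - (st_x S - xs).
  exact: subsub.
have dx' : st_x S - st_x' S = (st_x S - xs) - (st_x' S - xs).
  exact: subsub.
have dy' : st_y S + st_z S + nu *: st_x' S =
    (st_y S + st_z S - (ys + zs)) + nu *: (st_x' S - xs).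
  by rewrite yzs opprK scalerBr addrACA subrr addr0.
have dy : st_y' S - st_y S = (st_y' S - ys) - (st_y S - ys).
  exact: subsub.
have dz : st_z' S - st_z S = (st_z' S - zs) - (st_z S - zs).
  exact: subsub.
have dz' : st_z S - st_z' S = (st_z S - zs) - (st_z' S - zs).
  exact: subsub.
have dW : st_y S + st_z S - (ys + zs) = (st_y S - ys) + (st_z S - zs).
  by rewrite opprD addrACA.
have hdual2 := dual_dot_ge0 hlam ((st_z S - zs) - (st_z' S - zs)).
rewrite /pot_lin /pot /= dx dx' dy' dy dz dz' hgE.
rewrite -scalerDr (addrACA (st_y' S - ys)) -opprD -dW.
move: hlap hdual hdual2 hb1 hb2 hb3.
rewrite -/ys (dot_subC xs) (dot_subC ys).
(* Deviations, and later their inner products, become variables, so that the final comparison is one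
   identity between rational functions. *)
move: (st_y S + st_z S - (ys + zs)) (st_z S - zs) (st_z' S - zs) (st_y S - ys)
  (st_y' S - ys) (st_x S - xs) (st_x' S - xs)
  (shifted_grad nu f (st_x S) - ys) (bregman nu f (st_x S) xs)
  (bregman nu f xs (st_x S)) => W Z Z' Y Y' X X' G D D' hlap hdual hdual2 hb1 hb2 hb3.
have hX := dot_ge0 (X - X'); have hg := dot_ge0 (G - Y').
have hY := dot_ge0 (Y' - Y); have hW := dot_ge0 W.
have dualB (A B C : 'M[R]_(n, d)) :
    dual_dot E lam A (B - C) = dual_dot E lam A B - dual_dot E lam A C.
  by rewrite /dual_dot mulmxBr dotDr dotNr.
have dualZ (A B : 'M[R]_(n, d)) c :
    dual_dot E lam A (c *: B) = c * dual_dot E lam A B.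
  by rewrite /dual_dot -scalemxAr dotZr.
move: hdual2; rewrite !dualZ !dualB !(dual_dotC E lam (Z - Z')) !dualB.
rewrite (dual_dotC E lam Z Z') => hdual2.
move: (dot W (Lam *m W)) hlap => wlw hlap.
move: hX hg hY; rewrite !dotE (dotC Y Y') (dotC X' X) (dotC Y' G) (dotC Y' X')
  ?(dotC Y' W) ?(dotC Z' W) ?(dotC X' G) => hX hg hY.
move: hb3; rewrite ?(dotC X G) => hb3.
move: hb2 hb1 hW hdual hdual2 hX hg hY; rewrite -hb3.
move: (dual_dot E lam Z Z) (dual_dot E lam Z' Z') (dual_dot E lam Z' Z)
  (dot X X) (dot X' X') (dot X X') (dot G G) (dot G Y') (dot G X') (dot X' Y')
  (dot Y' Y') (dot Y' Y) (dot Y Y) (dot W W) (dot W Z') (dot W Y').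
move=> zz z'z' z'z xx x'x' xx' gg gy gx' x'y' y'y' y'y yy ww wz' wy'.
move=> h2 h1 hW h3 h4 hX hg hY.
(* The parameters are such that all cross terms of - (q / 8) pot - generator
   cancel and [slack] remains. *)
pose slack := L ^+ 2 * q ^+ 3 / 4 * (xx - xx' + (- xx' - - x'x'))
  + L * q / 2 * (D' - nu / 2 * xx) + q / 4 * (2 * L * D' - gg)
  + (5 / 8 - q / 4 * (1 + q / 4)) * (gg - gy + (- gy - - y'y'))
  + q / 8 * (y'y' - y'y + (- y'y - - yy))
  + (3 / (4 * q) - q / 16) * ww
  + q ^- 2 * (1 - 2 * chi_1 * chi2 E Lam) * wlw
  + q / (32 * chi_1) * (zz - z'z - (z'z - z'z'))
  + q / (32 * chi_1) * (2 * chi_1 * (ww + yy) - zz).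
have slack0 : 0 <= slack.
  have [qq qq'] := rate_bounds q0 q1.
  have q2 : 0 <= q ^- 2 by rewrite invr_ge0 exprn_ge0 // ltW.
  have qc : 0 <= q / (32 * chi_1) by rewrite divr_ge0 ?mulr_ge0 // ltW.
  have qL : 0 <= L * q by rewrite mulr_ge0 // ltW.
  have L3 : 0 <= L ^+ 2 * q ^+ 3 by rewrite mulr_ge0 // exprn_ge0 // ltW.
  by rewrite /slack !addr_ge0 // mulr_ge0 // ?subr_ge0 // ?divr_ge0 //
    ?mulr_ge0 // ?subr_ge0 // ltW.
rewrite -subr_ge0; apply: le_trans slack0 _.
rewrite le_eqVlt; apply/orP; left; apply/eqP; rewrite /slack /nu.
by field; rewrite !gt_eqF.
Qed.

Lemma pot_terms S :
  [/\ 0 <= dot (st_x' S - xs) (st_x' S - xs), 0 <= bregman nu f (st_x S) xs,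
      0 <= dot (st_y' S - ys) (st_y' S - ys), 0 <= dot (st_y S - ys) (st_y S - ys)
    & 0 <= dot (st_y S + st_z S - (ys + zs)) (st_y S + st_z S - (ys + zs)) /\
      0 <= dual_dot E lam (st_z' S - zs) (st_z' S - zs)].
Proof.
split; rewrite ?dot_ge0 //; first exact: (bregman_ge0 erefl nu0 convex_f smooth_f).
by split => //; exact: dual_dot_ge0.
Qed.

Lemma pot_terms_le S : [/\ 2 * nu * L * dot (st_x' S - xs) (st_x' S - xs) <= pot S,
    8 * L * bregman nu f (st_x S) xs <= pot S,
    1 * dot (st_y' S - ys) (st_y' S - ys) <= pot S,
    2^-1 * dot (st_y S - ys) (st_y S - ys) <= pot S
  & 2 / q ^+ 2 * dot (st_y S + st_z S - (ys + zs)) (st_y S + st_z S - (ys + zs))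
      <= pot S /\
    (4 * chi_1)^-1 * dual_dot E lam (st_z' S - zs) (st_z' S - zs) <= pot S].
Proof.
have q2 : 0 <= 2 / q ^+ 2 by rewrite divr_ge0 // exprn_ge0 // ltW.
have cc : 0 <= (4 * chi_1)^-1 by rewrite invr_ge0 mulr_ge0 // ltW.
have nL : 0 <= 2 * nu * L by rewrite !mulr_ge0 // ltW.
have L8 : 0 <= 8 * L by rewrite mulr_ge0 // ltW.
have sum6 (a b c e g h : R) : 0 <= a -> 0 <= b -> 0 <= c -> 0 <= e -> 0 <= g ->
    0 <= h -> [/\ a <= a + b + c + e + g + h, b <= a + b + c + e + g + h,
      c <= a + b + c + e + g + h, e <= a + b + c + e + g + h
      & g <= a + b + c + e + g + h /\ h <= a + b + c + e + g + h].
  by move=> a0 b0 c0 e0 g0 h0; split; [| | | |split]; lra.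
have [h1 h2 h3 h4 [h5 h6]] := pot_terms S.
by rewrite mul1r; apply: sum6 => //; apply: mulr_ge0 => //; rewrite invr_ge0.
Qed.

(** This is domination by [pot] with an unspecified constant. The drift's second-order term needs
    nothing sharper, because in [pot_step] it carries the factor kappa s, quadratic in the mesh. *)
Definition pot_bounded (u : state R n d -> R) :=
  exists2 K, 0 <= K & forall S, centered S -> u S <= K * pot S.

Lemma pot_boundedD u v : pot_bounded u -> pot_bounded v ->
  pot_bounded (fun S => u S + v S).
Proof.
move=> [K K0 uK] [K' K'0 vK']; exists (K + K'); first exact: addr_ge0.
by move=> S cS; rewrite mulrDl lerD ?uK ?vK'.
Qed.

Lemma pot_boundedZ c u : 0 <= c -> pot_bounded u -> pot_bounded (fun S => c * u S).
Proof.
move=> c0 [K K0 uK]; exists (c * K); first exact: mulr_ge0.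
by move=> S cS; rewrite -mulrA ler_wpM2l ?uK.
Qed.

Lemma pot_bounded_le u v : (forall S, centered S -> u S <= v S) ->
  pot_bounded v -> pot_bounded u.
Proof. by move=> uv [K K0 vK]; exists K => // S cS; exact: le_trans (uv _ cS) (vK _ cS). Qed.

Lemma pot_bounded_dotD (U V : state R n d -> 'M[R]_(n, d)) :
  pot_bounded (fun S => dot (U S) (U S)) -> pot_bounded (fun S => dot (V S) (V S)) ->
  pot_bounded (fun S => dot (U S + V S) (U S + V S)).
Proof.
move=> bU bV; apply: pot_bounded_le (pot_boundedZ (ler0n R 2) (pot_boundedD bU bV)) => S _.
exact: (dotDD_le (U S) (V S)).
Qed.

Lemma pot_bounded_dotZ c (U : state R n d -> 'M[R]_(n, d)) :
  pot_bounded (fun S => dot (U S) (U S)) ->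
  pot_bounded (fun S => dot (c *: U S) (c *: U S)).
Proof.
move=> bU; apply: pot_bounded_le (pot_boundedZ (sqr_ge0 c) bU) => S _.
by rewrite dotZl dotZr mulrA -expr2.
Qed.

Lemma pot_bounded_dotB (U V : state R n d -> 'M[R]_(n, d)) :
  pot_bounded (fun S => dot (U S) (U S)) -> pot_bounded (fun S => dot (V S) (V S)) ->
  pot_bounded (fun S => dot (U S - V S) (U S - V S)).
Proof.
move=> bU bV; apply: pot_bounded_dotD => //.
by apply: pot_bounded_le bV => S _; rewrite dotNl dotNr opprK.
Qed.

Lemma pot_bounded_quad_drift : pot_bounded (fun S => pot_quad (drift p S)).
Proof.
have term c u : 0 < c -> (forall S, c * u S <= pot S) -> pot_bounded u.
  move=> c0 cu; exists c^-1; first by rewrite invr_ge0 ltW.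
  by move=> S _; rewrite ler_pdivlMl.
have q2 : 0 <= 2 / q ^+ 2 by rewrite divr_ge0 // exprn_ge0 // ltW.
have cc : 0 <= (4 * chi_1)^-1 by rewrite invr_ge0 mulr_ge0 // ltW.
have nL : 0 <= 2 * nu * L by rewrite !mulr_ge0 // ltW.
have L8 : 0 <= 8 * L by rewrite mulr_ge0 // ltW.
have terms := pot_terms_le.
have bx' : pot_bounded (fun S => dot (st_x' S - xs) (st_x' S - xs)).
  by apply: (term (2 * nu * L)) => [|S]; [rewrite !mulr_gt0|have [] := terms S].
have bD : pot_bounded (fun S => bregman nu f (st_x S) xs).
  by apply: (term (8 * L)) => [|S]; [rewrite mulr_gt0|have [] := terms S].
have by' : pot_bounded (fun S => dot (st_y' S - ys) (st_y' S - ys)).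
  by apply: (term 1) => [|S] //; have [] := terms S.
have byy : pot_bounded (fun S => dot (st_y S - ys) (st_y S - ys)).
  by apply: (term 2^-1) => [|S]; [rewrite invr_gt0|have [] := terms S].
have bW : pot_bounded (fun S =>
    dot (st_y S + st_z S - (ys + zs)) (st_y S + st_z S - (ys + zs))).
  apply: (term (2 / q ^+ 2)) => [|S]; first by rewrite divr_gt0 // exprn_gt0.
  by have [_ _ _ _ []] := terms S.
have bz' : pot_bounded (fun S => dual_dot E lam (st_z' S - zs) (st_z' S - zs)).
  apply: (term (4 * chi_1)^-1) => [|S]; first by rewrite invr_gt0 mulr_gt0.
  by have [_ _ _ _ []] := terms S.
have bx : pot_bounded (fun S => dot (st_x S - xs) (st_x S - xs)).
  have c0 : 0 <= 2 / nu by rewrite divr_ge0 // ltW.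
  apply: pot_bounded_le (pot_boundedZ c0 bD) => S _.
  have := ler_wpM2l c0 (bregman_lb erefl convex_f smooth_f (st_x S) xs).
  rewrite mulrA (_ : 2 / nu * (nu / 2) = 1) ?mul1r //.
  by field; rewrite gt_eqF.
have bzz : pot_bounded (fun S => dual_dot E lam (st_z S - zs) (st_z S - zs)).
  have c0 : 0 <= 2 * chi_1 by rewrite mulr_ge0 // ltW.
  apply: pot_bounded_le (pot_boundedZ c0 (pot_boundedD bW byy)) => S.
  exact: dual_dot_le.
(* [pot] contains only the dual norm of z' - zs, but the drift of [z] brings [z'] into the Euclidean
   norm of y + z; finiteness of the rates compares the two. *)
have bZ' : pot_bounded (fun S => dot (st_z' S - zs) (st_z' S - zs)).
  have c0 : 0 <= rate_bound E lam.
    by rewrite mulr_ge0 // addr_ge0 // sumr_ge0 // => e /hlam /ltW.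
  apply: pot_bounded_le (pot_boundedZ c0 bz') => S [_ z'1].
  apply: (dual_dot_lb hE hlam hchi1).
  by rewrite mulmxBr z'1 ones_zs subr0.
have subsub (A B C : 'M[R]_(n, d)) : A - B = (A - C) - (B - C).
  by rewrite opprB addrA subrK.
apply: (@pot_bounded_le _ (fun S =>
  2 * nu * L * dot (p_eta' p *: ((st_x S - xs) - (st_x' S - xs)))
     (p_eta' p *: ((st_x S - xs) - (st_x' S - xs)))
  + 4 * L ^+ 2 * dot (p_eta p *: ((st_x' S - xs) - (st_x S - xs)))
     (p_eta p *: ((st_x' S - xs) - (st_x S - xs)))
  + dot (p_theta p *: (st_y S + st_z S - (ys + zs) + nu *: (st_x' S - xs)))
     (p_theta p *: (st_y S + st_z S - (ys + zs) + nu *: (st_x' S - xs)))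
  + 2^-1 * dot (p_alpha p *: ((st_y' S - ys) - (st_y S - ys)))
     (p_alpha p *: ((st_y' S - ys) - (st_y S - ys)))
  + 2 / q ^+ 2 * dot (p_alpha p *: ((st_y' S - ys) + (st_z' S - zs)
         - (st_y S + st_z S - (ys + zs))))
     (p_alpha p *: ((st_y' S - ys) + (st_z' S - zs)
         - (st_y S + st_z S - (ys + zs))))
  + (4 * chi_1)^-1 * (p_alpha' p ^+ 2 *
     (2 * (dual_dot E lam (st_z S - zs) (st_z S - zs) +
           dual_dot E lam (st_z' S - zs) (st_z' S - zs)))))).
  move=> S _; rewrite /pot_quad /drift /=.
  have dW : st_y S + st_z S + nu *: st_x' S =
      (st_y S + st_z S - (ys + zs)) + nu *: (st_x' S - xs).
    by rewrite yzs opprK scalerBr addrACA subrr addr0.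
  have dyz : st_y' S - st_y S + (st_z' S - st_z S) =
      (st_y' S - ys) + (st_z' S - zs) - (st_y S + st_z S - (ys + zs)).
    move: (st_y' S) (st_y S) (st_z' S) (st_z S) ys zs => A B C D a c.
    by apply/matrixP => i j; rewrite !mxE; ring.
  rewrite -!subsub dW -scalerDr dyz dotNl dotNr opprK lerD2l.
  rewrite ler_wpM2l // (subsub _ _ zs).
  rewrite [X in X <= _](_ : _ = p_alpha' p ^+ 2 * dual_dot E lam
      ((st_z S - zs) - (st_z' S - zs)) ((st_z S - zs) - (st_z' S - zs))).
    by rewrite ler_wpM2l ?sqr_ge0 // dual_dotBB_le.
  by rewrite /dual_dot -!scalemxAr !dotZl !dotZr mulrA -expr2.
have L2 : 0 <= 4 * L ^+ 2 by rewrite mulr_ge0 // sqr_ge0.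
do 5?apply: pot_boundedD.
- by apply: pot_boundedZ => //; apply: pot_bounded_dotZ; exact: pot_bounded_dotB.
- by apply: pot_boundedZ => //; apply: pot_bounded_dotZ; exact: pot_bounded_dotB.
- apply: pot_bounded_dotZ; apply: (pot_bounded_dotD bW).
  exact: pot_bounded_dotZ.
- by apply: pot_boundedZ => //; apply: pot_bounded_dotZ; exact: pot_bounded_dotB.
- apply: pot_boundedZ => //; apply: pot_bounded_dotZ; apply: pot_bounded_dotB => //.
  exact: pot_bounded_dotD.
- apply: pot_boundedZ => //; apply: pot_boundedZ; first exact: sqr_ge0.
  by apply: pot_boundedZ => //; exact: pot_boundedD.
Qed.

Lemma pot_linZ S c I : pot_lin S (c *: I) = c * pot_lin S I.
Proof.
rewrite /pot_lin /= -scalerDr /dual_dot -scalemxAr !dotZr; ring.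
Qed.

Lemma pot_quadZ c I : pot_quad (c *: I) = c ^+ 2 * pot_quad I.
Proof.
rewrite /pot_quad /= -scalerDr /dual_dot -scalemxAr !(dotZr, dotZl); ring.
Qed.

Lemma pot_ge0 S : 0 <= pot S.
Proof.
have [_ _ h _ _] := pot_terms_le S; apply: le_trans h.
by rewrite mul1r dot_ge0.
Qed.

Lemma centered_drift S s : centered S -> centered (S + s *: drift p S).
Proof.
move=> [z1 z'1]; split; rewrite /= mulmxDr -!scalemxAr mulmxBr z1 z'1;
by rewrite subr0 !scaler0 addr0.
Qed.

Lemma centered_jump c S : centered S -> centered (S + clock_jump p f c S).
Proof.
move=> [z1 z'1]; case: c => [i|e]; split; rewrite /= ?addr0 //.
  by rewrite mulmxDr z1 mulmxN -!scalemxAr mulmxA ones_edge_mx mul0mx scaler0 subr0.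
by rewrite mulmxDr z'1 mulmxN -!scalemxAr mulmxA ones_edge_mx mul0mx scaler0 subr0.
Qed.

(* A cell of the time grid performs a jump with probability kappa times its rate
   and the drift step s with the remaining probability w; w s = kappa makes the
   first-order terms add up to kappa times the generator. *)
Lemma pot_step : exists2 K, 0 <= K & forall S w kappa s, centered S ->
  0 <= w -> 0 <= kappa -> 0 <= s -> w * s = kappa ->
  kappa * \sum_(i < n) (pot (S + oracle_jump p f i S) - pot S)
  + kappa * \sum_(e in E) lam e * (pot (S + gossip_jump p e S) - pot S)
  + w * (pot (S + s *: drift p S) - pot S)
  <= (- (q / 8) * kappa + K * kappa * s) * pot S.
Proof.
have [K K0 hK] := pot_bounded_quad_drift.
exists K => // S w kappa s cS w0 k0 s0 ws.
have h1 : \sum_(i < n) (pot (S + oracle_jump p f i S) - pot S) <=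
    \sum_(i < n) (pot_lin S (oracle_jump p f i S) + pot_quad (oracle_jump p f i S)).
  by apply: ler_sum => i _; rewrite lerBlDl addrA; exact: potD.
have h2 : \sum_(e in E) lam e * (pot (S + gossip_jump p e S) - pot S) <=
    \sum_(e in E) lam e *
      (pot_lin S (gossip_jump p e S) + pot_quad (gossip_jump p e S)).
  apply: ler_sum => e eE; rewrite ler_pM2l ?hlam // lerBlDl addrA; exact: potD.
have h3 := potD S (s *: drift p S); rewrite pot_linZ pot_quadZ in h3.
have h4 := generator_le cS; rewrite /generator in h4.
have h5 := hK _ cS.
have h3' : w * (pot (S + s *: drift p S) - pot S) <=
    kappa * pot_lin S (drift p S) + kappa * s * pot_quad (drift p S).
  have -> : kappa * pot_lin S (drift p S) + kappa * s * pot_quad (drift p S) =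
    w * (s * pot_lin S (drift p S) + s ^+ 2 * pot_quad (drift p S)).
    by rewrite -ws; ring.
  by rewrite ler_wpM2l // lerBlDl addrA.
have h5' : kappa * s * pot_quad (drift p S) <= kappa * s * (K * pot S).
  by rewrite ler_wpM2l // mulr_ge0.
have h1' := ler_wpM2l k0 h1; have h2' := ler_wpM2l k0 h2.
have h4' := ler_wpM2l k0 h4.
apply: (le_trans (lerD (lerD h1' h2') h3')).
rewrite -!mulrDr in h4' *.
have -> : (- (q / 8) * kappa + K * kappa * s) * pot S =
   kappa * (- (q / 8) * pot S) + kappa * s * (K * pot S) by ring.
apply: le_trans (lerD h4' h5'); rewrite !mulrDr; lra.
Qed.

Lemma pot_lb S : 4 * nu * L * dot (st_x S - xs) (st_x S - xs) <= pot S.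
Proof.
have [_ h _ _ _] := pot_terms_le S; apply: le_trans h.
have L8 : 0 <= 8 * L by rewrite mulr_ge0 // ltW.
have := ler_wpM2l L8 (bregman_lb erefl convex_f smooth_f (st_x S) xs).
by congr (_ <= _); field.
Qed.

Lemma ones_centering : (ones R n)^T *m centering R n = 0.
Proof.
rewrite /centering mulmxBr mulmx1 -scalemxAr mulmxA.
have -> : (ones R n)^T *m ones R n = n%:R%:M.
  apply/matrixP => i j; rewrite !mxE !ord1 eqxx mulr1n.
  under eq_bigr do rewrite !mxE mulr1.
  by rewrite sumr_const card_ord.
rewrite mul_scalar_mx scalerA mulVf ?scale1r ?subrr // pnatr_eq0.
by rewrite -lt0n; apply: leq_trans n2.
Qed.

Lemma centering_tr : (centering R n)^T = centering R n.
Proof. by rewrite /centering linearB /= trmx1 linearZ /= trmx_mul trmxK. Qed.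

Lemma centering_id (U : 'M[R]_(n, d)) : (ones R n)^T *m U = 0 -> centering R n *m U = U.
Proof.
by move=> U1; rewrite /centering mulmxBl mul1mx -scalemxAl -mulmxA U1 mulmx0 scaler0 subr0.
Qed.

Lemma centering_xs : centering R n *m xs = 0.
Proof.
by rewrite xs_ones mulmxA -[X in X *m _]trmxK trmx_mul centering_tr ones_centering trmx0 mul0mx.
Qed.

Lemma centering_ys : centering R n *m ys = - zs.
Proof.
rewrite /ys /shifted_grad mulmxBr -scalemxAr centering_xs scaler0 subr0.
rewrite /zs opprK centering_id //; apply/eqP; rewrite -oppr_eq0 -mulmxN.
by apply/eqP; exact: ones_zs.
Qed.

Definition initial_state (x0 : 'M[R]_(n, d)) : state R n d :=
  let y0 := shifted_grad nu f x0 in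
  (x0, x0, y0, y0, - (centering R n *m y0), - (centering R n *m y0)).

Lemma centered_initial_state x0 : centered (initial_state x0).
Proof.
by split; rewrite /= mulmxN mulmxA ones_centering mul0mx oppr0.
Qed.

(** Let G be the difference of the shifted gradients at [x0] and [xs], and P the centering. Then y
    and y' deviate by G, z and z' by - P G, and y + z by G - P G. The coefficient 7 / 4 is 1 + 1 / 2
    + 1 / 4, for y', y and z'; [shifted_grad_lip] turns |G|^2 into L^2 times the squared
    distance. *)
Lemma pot_initial_state x0 : pot (initial_state x0) <=
  (2 * nu * L + 4 * L ^+ 2 + (7 / 4 + 2 / q ^+ 2) * L ^+ 2) *
  dot (x0 - xs) (x0 - xs).
Proof.
have hlip := shifted_grad_lip erefl nu0 L0 convex_f smooth_f x0 xs; rewrite -/ys in hlip.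
have hub := bregman_ub nu0 L0 smooth_f x0 xs.
have cG := @centering_id (centering R n *m (shifted_grad nu f x0 - ys)).
rewrite mulmxA ones_centering mul0mx in cG; have {}cG := cG erefl.
rewrite /pot /=.
have -> : - (centering R n *m shifted_grad nu f x0) - zs =
    - (centering R n *m (shifted_grad nu f x0 - ys)).
  by rewrite (mulmxBr _ _ ys) centering_ys; move: zs => B; rewrite opprK opprD.
have -> : shifted_grad nu f x0 - centering R n *m shifted_grad nu f x0 - (ys + zs)
  = (shifted_grad nu f x0 - ys) - centering R n *m (shifted_grad nu f x0 - ys).
  rewrite (mulmxBr _ _ ys) centering_ys.
  move: (shifted_grad nu f x0) ys zs (centering R n *m _) => A B C D.
  by apply/matrixP => i j; rewrite !mxE; ring.
have hub2 := @dual_dot_ub _ _ E lam hlam chi_1 hchi1 d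
  (- (centering R n *m (shifted_grad nu f x0 - ys))) chi0.
rewrite mulmxN mulmxA ones_centering mul0mx oppr0 in hub2.
have {}hub2 := hub2 erefl.
have : dot (centering R n *m (shifted_grad nu f x0 - ys))
    (centering R n *m (shifted_grad nu f x0 - ys)) =
  dot (shifted_grad nu f x0 - ys) (centering R n *m (shifted_grad nu f x0 - ys)).
  by rewrite dot_mulmxl centering_tr cG.
move: hlip hub hub2.
move: (dot (x0 - xs) (x0 - xs)) (bregman nu f x0 xs) => XX D.
move: (shifted_grad nu f x0 - ys) => G; move: (centering R n *m G) => PG.
rewrite dotNl dotNr opprK => hlip hub hub2 hP.
have hPG := dot_ge0 PG; have := dot_ge0 (G - PG).
rewrite !dotE (dotC PG G) -hP => hGP.
have nL : 0 <= 2 * nu * L by rewrite !mulr_ge0 // ltW.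
have L8 : 0 <= 8 * L by rewrite mulr_ge0 // ltW.
have q2 : 0 <= 2 / q ^+ 2 by rewrite divr_ge0 // exprn_ge0 // ltW.
have cc : 0 <= (4 * chi_1)^-1 by rewrite invr_ge0 mulr_ge0 // ltW.
have hub' := ler_wpM2l L8 hub.
have hub2' : (4 * chi_1)^-1 * dual_dot E lam (- PG) (- PG) <= 4^-1 * dot G G.
  apply: (le_trans (ler_wpM2l cc hub2)).
  have -> : (4 * chi_1)^-1 * (chi_1 * dot PG PG) = 4^-1 * dot PG PG.
    by field; rewrite gt_eqF.
  by rewrite ler_wpM2l ?invr_ge0 //; lra.
have hGP' : 2 / q ^+ 2 * (dot G G - dot PG PG) <= 2 / q ^+ 2 * dot G G.
  by rewrite ler_wpM2l //; lra.
have hG' : (7 / 4 + 2 / q ^+ 2) * dot G G <=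
    (7 / 4 + 2 / q ^+ 2) * (L ^+ 2 * XX).
  by rewrite ler_wpM2l // addr_ge0.
move: (dual_dot E lam (- PG) (- PG)) hub2' => DP hub2'.
move: hG' hGP' q2; move: (2 / q ^+ 2) => c hG' hGP' q2; lra.
Qed.

End Lyapunov.

(** * Poisson processes on a dyadic grid *)

Lemma integral_finite_fun (R : realType) (dT : measure_display)
    (T : measurableType dT) (P : probability T R) (I : finType)
    (X : T -> I) (g : I -> R) :
  (forall i, measurable (X @^-1` [set i])) -> (forall i, 0 <= g i) ->
  (\int[P]_w (g (X w))%:E = \sum_(i : I) (g i)%:E * P (X @^-1` [set i]))%E.
Proof.
move=> mX g0.
transitivity (\int[P]_w (\sum_(i : I) (g i * \1_(X @^-1` [set i]) w)%:E))%E.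
  apply: eq_integral => w _; rewrite sumEFin (bigD1 (X w)) //= big1.
    by rewrite addr0 indicE mem_set // mulr1.
  move=> i iX; rewrite indicE memNset ?mulr0 //= => h.
  by rewrite h eqxx in iX.
rewrite ge0_integral_sum //.
- apply: eq_bigr => i _.
  rewrite (integralZl_indic measurableT (fun=> X @^-1` [set i])) //.
    by rewrite integral_indic // setIT.
  by move=> h; have := lt_le_trans h (g0 i); rewrite ltxx.
- move=> i; apply/measurable_EFinP; apply: measurable_funM => //.
- by move=> i w _; rewrite lee_fin mulr_ge0.
Qed.

Lemma sum_tuple_cons (R : realType) (I : finType) m (F : m.+1.-tuple I -> R) :
  \sum_(t : m.+1.-tuple I) F t = \sum_(i : I) \sum_(t : m.-tuple I) F [tuple of i :: t].
Proof.
rewrite pair_big /= (reindex (fun p : I * m.-tuple I => [tuple of p.1 :: p.2])) //.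
exists (fun t => (thead t, [tuple of behead t])) => [[i t] _|t _] /=.
  by congr (_, _); apply/val_inj.
by rewrite [RHS]tuple_eta.
Qed.

Lemma sum_tuple_nil (R : realType) (I : finType) (F : 0.-tuple I -> R) :
  \sum_(t : 0.-tuple I) F t = F [tuple].
Proof.
rewrite (bigD1 [tuple]) //= big1 ?addr0 // => t /eqP[].
exact: tuple0.
Qed.

Section GridLaw.
Variables (R : realType) (dT : measure_display) (T : measurableType dT).
Variables (P : probability T R) (C : finType) (D : {set C}) (rate : C -> R).
Variable cnt : C -> R -> T -> nat.
Hypothesis pois : forall c, c \in D -> poisson_process P (rate c) (cnt c).
Hypothesis rate0 : forall c, c \in D -> 0 < rate c.
Hypothesis indep :
  mutually_independent P D (fun c => generated_by_process (cnt c)).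

(* Increments are truncated at 2, so that a cell takes finitely many values. *)
Definition trunc (k : nat) : 'I_3 := inord (minn k 2).

Definition increment (c : C) (s t : R) (w : T) : nat := (cnt c t w - cnt c s w)%N.

Definition cell (s t : R) (w : T) : {ffun C -> 'I_3} :=
  [ffun c => if c \in D then trunc (increment c s t w) else ord0].

(** The law of a truncated Poisson count: 0, 1, or at least 2 events. A cell has a coordinate for
    every element of [C], so an index outside [D] gets a point mass at 0. *)
Definition weight (h : R) (c : C) (a : 'I_3) : R :=
  if c \in D then
    let e := expR (- (rate c * h)) in
    if a == 0%N :> nat then e else if a == 1%N :> nat then rate c * h * e
    else 1 - e - rate c * h * e
  else (a == ord0)%:R.

Definition cell_law (h : R) (v : {ffun C -> 'I_3}) : R :=
  \prod_(c : C) weight h c (v c).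

Lemma val_trunc k : trunc k = minn k 2 :> nat.
Proof. by rewrite /trunc inordK // ltnS geq_minr. Qed.

Lemma trunc_eq k (a : 'I_3) : (a < 2)%N -> (trunc k == a) = (k == a :> nat).
Proof. by move=> a2; rewrite -val_eqE /= val_trunc; lia. Qed.

Lemma weight_ge0 h c a : 0 <= h -> 0 <= weight h c a.
Proof.
move=> h0; rewrite /weight; case: ifPn => // cD.
have rh0 : 0 <= rate c * h by rewrite mulr_ge0 // ltW // rate0.
case: ifPn => _; first exact: expR_ge0.
case: ifPn => _; first by rewrite mulr_ge0 // expR_ge0.
have : (1 + rate c * h) * expR (- (rate c * h)) <= 1.
  by rewrite expRN ler_pdivrMr ?expR_gt0 // mul1r expR_ge1Dx.
by rewrite mulrDl mul1r; lra.
Qed.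

Lemma sum_weight h c : \sum_(a : 'I_3) weight h c a = 1.
Proof.
rewrite /weight; case: (c \in D); rewrite !big_ord_recl big_ord0 /=.
  by ring.
by rewrite !addr0.
Qed.

Lemma cell_law_ge0 h v : 0 <= h -> 0 <= cell_law h v.
Proof. by move=> h0; apply: prodr_ge0 => c _; exact: weight_ge0. Qed.

Lemma sum_cell_law h : \sum_v cell_law h v = 1.
Proof.
rewrite /cell_law -(bigA_distr_bigA (weight h)) big1 // => c _.
exact: sum_weight.
Qed.

Lemma measurable_increment c s t : c \in D -> 0 <= s -> 0 <= t ->
  measurable_fun setT (increment c s t).
Proof.
by move=> cD s0 t0; have [m _ _ _] := pois cD; apply: measurable_fun_subn; exact: m.
Qed.

Lemma increment_law c s t (k : nat) : c \in D -> 0 <= s -> s < t ->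
  P [set w | increment c s t w = k] =
    ((rate c * (t - s)) ^+ k * k`!%:R^-1 * expR (- (rate c * (t - s))))%:E.
Proof.
move=> cD s0 st; have [_ _ + _] := pois cD => /(_ s t k s0 st).
by rewrite /poisson_pmf mulr_gt0 ?rate0 ?subr_gt0.
Qed.

Lemma trunc_law c s t (a : 'I_3) : c \in D -> 0 <= s -> s < t ->
  P [set w | trunc (increment c s t w) = a] = (weight (t - s) c a)%:E.
Proof.
move=> cD s0 st.
have small (b : 'I_3) : (b < 2)%N -> [set w | trunc (increment c s t w) = b] =
    [set w | increment c s t w = b].
  move=> b2; apply/seteqP; split=> w /= h.
    by apply/eqP; rewrite -trunc_eq // h.
  by apply/eqP; rewrite trunc_eq // h.
have mi := measurable_increment cD s0 (le_trans s0 (ltW st)).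
have ms (b : nat) : measurable [set w | increment c s t w = b].
  rewrite -[X in measurable X]setTI; exact: (mi measurableT [set b]).
have w0 := increment_law 0 cD s0 st; have w1 := increment_law 1 cD s0 st.
rewrite /weight cD.
case: a => -[|[|[|//]]] ha /=.
- by rewrite small // w0 expr0 fact0 invr1 mulr1 mul1r.
- by rewrite small // w1 expr1 invr1 mulr1.
have -> : [set w | trunc (increment c s t w) = Ordinal ha] =
    ~` ([set w | increment c s t w = 0%N] `|` [set w | increment c s t w = 1%N]).
  apply/seteqP; split=> w /=.
    move=> /(congr1 val) /=; rewrite val_trunc; lia.
  by move=> h; apply/val_inj; rewrite /= val_trunc; move: h; lia.
rewrite probability_setC; last exact: measurableU.
rewrite measureU //; last by apply/seteqP; split=> w //= [-> ].
rewrite [X in (1 - (X + _))%E]w0 [X in (1 - (_ + X))%E]w1.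
apply: (congr1 EFin); rewrite expr0 expr1 fact0 invr1 !mulr1 mul1r.
by rewrite opprD addrA.
Qed.

Lemma generated_by_process_measurable c t : 0 <= t ->
  measurable_fun (setT : set (g_sigma_algebraType
    (\bigcup_(t in [set t : R | 0 <= t]) generated_by (cnt c t)))) (cnt c t).
Proof.
by move=> t0 _ B mB; apply: sub_sigma_algebra; exists t => //; exists B.
Qed.

Lemma increments_law o h m (c : C) (a : 'I_m -> 'I_3) : c \in D -> 0 <= o -> 0 < h ->
  let A := \bigcap_(i in [set` [set: 'I_m]%SET])
    [set w | trunc (increment c (o + i%:R * h) (o + i.+1%:R * h) w) = a i] in
  generated_by_process (cnt c) A /\ P A = (\prod_(i < m) weight h c (a i))%:E.
Proof.
move=> cD o0 h0 A.
have g0 (i : nat) : 0 <= o + i%:R * h by rewrite addr_ge0 // mulr_ge0 // ltW.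
split.
  rewrite /generated_by_process.
  change ((\bigcup_(t in [set t : R | 0 <= t]) generated_by (cnt c t)).-sigma.-measurable A).
  apply: fin_bigcap_measurable => [|i _]; first exact: finite_finset.
  have := measurable_fun_subn (@generated_by_process_measurable c _ (g0 i.+1))
    (@generated_by_process_measurable c _ (g0 i)).
  move=> /(_ measurableT [set k | trunc k = a i]) hm.
  by rewrite -[X in _.-measurable X]setTI; exact: hm.
have [_ _ _ ind] := pois cD.
have hom : {homo (fun i => o + i%:R * h) : i j / (i <= j)%N >-> i <= j}.
  by move=> i j ij; rewrite lerD2l ler_pM2r // ler_nat.
rewrite (ind m (fun i => o + i%:R * h) (g0 0) hom [set: 'I_m]%SET (fun i : 'I_m =>
  [set w | trunc (increment c (o + i%:R * h) (o + i.+1%:R * h) w) = a i])) //.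
  rewrite -prodEFin; apply: eq_big => [i|i _]; first by rewrite inE.
  rewrite trunc_law // ?ltrD2l ?ltr_pM2r ?ltr_nat // opprD addrACA subrr add0r -mulrBl.
  by rewrite -natr1 addrAC subrr add0r mul1r.
move=> i _; exists [set k | trunc k = a i] => //; rewrite setTI //.
Qed.

Definition cells (o h : R) m (w : T) : m.-tuple {ffun C -> 'I_3} :=
  [tuple cell (o + i%:R * h) (o + i.+1%:R * h) w | i < m].

Lemma cells_law o h m (t : m.-tuple {ffun C -> 'I_3}) : 0 <= o -> 0 < h ->
  measurable [set w | cells o h m w = t] /\
  P [set w | cells o h m w = t] = (\prod_(v <- t) cell_law h v)%:E.
Proof.
move=> o0 h0; rewrite big_tuple /cell_law exchange_big /=.
(* A tuple with a nonzero entry outside [D] has probability 0 on both sides; for any other tuple the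
   event is an intersection over clocks of intersections over cells. *)
have [offD|] := boolP [forall i, forall c, (c \notin D) ==> (tnth t i c == ord0)].
  have {}offD i c : c \notin D -> tnth t i c = ord0.
    by move=> cD; have /forallP/(_ i)/forallP/(_ c)/implyP/(_ cD)/eqP := offD.
  have -> : [set w | cells o h m w = t] =
    \bigcap_(c in [set` D]) (\bigcap_(i in [set` [set: 'I_m]%SET])
      [set w | trunc (increment c (o + i%:R * h) (o + i.+1%:R * h) w) = tnth t i c]).
    apply/seteqP; split=> w /=.
      by move=> <- c /= cD i _ /=; rewrite tnth_mktuple ffunE cD.
    move=> H; apply: eq_from_tnth => i; apply/ffunP => c.
    rewrite tnth_mktuple ffunE; case: ifPn => cD; last by rewrite offD.
    by rewrite (H c cD i) //=; rewrite finset.in_setT.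
  split.
    apply: fin_bigcap_measurable => [|c cD]; first exact: finite_finset.
    apply: fin_bigcap_measurable => [|j _]; first exact: finite_finset.
    have g0 (i : nat) : 0 <= o + i%:R * h by rewrite addr_ge0 // mulr_ge0 // ltW.
    have hm := (measurable_increment cD (g0 j) (g0 j.+1) measurableT (_ : measurable
      [set k | trunc k = tnth t j c])).
    by rewrite -[X in _.-measurable X]setTI; exact: hm.
  rewrite indep //; last by move=> c cD; have [] := increments_law (tnth t ^~ c) cD o0 h0.
  rewrite [in RHS](bigID (mem D)) /= [X in _ * X]big1 ?mulr1; last first.
    move=> c cD; rewrite big1 // => i _.
    by rewrite /weight (negPf cD) offD.
  rewrite -prodEFin; apply: eq_bigr => c cD.
  by have [_ ->] := increments_law (tnth t ^~ c) cD o0 h0.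
rewrite negb_forall => /existsP[i]; rewrite negb_forall => /existsP[c].
rewrite negb_imply => /andP[cD tic].
have -> : [set w | cells o h m w = t] = set0.
  apply/seteqP; split=> // w /= E; move: tic.
  by rewrite -E tnth_mktuple ffunE (negPf cD) eqxx.
split; first exact: measurable0.
rewrite measure0 (bigD1 c) //= (bigD1 i) //= {1}/weight (negPf cD) (negPf tic).
by rewrite mul0r mul0r.
Qed.

Lemma integral_cells o h m (g : m.-tuple {ffun C -> 'I_3} -> R) : 0 <= o -> 0 < h ->
  (forall t, 0 <= g t) ->
  (\int[P]_w (g (cells o h m w))%:E =
   (\sum_(t : m.-tuple {ffun C -> 'I_3}) (\prod_(v <- t) cell_law h v) * g t)%:E)%E.
Proof.
move=> o0 h0 g0; rewrite integral_finite_fun // => [|t]; last first.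
  by have [] := cells_law t o0 h0.
rewrite -sumEFin; apply: eq_bigr => t _; rewrite muleC EFinM.
by have [_ ->] := cells_law t o0 h0.
Qed.

Lemma measurable_cells_fun o h m (g : m.-tuple {ffun C -> 'I_3} -> R) : 0 <= o -> 0 < h ->
  measurable_fun setT (fun w => g (cells o h m w)).
Proof.
move=> o0 h0 _ B mB; rewrite setTI.
have -> : (fun w => g (cells o h m w)) @^-1` B =
  \bigcup_(t in [set t | B (g t)]) [set w | cells o h m w = t].
  apply/seteqP; split=> w /=; first by move=> Bw; exists (cells o h m w).
  by move=> [t /= Bt ->].
apply: fin_bigcup_measurable => [|t _]; first exact: finite_finset.
by have [] := cells_law t o0 h0.
Qed.

Definition unit_cell (c : C) : {ffun C -> 'I_3} :=
  [ffun c' => if c' == c then inord 1 else ord0].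

Definition event_count (s t : R) (w : T) : nat := \sum_(c in D) increment c s t w.

Definition total_rate : R := \sum_(c in D) rate c.

Lemma trunc0 k : (trunc k == ord0) = (k == 0%N).
Proof. exact: (@trunc_eq k ord0). Qed.

Lemma trunc1 k : (trunc k == inord 1) = (k == 1%N).
Proof. by rewrite trunc_eq inordK. Qed.

Lemma cell_eq0 s t w : (cell s t w == [ffun=> ord0]) = (event_count s t w == 0%N).
Proof.
apply/eqP/eqP => [/ffunP h|].
  rewrite /event_count big1 // => c cD; apply/eqP; rewrite -trunc0.
  by have := h c; rewrite !ffunE cD => ->.
move=> /eqP; rewrite /event_count sum_nat_eq0 => /forall_inP h.
by apply/ffunP => c; rewrite !ffunE; case: ifPn => // cD; apply/eqP; rewrite trunc0 h.
Qed.

Lemma cell_unit s t w c : c \in D -> cell s t w = unit_cell c ->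
  increment c s t w = 1%N /\ forall c', c' \in D -> c' != c -> increment c' s t w = 0%N.
Proof.
move=> cD /ffunP h; split.
  by apply/eqP; rewrite -trunc1; have := h c; rewrite !ffunE cD eqxx => ->.
move=> c' c'D ne; apply/eqP; rewrite -trunc0.
by have := h c'; rewrite !ffunE c'D (negPf ne) => ->.
Qed.

Lemma event_count_le1P s t w : (event_count s t w <= 1)%N <->
  cell s t w = [ffun=> ord0] \/ exists2 c, c \in D & cell s t w = unit_cell c.
Proof.
split.
  rewrite leq_eqVlt ltnS leqn0 => /orP[/eqP t1|]; last first.
    by rewrite -cell_eq0 => /eqP; left.
  right; have [|] := boolP [exists c, (c \in D) && (0 < increment c s t w)%N]; last first.
    rewrite negb_exists => /forallP h; move: t1; rewrite /event_count big1 // => c cD.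
    by have := h c; rewrite cD /= lt0n negbK => /eqP.
  move=> /existsP[c /andP[cD c1]].
  exists c => //; apply/ffunP => c'; rewrite !ffunE.
  move: t1; rewrite /event_count (bigD1 c) //= => t1.
  have [->|ne] := eqVneq c' c; first by rewrite cD; apply/eqP; rewrite trunc1; lia.
  case: ifPn => // c'D; apply/eqP; rewrite trunc0.
  move: t1; rewrite (bigD1 c') /=; last by rewrite c'D.
  by lia.
case=> [/eqP|[c cD cu]]; first by rewrite cell_eq0 => /eqP ->.
have [c1 c0] := cell_unit cD cu.
by rewrite /event_count (bigD1 c) //= c1 big1 // => c' /andP[c'D ne]; exact: c0.
Qed.

Lemma cell_law0 h : cell_law h [ffun=> ord0] = expR (- (total_rate * h)).
Proof.
rewrite /cell_law /total_rate mulr_suml -sumrN expR_sum [LHS](bigID (mem D)) /=.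
rewrite [X in _ * X]big1 ?mulr1 => [|c cD]; last first.
  by rewrite /weight (negPf cD) ffunE eqxx.
by apply: eq_bigr => c cD; rewrite /weight cD ffunE.
Qed.

Lemma cell_law_unit h c : c \in D ->
  cell_law h (unit_cell c) = rate c * (h * expR (- (total_rate * h))).
Proof.
move=> cD; rewrite mulrA -cell_law0 /cell_law [LHS](bigD1 c) //=.
rewrite [X in _ = _ * X](bigD1 c) //= /weight cD !ffunE eqxx inordK //= mulrA.
by congr (_ * _); apply: eq_bigr => c' ne; rewrite !ffunE (negPf ne).
Qed.

Lemma single_cell_law s h v : 0 <= s -> 0 < h ->
  measurable [set w | cell s (s + h) w = v] /\
  P [set w | cell s (s + h) w = v] = (cell_law h v)%:E.
Proof.
move=> s0 h0; have := @cells_law s h 1 [tuple v] s0 h0.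
rewrite big_seq1.
have -> : [set w | cells s h 1 w = [tuple v]] = [set w | cell s (s + h) w = v].
  apply/seteqP; split=> w /=.
    by move=> /(congr1 (fun t => tnth t ord0)); rewrite tnth_mktuple mul0r mul1r addr0.
  by move=> E; apply: eq_from_tnth => i; rewrite ord1 tnth_mktuple mul0r mul1r addr0.
by [].
Qed.

Definition good_cells : {set {ffun C -> 'I_3}} :=
  [ffun=> ord0] |: [set unit_cell c | c in D].

Lemma event_count_le1 s t w : (event_count s t w <= 1)%N = (cell s t w \in good_cells).
Proof.
apply/idP/idP => [/event_count_le1P[->|[c cD ->]]|].
- by rewrite in_setU1 eqxx.
- by rewrite in_setU1; apply/orP; right; apply/imsetP; exists c.
rewrite in_setU1 => /orP[/eqP h|/imsetP[c cD h]]; apply/event_count_le1P; [by left|right].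
by exists c.
Qed.

Lemma unit_cell_inj : injective unit_cell.
Proof.
move=> c c' /ffunP/(_ c); rewrite !ffunE eqxx; case: eqP => // _.
by move=> /(congr1 val); rewrite /= inordK.
Qed.

Lemma sum_good_cells h : \sum_(v in good_cells) cell_law h v =
  (1 + total_rate * h) * expR (- (total_rate * h)).
Proof.
rewrite big_setU1 /=; last first.
  apply/negP => /imsetP[c cD /ffunP/(_ c)]; rewrite !ffunE eqxx.
  by move=> /(congr1 val); rewrite /= inordK.
rewrite cell_law0 big_imset /=; last by move=> c c' _ _; exact: unit_cell_inj.
under eq_bigr => c cD do rewrite cell_law_unit //.
by rewrite -mulr_suml -/total_rate; ring.
Qed.

Lemma total_rate_ge0 : 0 <= total_rate.
Proof. by apply: sumr_ge0 => c /rate0 /ltW. Qed.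

(** With x = [total_rate * h], the complement has probability (1 + x) exp(- x), and exp(- x) >= 1 -
    x leaves at most x^2. *)
Lemma bad_cell s h : 0 <= s -> 0 < h ->
  measurable [set w | (1 < event_count s (s + h) w)%N] /\
  (P [set w | (1 < event_count s (s + h) w)%N] <= ((total_rate * h) ^+ 2)%:E)%E.
Proof.
move=> s0 h0; pose g v : R := (v \notin good_cells)%:R.
have mcell v : measurable ((cell s (s + h)) @^-1` [set v]).
  by have [] := single_cell_law v s0 h0.
have E : [set w | (1 < event_count s (s + h) w)%N] =
    \bigcup_(v in [set` ~: good_cells]) (cell s (s + h)) @^-1` [set v].
  apply/seteqP; split=> w /=.
    by rewrite ltnNge event_count_le1 => h1; exists (cell s (s + h) w) => //=; rewrite inE.
  by move=> [v /=]; rewrite inE => h1 E; rewrite ltnNge event_count_le1 E.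
have mb : measurable [set w | (1 < event_count s (s + h) w)%N].
  by rewrite E; apply: fin_bigcup_measurable => // v _.
split=> //.
have -> : P [set w | (1 < event_count s (s + h) w)%N] =
    (\int[P]_w (g (cell s (s + h) w))%:E)%E.
  rewrite -[in LHS](setIT [set w | _]) -integral_indic //.
  apply: eq_integral => w _; rewrite indicE /g -event_count_le1 -ltnNge; congr (_%:R%:E).
  by case: (ltnP 1 (event_count s (s + h) w)) => h1; [rewrite mem_set|rewrite memNset //= ltnNge h1].
rewrite integral_finite_fun //.
under eq_bigr => v _.
  have [_ pv] := single_cell_law v s0 h0.
  rewrite [P _]pv -EFinM.
  over.
rewrite sumEFin lee_fin.
have -> : \sum_v g v * cell_law h v = 1 - \sum_(v in good_cells) cell_law h v.
  apply/eqP; rewrite eq_sym subr_eq -(sum_cell_law h) [X in X == _](bigID (mem good_cells)) /=.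
  rewrite addrC [X in _ == X + _](bigID (mem good_cells)) /=.
  rewrite [X in _ == X + _ + _]big1 ?add0r => [|v vg]; last by rewrite /g vg mul0r.
  by rewrite (inj_eq (addIr _)); apply/eqP/eq_bigr => v vg; rewrite /g vg mul1r.
rewrite sum_good_cells; set x := total_rate * h.
have x0 : 0 <= x by rewrite mulr_ge0 ?total_rate_ge0 // ltW.
have := expR_ge1Dx (- x) => h1.
have : (1 + x) * (1 - x) <= (1 + x) * expR (- x) by rewrite ler_wpM2l // addr_ge0.
by lra.
Qed.

Definition good_grid (Tm : R) (k : nat) (w : T) : Prop :=
  forall j : nat, (j < 2 ^ k)%N ->
    (event_count (j%:R * (Tm / (2 ^ k)%:R)) (j.+1%:R * (Tm / (2 ^ k)%:R)) w <= 1)%N.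

Lemma cnt_mono c s t w : c \in D -> 0 <= s -> s <= t -> (cnt c s w <= cnt c t w)%N.
Proof. by move=> cD s0 st; have [_ /(_ w)[_ h _] _ _] := pois cD; exact: h. Qed.

Lemma event_count_mono s s' t t' w : 0 <= s' -> s' <= s -> s <= t -> t <= t' ->
  (event_count s t w <= event_count s' t' w)%N.
Proof.
move=> s'0 ss st tt; apply: leq_sum => c cD; apply: leq_sub.
  by apply: cnt_mono => //; apply: le_trans st; apply: le_trans ss.
exact: cnt_mono.
Qed.

(** Cell [j] of the finer grid lies in cell [j./2] of the coarser one. Hence bad grids form a
    decreasing sequence of events, and no Borel-Cantelli argument is needed. *)
Lemma good_gridS Tm k w : 0 < Tm -> good_grid Tm k w -> good_grid Tm k.+1 w.
Proof.
move=> T0 gk j jk.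
have j2 : (j./2 < 2 ^ k)%N by move: jk; rewrite expnS; lia.
apply: leq_trans (gk _ j2).
have k0 : 0 < (2 ^ k)%:R :> R by rewrite ltr0n expn_gt0.
have e : (2 ^ k.+1)%:R = 2 * (2 ^ k)%:R :> R by rewrite expnS natrM.
have hh : Tm / (2 ^ k)%:R = 2 * (Tm / (2 ^ k.+1)%:R).
  by rewrite e; field; rewrite gt_eqF.
have h0 : 0 < Tm / (2 ^ k.+1)%:R by rewrite divr_gt0 // e mulr_gt0.
rewrite hh; move: (Tm / (2 ^ k.+1)%:R) h0 => h' h0.
rewrite !mulrA -!natrM; apply: event_count_mono.
- by rewrite mulr_ge0 // ltW.
- by rewrite ler_pM2r // ler_nat; lia.
- by rewrite ler_pM2r // ler_nat.
- by rewrite ler_pM2r // ler_nat; lia.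
Qed.

Lemma ae_good_grid Tm : 0 < Tm ->
  {ae P, forall w, exists k0, forall k, (k0 <= k)%N -> good_grid Tm k w}.
Proof.
move=> T0.
pose h k := Tm / (2 ^ k)%:R.
have k0 k : 0 < (2 ^ k)%:R :> R by rewrite ltr0n expn_gt0.
have h0 k : 0 < h k by rewrite divr_gt0.
pose B k (j : nat) := [set w | (1 < event_count (j%:R * h k) (j%:R * h k + h k) w)%N].
pose bad k := \bigcup_(j in `I_(2 ^ k)) B k j.
have jh0 k (j : nat) : 0 <= j%:R * h k by rewrite mulr_ge0 // ltW.
have mB k j : measurable (B k j) by have [] := bad_cell (jh0 k j) (h0 k).
have mbad k : measurable (bad k).
  by apply: fin_bigcup_measurable => // j _.
(* There are 2^k cells, each bad with probability at most (total_rate Tm / 2^k)^2. *)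
have Pbad k : (P (bad k) <= ((total_rate * Tm) ^+ 2 * (2 ^ k)%:R^-1)%:E)%E.
  apply: (@le_trans _ _ (\sum_(j < 2 ^ k) P (B k j))%E).
    apply: content_subadditive => //; rewrite /bad bigcup_mkord //.
  apply: (@le_trans _ _ (\sum_(j < 2 ^ k) ((total_rate * h k) ^+ 2)%:E)%E).
    by apply: lee_sum => j _; have [] := bad_cell (jh0 k j) (h0 k).
  rewrite sumEFin lee_fin sumr_const card_ord -[_ *+ (2 ^ k)]mulr_natl /h.
  rewrite le_eqVlt; apply/orP; left; apply/eqP.
  by field; rewrite gt_eqF.
exists (\bigcap_k bad k); split.
- exact: bigcapT_measurable.
- apply/eqP; rewrite -measure_le0; apply/lee_addgt0Pr => e e0; rewrite add0e.
  have [k hk] : exists k, (total_rate * Tm) ^+ 2 * (2 ^ k)%:R^-1 <= e.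
    have c0 : 0 <= (total_rate * Tm) ^+ 2 / e by rewrite divr_ge0 ?sqr_ge0 // ltW.
    exists (Num.bound ((total_rate * Tm) ^+ 2 / e)).
    have := archi_boundP c0; set b := Num.bound _ => hb.
    rewrite ler_pdivrMr // [leRHS]mulrC -ler_pdivrMr // (le_trans (ltW hb)) //.
    by rewrite ler_nat ltnW // ltn_expl.
  apply: (le_trans (le_measure P _ _ (_ : \bigcap_k bad k `<=` bad k))).
  + by rewrite inE; exact: bigcapT_measurable.
  + by rewrite inE.
  + by move=> w; apply.
  + by apply: (le_trans (Pbad k)); rewrite lee_fin.
- move=> w /= H k _; apply: contrapT => nb; apply: H; exists k => k' kk'.
  have gk : good_grid Tm k w.
    move=> j jk; rewrite leqNgt; apply/negP => b; apply: nb; exists j => //=.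
    by move: b; rewrite -natr1 mulrDl mul1r.
  rewrite -(subnK kk'); elim: (k' - k)%N => [//|i IH].
  by rewrite addSn; exact: good_gridS.
Qed.

Definition single_event (v : {ffun C -> 'I_3}) : option C :=
  [pick c | (c \in D) && (v == unit_cell c)].

Lemma single_event_unit c : c \in D -> single_event (unit_cell c) = Some c.
Proof.
move=> cD; rewrite /single_event; case: pickP => [c' /andP[_ /eqP/unit_cell_inj ->] //|].
by move=> /(_ c); rewrite cD eqxx.
Qed.

Definition unit_cells : {set {ffun C -> 'I_3}} := [set unit_cell c | c in D].

Lemma single_event_None v : v \notin unit_cells ->
  single_event v = None.
Proof.
rewrite /single_event; case: pickP => // c /andP[cD /eqP ->] /negP[].
by apply/imsetP; exists c.
Qed.

Section Chain.
Variables (V : Type) (Phi : V -> R) (J : C -> V -> V) (A : V -> V).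

(* Cells with several events also move by A, so that the law of a step is
   explicit; almost surely they disappear on fine grids. *)
Definition chain_step (S : V) (v : {ffun C -> 'I_3}) : V :=
  if single_event v is Some c then J c S else A S.

(** A cell whose only event is one ring of [c] has probability [rate c * kappa]; all other cells
    take the step [A], with total probability [1 - total_rate * kappa]. *)
Lemma expect_chain_step h S : let kappa := h * expR (- (total_rate * h)) in
  \sum_v cell_law h v * Phi (chain_step S v) =
  Phi S + kappa * (\sum_(c in D) rate c * (Phi (J c S) - Phi S))
  + (1 - total_rate * kappa) * (Phi (A S) - Phi S).
Proof.
move=> kappa; pose U := unit_cells.
have splitU (F : {ffun C -> 'I_3} -> R) :
    \sum_v F v = \sum_(c in D) F (unit_cell c) + \sum_(v | v \notin U) F v.
  rewrite (bigID (mem U)) /= big_imset //= => c c' _ _.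
  exact: unit_cell_inj.
have := sum_cell_law h; rewrite !splitU.
under eq_bigr => c cD do rewrite cell_law_unit // -/kappa.
under [X in _ -> X + _ = _]eq_bigr => c cD do
  rewrite cell_law_unit // -/kappa /chain_step single_event_unit //.
under [X in _ -> _ + X = _]eq_bigr => v vU do
  rewrite /chain_step single_event_None //.
rewrite -mulr_suml -/total_rate -mulr_suml => /eqP.
rewrite addrC eq_sym -subr_eq => /eqP <-.
have -> : \sum_(c in D) rate c * (Phi (J c S) - Phi S) =
    \sum_(c in D) rate c * Phi (J c S) - total_rate * Phi S.
  by rewrite /total_rate mulr_suml -sumrB; apply: eq_bigr => c _; rewrite mulrBr.
have -> : \sum_(c in D) rate c * kappa * Phi (J c S) =
    kappa * \sum_(c in D) rate c * Phi (J c S).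
  by rewrite mulr_sumr; apply: eq_bigr => c _; ring.
by ring.
Qed.

(** The Markov property in finite form: the first cell is split off, and the product weight of the
    remaining cells does not depend on it. *)
Lemma expect_chain (inv : V -> Prop) h r m S : 0 <= r -> 0 <= h ->
  (forall S v, inv S -> inv (chain_step S v)) ->
  (forall S, inv S -> \sum_v cell_law h v * Phi (chain_step S v) <= r * Phi S) ->
  inv S ->
  \sum_(t : m.-tuple {ffun C -> 'I_3})
    (\prod_(v <- t) cell_law h v) * Phi (foldl chain_step S t) <= r ^+ m * Phi S.
Proof.
move=> r0 h0 inv_step dec; elim: m S => [|m IH] S iS.
  by rewrite sum_tuple_nil big_nil expr0 !mul1r.
rewrite sum_tuple_cons /=.
apply: (@le_trans _ _ (\sum_v cell_law h v * (r ^+ m * Phi (chain_step S v)))).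
  apply: ler_sum => v _; rewrite [leLHS](_ : _ = cell_law h v *
    \sum_(t : m.-tuple {ffun C -> 'I_3})
    (\prod_(v <- t) cell_law h v) * Phi (foldl chain_step (chain_step S v) t)).
    by rewrite ler_wpM2l ?cell_law_ge0 // IH //; exact: inv_step.
  by rewrite mulr_sumr; apply: eq_bigr => t _; rewrite big_cons mulrA.
rewrite exprSr -mulrA; apply: le_trans (ler_wpM2l (exprn_ge0 m r0) (dec _ iS)).
by rewrite mulr_sumr; apply: ler_sum => v _; rewrite mulrCA.
Qed.

End Chain.

End GridLaw.

(** * Pathwise convergence of the grid chain *)

Lemma cvg_dyadic_step (R : realType) (t : R) : t / (2 ^ k)%:R @[k --> \oo] --> (0 : R).
Proof.
have -> : (fun k => t / (2 ^ k)%:R) = geometric t 2^-1.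
  by apply/funext => k; rewrite /geometric /= natrX exprVn.
by apply: cvg_geometric; rewrite gtr0_norm ?invr_gt0 // invf_lt1 // ltr1n.
Qed.

Section RealInduction.
Variable R : realType.
Implicit Types (a b c r : R) (A : R -> Prop).

Lemma real_induction a b A : a <= b -> A a ->
  (forall c, a <= c -> c < b -> (forall r, a <= r -> r <= c -> A r) ->
     exists2 d, c < d & forall r, c < r -> r < d -> A r) ->
  (forall c, a < c -> c <= b -> (forall r, a <= r -> r < c -> A r) -> A c) ->
  forall r, a <= r -> r <= b -> A r.
Proof.
move=> ab Aa right left.
pose E := [set c | [/\ a <= c, c <= b & forall r, a <= r -> r <= c -> A r]].
have Ea : E a.
  by split=> // r ar ra; have -> : r = a by apply/le_anti; rewrite ar ra.
have ubE : ubound E b by move=> c [].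
have hE : has_sup E by split; [exists a|exists b].
set s := sup E.
have as_ : a <= s by apply: ub_le_sup => //; exists b.
have sb : s <= b by apply: ge_sup; [exists a|].
have below r : a <= r -> r < s -> A r.
  move=> ar rs; have [c [_ _ Ec] cr] : exists2 c, E c & r < c.
    have := @sup_adherent _ E (s - r); rewrite subr_gt0 => /(_ rs hE)[c Ec].
    by rewrite -/s opprB addrCA subrr addr0; exists c.
  by apply: Ec => //; exact: ltW.
have As : A s.
  by move: as_; rewrite le_eqVlt => /orP[/eqP <- //|as_]; exact: left.
have upto r : a <= r -> r <= s -> A r.
  by move=> ar; rewrite le_eqVlt => /orP[/eqP -> //|]; exact: below.
have [sb'|bs] := ltP s b; last first.
  by move=> r ar rb; apply: upto => //; exact: le_trans bs.
have [d sd Ad] := right s as_ sb' upto.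
pose r := Num.min b ((s + d) / 2).
have sr : s < r by rewrite /r lt_min sb'; lra.
have rd : r < d by rewrite /r gt_min; apply/orP; right; lra.
have : E r.
  split; [exact: le_trans (ltW sr)|by rewrite /r ge_min lexx|].
  move=> r' ar' r'r; have [r's|sr'] := leP r' s; first exact: upto.
  by apply: Ad => //; exact: le_lt_trans rd.
by move=> /(ub_le_sup (ex_intro _ b ubE)); rewrite leNgt sr.
Qed.

Lemma near_right c (Q : R -> Prop) :
  (\forall x \near c^'+, Q x) -> exists2 d, c < d & forall r, c < r -> r < d -> Q r.
Proof.
move=> /nbhs_ballP[e /= e0 h]; exists (c + e); first by rewrite ltrDl.
move=> r cr rd; apply: h => //=; rewrite /ball /= distrC ger0_norm ?subr_ge0 ?ltW //.
by rewrite ltrBlDl.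
Qed.

Lemma near_left c (Q : R -> Prop) :
  (\forall x \near c^'-, Q x) -> exists2 d, d < c & forall r, d < r -> r < c -> Q r.
Proof.
move=> /nbhs_ballP[e /= e0 h]; exists (c - e); first by rewrite ltrBlDr ltrDl.
move=> r cr rd; apply: h => //=; rewrite /ball /= ger0_norm ?subr_ge0 ?ltW //.
by lra.
Qed.

End RealInduction.

(** * Mean value inequality and boundedness for vector-valued paths *)

Section MeanValue.
Variables (R : realType) (V : normedModType R).
Implicit Types (u du : R -> V) (a b s t : R).

Lemma derive_step u (l : V) (c : R) (B K : R) : is_derive c 1 u l -> `|l| <= B -> B < K ->
  exists2 d, c < d & forall r, c < r -> r < d -> `|u r - u c| <= K * (r - c).
Proof.
move=> [dc dl] lB BK.
have : (fun h => h^-1 *: (u (h *: 1 + c) - u c)) @ 0^' --> l by rewrite -dl.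
move=> /cvgrPdist_lt/(_ (K - B)); rewrite subr_gt0 => /(_ BK).
move=> /nbhs_ballP[e /= e0 H].
exists (c + e); first by rewrite ltrDl.
move=> r cr rd; have rc : 0 < r - c by rewrite subr_gt0.
have := H (r - c); rewrite /ball /= sub0r normrN gtr0_norm // ltrBlDl => /(_ rd).
move=> /(_ (lt0r_neq0 rc)); rewrite [(r - c) *: _]mulr1 subrK => h.
have -> : u r - u c = (r - c) *: ((r - c)^-1 *: (u r - u c)).
  by rewrite scalerA divff ?scale1r // gt_eqF.
rewrite normrZ gtr0_norm // mulrC ler_pM2r //.
set w := (r - c)^-1 *: _ in h *.
have -> : w = l - (l - w) by rewrite opprB addrC subrK.
apply: (le_trans (ler_normB _ _)); rewrite -[K](subrK B) addrC lerD //.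
exact: ltW.
Qed.

(** Vector values exclude the mean value theorem as an equality. Real induction works for each slope
    [K] above [B]: differentiability extends the bound to the right and continuity closes it at
    limits. *)
Lemma norm_increment_le u du a b B : a < b ->
  (forall t, a < t -> t < b -> is_derive t 1 u (du t)) ->
  (forall t, a < t -> t < b -> `|du t| <= B) ->
  forall s t, a < s -> s <= t -> t < b -> `|u t - u s| <= B * (t - s).
Proof.
move=> ab du_ duB s t as_ st tb.
have cu r : a < r -> r < b -> {for r, continuous u}.
  move=> ar rb; have [h _] := du_ r ar rb.
  by apply: differentiable_continuous; apply/derivable1_diffP.
apply/ler_addgt0Pr => e e0.
(* The excess slope is chosen so that it contributes at most [e] over the whole interval. *)
pose K := B + e / (t - s + 1).
have ts0 : 0 < t - s + 1 by rewrite ltr_wpDl // subr_ge0.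
have BK : B < K by rewrite ltrDl divr_gt0.
have : `|u t - u s| <= K * (t - s).
  apply: (@real_induction _ s t (fun r => `|u r - u s| <= K * (r - s))) => //.
  - by rewrite !subrr normr0 mulr0.
  - move=> c sc ct IH.
    have ac : a < c := lt_le_trans as_ sc.
    have cb : c < b := lt_trans ct tb.
    have [d cd Hd] := derive_step (du_ _ ac cb) (duB _ ac cb) BK.
    exists d => // r cr rd.
    have -> : u r - u s = (u r - u c) + (u c - u s) by rewrite addrA subrK.
    apply: (le_trans (ler_normD _ _)).
    have := IH c sc (lexx _); have := Hd r cr rd; lra.
  - move=> c sc ct IH.
    have ac : a < c := lt_trans as_ sc.
    have cb : c < b := le_lt_trans ct tb.
    have h1 : `|u r - u s| @[r --> c^'-] --> `|u c - u s|.
      apply: cvg_at_left_filter; apply: cvg_norm; apply: cvgB; last exact: cvg_cst.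
      exact: cu.
    have h2 : K * (r - s) @[r --> c^'-] --> K * (c - s).
      apply: cvg_at_left_filter; apply: cvgM; first exact: cvg_cst.
      by apply: cvgB; [exact: cvg_id|exact: cvg_cst].
    apply: (ler_cvg_to h1 h2); near=> r; apply: IH.
      by near: r; exact: nbhs_left_ge.
    by near: r; exact: nbhs_left_lt.
move=> /le_trans; apply; rewrite /K mulrDl lerD2l mulrAC ler_pdivrMr //.
by rewrite ler_pM2l // lerDl.
Unshelve. all: by end_near.
Qed.

(** The endpoints may carry events, where no derivative is available; only right continuity at [a]
    and the left limit at [b] are used there. *)
Lemma norm_increment_oo u du a b B l : a < b ->
  (forall t, a < t -> t < b -> is_derive t 1 u (du t)) ->
  (forall t, a < t -> t < b -> `|du t| <= B) ->
  u s @[s --> a^'+] --> u a -> u s @[s --> b^'-] --> l ->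
  `|l - u a| <= B * (b - a).
Proof.
move=> ab du_ duB ua ub.
have B0 : 0 <= B.
  by apply: (le_trans (normr_ge0 (du ((a + b) / 2)))); apply: duB; lra.
have h t : a < t -> t < b -> `|u t - u a| <= B * (b - a).
  move=> at_ tb.
  have h1 : `|u t - u s| @[s --> a^'+] --> `|u t - u a|.
    by apply: cvg_norm; apply: cvgB; [exact: cvg_cst|exact: ua].
  apply: (ler_cvg_to h1 (cvg_cst _)); near=> s.
  have as_ : a < s by [].
  have st : s <= t by near: s; exact: nbhs_right_le.
  apply: (le_trans (norm_increment_le ab du_ duB as_ st tb)).
  by rewrite ler_wpM2l // lerB // ltW.
have h1 : `|u t - u a| @[t --> b^'-] --> `|l - u a|.
  by apply: cvg_norm; apply: cvgB; [exact: ub|exact: cvg_cst].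
apply: (ler_cvg_to h1 (cvg_cst _)); near=> t; apply: h; last by [].
by near: t; exact: nbhs_left_gt.
Unshelve. all: by end_near.
Qed.

Lemma cadlag_bounded u Tm : 0 <= Tm -> cadlag u ->
  exists M, forall t, 0 <= t -> t <= Tm -> `|u t| <= M.
Proof.
move=> T0 [cr cl].
suff [M HM] : exists M, forall t, 0 <= t -> t <= Tm -> `|u t| <= M by exists M.
apply: (@real_induction _ 0 Tm (fun r => exists M, forall t, 0 <= t -> t <= r -> `|u t| <= M)) => //.
- exists `|u 0| => t t0 t0'; have -> // : t = 0 by apply/le_anti; rewrite t0 t0'.
- move=> c c0 cT /(_ c c0 (lexx _))[M HM].
  have /cvgrPdist_lt/(_ 1 ltr01)/near_right[d cd Hd] := cr c c0.
  exists d => // r crr rd; exists (Num.max M (`|u c| + 1)) => t t0 tr.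
  have [tc|ct] := leP t c; first by rewrite le_max HM.
  rewrite le_max; apply/orP; right.
  have := Hd t ct (le_lt_trans tr rd) => h.
  have -> : u t = u c - (u c - u t) by rewrite opprB addrC subrK.
  by apply: (le_trans (ler_normB _ _)); rewrite lerD2l ltW.
- move=> c c0 cT IH.
  have /cvg_ex[l] := cl c c0.
  move=> /cvgrPdist_lt/(_ 1 ltr01)/near_left[d dc Hd].
  (* The interval up to [e] is covered by the induction; beyond [e] the left limit at [c] bounds the
     path. The maximum with 0 keeps [e] in the domain. *)
  pose e := Num.max 0 ((d + c) / 2).
  have ec : e < c by rewrite /e gt_max c0; lra.
  have e00 : 0 <= e by rewrite /e le_max lexx.
  have [M HM] := IH e e00 ec.
  exists (Num.max M (Num.max (`|l| + 1) `|u c|)) => t t0 tc.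
  rewrite !le_max.
  have [te|et] := leP t e; first by rewrite HM.
  move: tc; rewrite le_eqVlt => /orP[/eqP ->|tc]; first by rewrite lexx !orbT.
  have dt : d < t by apply: le_lt_trans et; rewrite /e le_max; apply/orP; right; lra.
  have := Hd t dt tc => h; apply/orP; right; apply/orP; left.
  have -> : u t = l - (l - u t) by rewrite opprB addrC subrK.
  by apply: (le_trans (ler_normB _ _)); rewrite lerD2l ltW.
Qed.

Lemma is_derive_scalel (v : V) (r : R) : is_derive r 1 (fun r => r *: v) v.
Proof.
have h : (fun h => h^-1 *: ((h *: 1 + r) *: v - r *: v)) @ (0 : R)^' --> v.
  apply: cvg_near_cst; near=> h.
  rewrite scalerDl addrK [h *: 1]mulr1 scalerA mulVf ?scale1r //.
  by near: h; exact: nbhs_dnbhs_neq.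
by apply: DeriveDef; [apply/cvg_ex; exists v|apply/cvg_lim].
Unshelve. all: by end_near.
Qed.

End MeanValue.

(** * Jump times of one counting path *)

Section Jumps.
Variables (R : realType) (dT : measure_display) (T : measurableType dT).
Variables (cnt : R -> T -> nat) (w : T).
Hypothesis mono : forall s t, 0 <= s -> s <= t -> (cnt s w <= cnt t w)%N.
Hypothesis cadlag_cnt : cadlag (real_path (R := R) cnt w).
Let nu : R -> R := real_path cnt w.

Lemma jump_eq (c r : R) (k : nat) : c < r ->
  (forall t, c < t -> t < r -> cnt t w = k) -> jump nu r = nu r - k%:R.
Proof.
move=> cr h; rewrite /jump /left_limit; congr (_ - _).
apply/cvg_lim => //; apply: cvg_near_cst; near=> t.
have ct : c < t by near: t; exact: nbhs_left_gt.
by rewrite /nu /real_path h.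
Unshelve. all: by end_near.
Qed.

Lemma jump_no_increment s t : 0 <= s -> (cnt t w - cnt s w)%N = 0%N ->
  forall r, s < r -> r <= t -> jump nu r = 0.
Proof.
move=> s0 /eqP; rewrite subn_eq0 => ts r sr rt.
have E r' : s <= r' -> r' <= t -> cnt r' w = cnt s w.
  move=> sr' r't; apply/eqP; rewrite eqn_leq (leq_trans (mono _ r't) ts) ?mono //.
  exact: le_trans s0 sr'.
rewrite (@jump_eq s r (cnt s w)) // => [|r' sr' r'r].
  by rewrite /nu /real_path E ?subrr // ltW.
by rewrite E ?ltW //; exact: lt_le_trans rt.
Qed.

(** The jump time is the infimum of the times at which the larger count is reached. *)
Lemma jump_unit_increment s t : 0 <= s -> s < t -> (cnt t w - cnt s w)%N = 1%N ->
  exists tau, [/\ s < tau, tau <= t, jump nu tau = 1 &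
    (forall r, s < r -> r < tau -> jump nu r = 0) /\
    (forall r, tau < r -> r <= t -> jump nu r = 0)].
Proof.
move=> s0 st ts.
have tS : cnt t w = (cnt s w).+1 by lia.
pose E := [set r | s <= r /\ r <= t /\ cnt r w = (cnt s w).+1].
have Et : E t by split; [exact: ltW|].
have lbE : lbound E s by move=> r [].
have hE : has_inf E by split; [exists t|exists s].
set tau := inf E.
have stau : s <= tau by apply: lb_le_inf => //; exists t.
have taut : tau <= t by apply: ge_inf => //; exists s.
have after r : tau < r -> r <= t -> cnt r w = (cnt s w).+1.
  move=> taur rt; have := @inf_adherent _ E (r - tau).
  rewrite subr_gt0 => /(_ taur hE)[r' [sr' [r't Er']]].
  rewrite -/tau addrC subrK => r'r.
  apply/eqP; rewrite eqn_leq -{1}tS -Er' !mono //.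
  - exact: le_trans sr'.
  - exact: ltW.
  - exact: le_trans (le_trans s0 stau) (ltW taur).
have before r : s <= r -> r < tau -> cnt r w = cnt s w.
  move=> sr rtau; have rt : r <= t := le_trans (ltW rtau) taut.
  have h1 := mono s0 sr; have h2 := mono (le_trans s0 sr) rt.
  have [//|h] : cnt r w = cnt s w \/ cnt r w = (cnt s w).+1 by lia.
  have : E r by [].
  by move=> /(ge_inf (ex_intro _ s lbE)); rewrite leNgt rtau.
(* The infimum is attained: just after [tau] the count is already the larger one, and the path is
   right-continuous. *)
have Etau : cnt tau w = (cnt s w).+1.
  move: taut; rewrite le_eqVlt => /orP[/eqP -> //|taut'].
  have c1 := (proj1 cadlag_cnt) tau (le_trans s0 stau).
  have c2 : real_path (R := R) cnt w r @[r --> tau^'+] --> ((cnt s w).+1%:R : R).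
    apply: cvg_near_cst; near=> r.
    have rt : r <= t by near: r; exact: nbhs_right_le.
    by rewrite /real_path after.
  have e2 : lim (real_path (R := R) cnt w r @[r --> tau^'+]) = (cnt s w).+1%:R.
    by apply/cvg_lim.
  have e1 : lim (real_path (R := R) cnt w r @[r --> tau^'+]) = (cnt tau w)%:R.
    by apply/cvg_lim.
  move/eqP: e2; rewrite e1.
  by rewrite eqr_nat => /eqP.
have stau' : s < tau.
  rewrite lt_neqAle stau andbT; apply/eqP => e.
  by move: Etau; rewrite -e; lia.
exists tau; split => //.
  rewrite (@jump_eq s tau (cnt s w)) // => [|r sr rtau].
    by rewrite /nu /real_path Etau -natr1 addrAC subrr add0r.
  by rewrite before // ltW.
split=> r h1 h2.
  apply: (@jump_no_increment s r) => //.
  by rewrite before ?subnn // ltW.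
apply: (@jump_no_increment tau r) => //; first exact: le_trans stau.
by rewrite after // Etau subnn.
Unshelve. all: by end_near.
Qed.
End Jumps.

(** * Error of the grid chain along one path *)

Section Path.
Variables (R : realType) (V : normedModType R).
Variables (dT : measure_display) (T : measurableType dT).
Variables (C : finType) (D : {set C}) (cnt : C -> R -> T -> nat) (w : T).
Hypothesis mono : forall c, c \in D -> forall s t, 0 <= s -> s <= t ->
  (cnt c s w <= cnt c t w)%N.
Hypothesis cadlag_cnt : forall c, c \in D -> cadlag (real_path (R := R) (cnt c) w).
Variables (S : R -> V) (b : V -> V) (J : C -> V -> V) (K : R).
Let jmp c t := jump (real_path (R := R) (cnt c) w) t.
Let event t := exists2 c, c \in D & jmp c t != 0.
Hypothesis cadlag_S : cadlag S.
Hypothesis S_derive : forall t, 0 < t -> ~ event t -> is_derive t 1 S (b (S t)).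
Hypothesis S_nojump : forall t, 0 < t -> ~ event t -> jump S t = 0.
Hypothesis S_jump : forall t c, 0 < t -> c \in D -> jmp c t = 1 ->
  (forall c', c' \in D -> c' != c -> jmp c' t = 0) -> jump S t = J c (left_limit S t).
Hypothesis K0 : 0 <= K.
Hypothesis b_lip : forall u v, `|b u - b v| <= K * `|u - v|.
Hypothesis J_lip : forall c u v, `|J c u - J c v| <= K * `|u - v|.

Section Cell.
Variables (Tm B : R).
Hypothesis bB : forall t, 0 <= t -> t <= Tm -> `|b (S t)| <= B.

Lemma S_left t : 0 < t -> S s @[s --> t^'-] --> left_limit S t.
Proof. by move=> t0; have [_ /(_ t t0)] := cadlag_S. Qed.

Lemma drift_left s t : 0 <= s -> s < t -> t <= Tm ->
  (forall r, s < r -> r < t -> ~ event r) ->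
  `|left_limit S t - S s| <= B * (t - s).
Proof.
move=> s0 st tT ne; apply: (@norm_increment_oo _ _ S (b \o S) s t B) => //.
- by move=> r sr rt; apply: S_derive; [exact: le_lt_trans sr|exact: ne].
- move=> r sr rt; apply: bB; first exact: le_trans (ltW sr).
  by apply: le_trans tT; exact: ltW.
- by have [/(_ s s0)] := cadlag_S.
- by apply: S_left; exact: le_lt_trans st.
Qed.

Lemma drift_nojump s t : 0 <= s -> s <= t -> t <= Tm ->
  (forall r, s < r -> r <= t -> ~ event r) -> `|S t - S s| <= B * (t - s).
Proof.
move=> s0; rewrite le_eqVlt => /orP[/eqP -> _ _|st tT ne].
  by rewrite !subrr normr0 mulr0.
have -> : S t = left_limit S t.
  apply/eqP; rewrite -subr_eq0; apply/eqP; apply: S_nojump; last exact: ne.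
  exact: le_lt_trans st.
by apply: drift_left => // r sr rt; apply: ne => //; exact: ltW.
Qed.

(** On an event-free cell the path moves by O(t - s), so its velocity changes by O(t - s) and the
    Euler error is of second order; summed over all cells it vanishes. *)
Lemma drift_nojump2 s t : 0 <= s -> s < t -> t <= Tm ->
  (forall r, s < r -> r <= t -> ~ event r) ->
  `|S t - S s - (t - s) *: b (S s)| <= K * B * (t - s) ^+ 2.
Proof.
move=> s0 st tT ne.
have St : S t = left_limit S t.
  apply/eqP; rewrite -subr_eq0; apply/eqP; apply: S_nojump; last exact: ne.
  exact: le_lt_trans st.
pose u r := S r - r *: b (S s).
have -> : S t - S s - (t - s) *: b (S s) = u t - u s.
  by rewrite /u scalerBl !opprB [LHS]addrACA [RHS]addrACA (addrC (- S s)).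
have -> : K * B * (t - s) ^+ 2 = K * (B * (t - s)) * (t - s) by ring.
have cont (F : set_system R) (FF : Filter F) (r : R) :
    F --> r -> x *: b (S s) @[x --> F] --> r *: b (S s).
  by move=> Fr; apply: cvgZr_tmp.
apply: (@norm_increment_oo _ _ u (fun r => b (S r) - b (S s)) s t) => //.
- move=> r sr rt; apply: is_deriveB; last exact: is_derive_scalel.
  by apply: S_derive; [exact: le_lt_trans sr|apply: ne => //; exact: ltW].
- move=> r sr rt; apply: (le_trans (b_lip _ _)); rewrite ler_wpM2l //.
  have h : `|S r - S s| <= B * (r - s).
    apply: drift_nojump => //; [exact: ltW|by apply: le_trans tT; exact: ltW|].
    by move=> r' sr' r'r; apply: ne => //; apply: le_trans (ltW rt).
  apply: (le_trans h); rewrite ler_wpM2l //; last by rewrite lerB // ltW.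
  by apply: le_trans (bB s0 _); [exact: normr_ge0|exact: le_trans (ltW st) _].
- apply: cvgB; first by have [/(_ s s0)] := cadlag_S.
  by apply: cont; apply: cvg_at_right_filter; exact: cvg_id.
- apply: cvgB; first by rewrite St; apply: S_left; exact: le_lt_trans st.
  by apply: cont; apply: cvg_at_left_filter; exact: cvg_id.
Qed.

(** Drift before the event, jump taken at the left limit, drift after it: the jump acts on a point
    within B (t - s) of [S s] and is Lipschitz. A first-order error suffices, as the number of such
    cells is at most the number of events. *)
Lemma event_cell s t c : 0 <= s -> s < t -> t <= Tm -> c \in D ->
  increment cnt c s t w = 1%N ->
  (forall c', c' \in D -> c' != c -> increment cnt c' s t w = 0%N) ->
  `|S t - S s - J c (S s)| <= B * (1 + K) * (t - s).
Proof.
move=> s0 st tT cD c1 c0.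
have [tau [stau taut jtau [j1 j2]]] :=
  jump_unit_increment (mono cD) (cadlag_cnt cD) s0 st c1.
have other c' r : c' \in D -> c' != c -> s < r -> r <= t -> jmp c' r = 0.
  move=> c'D c'c; apply: (jump_no_increment (mono c'D)) => //.
  exact: c0.
have ne1 r : s < r -> r < tau -> ~ event r.
  move=> sr rtau [c' c'D] /eqP; have [->|c'c] := eqVneq c' c; first by rewrite [jmp _ _]j1.
  by rewrite other // (le_trans (ltW rtau)).
have ne2 r : tau < r -> r <= t -> ~ event r.
  move=> taur rt [c' c'D] /eqP; have [->|c'c] := eqVneq c' c; first by rewrite [jmp _ _]j2.
  by rewrite other // (lt_trans stau).
have tau0 : 0 < tau := le_lt_trans s0 stau.
have St : S tau = left_limit S tau + J c (left_limit S tau).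
  rewrite -(S_jump tau0 cD jtau) => [|c' c'D c'c]; last exact: other.
  by rewrite /jump addrC subrK.
have h1 := drift_left s0 stau (le_trans taut tT) ne1.
have h2 := drift_nojump (ltW tau0) taut tT ne2.
set l := left_limit S tau in St h1.
have -> : S t - S s - J c (S s) = (S t - S tau) + ((l - S s) + (J c l - J c (S s))).
  rewrite St; move: (S t) (S s) (J c (S s)) (J c l) => x y z v.
  by rewrite [X in _ = _ + X]addrACA [RHS]addrA subrK -addrA.
apply: (le_trans (ler_normD _ _)).
have h3 := le_trans (ler_normD (l - S s) (J c l - J c (S s)))
  (lerD h1 (le_trans (J_lip c l (S s)) (ler_wpM2l K0 h1))).
apply: (le_trans (lerD h2 h3)).
have B0 : 0 <= B.
  by apply: le_trans (bB s0 _); [exact: normr_ge0|exact: le_trans (ltW st) _].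
have : 0 <= B * K * (t - tau) by rewrite !mulr_ge0 // subr_ge0.
lra.
Qed.

Lemma no_event_cell (s t : R) : 0 <= s -> s < t -> t <= Tm -> event_count D cnt s t w = 0%N ->
  `|S t - S s - (t - s) *: b (S s)| <= K * B * (t - s) ^+ 2.
Proof.
move=> s0 st tT tot0; apply: drift_nojump2 => // r sr rt [c cD] /eqP; apply.
apply: (@jump_no_increment _ _ _ _ _ (mono cD) s t s0 _ r) => //.
by move/eqP: tot0; rewrite /event_count sum_nat_eq0 => /forall_inP/(_ c cD)/eqP.
Qed.

Variables (m : nat) (h sigma : R).
Hypothesis h0 : 0 < h.
Hypothesis hT : m%:R * h <= Tm.
Hypothesis sigma0 : 0 <= sigma.
Hypothesis good : forall j : nat, (j < m)%N ->
  (event_count D cnt (j%:R * h) (j.+1%:R * h) w <= 1)%N.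

Definition euler_chain (j : nat) : V :=
  foldl (chain_step D (fun c u => u + J c u) (fun u => u + sigma *: b u)) (S 0)
    (mkseq (fun i => cell D cnt (i%:R * h) (i.+1%:R * h) w) j).

Let count (j : nat) := (\sum_(c in D) cnt c (j%:R * h) w)%N.

(** A discrete Gronwall estimate: a past error is amplified by at most 1 + sigma K in a cell without
    event and by 1 + K in a cell with one. The term with [h - sigma] accounts for the chain's Euler
    step not being the mesh. *)
Lemma euler_chain_error j : (j <= m)%N ->
  `|S (j%:R * h) - euler_chain j| <=
  (1 + sigma * K) ^+ j * (1 + K) ^+ count j *
    (j%:R * (K * B * h ^+ 2 + `|h - sigma| * B) + (count j)%:R * (B * (1 + K) * h)).
Proof.
have jh0 (i : nat) : 0 <= i%:R * h by rewrite mulr_ge0 // ltW.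
have B0 : 0 <= B.
  apply: le_trans (bB (lexx 0) _); first exact: normr_ge0.
  by apply: le_trans hT; rewrite jh0.
set eps := _ * h ^+ 2 + _.
have eps0 : 0 <= eps by rewrite addr_ge0 // ?mulr_ge0 // ?exprn_ge0 // ltW.
have C10 : 0 <= B * (1 + K) * h by rewrite !mulr_ge0 ?addr_ge0 // ltW.
have sK : 1 <= 1 + sigma * K by rewrite lerDl mulr_ge0.
have K1 : 1 <= 1 + K by rewrite lerDl.
elim: j => [|j IH] jm.
  rewrite (_ : euler_chain 0 = S (0 * h)); last by rewrite mul0r.
  rewrite subrr normr0; apply: mulr_ge0; last by rewrite addr_ge0 // mulr_ge0.
  by rewrite mulr_ge0 // exprn_ge0 // (le_trans ler01).
have {}IH := IH (ltnW jm).
have jT : j.+1%:R * h <= Tm.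
  by apply: le_trans hT; rewrite ler_pM2r // ler_nat.
have jlt : j%:R * h < j.+1%:R * h by rewrite ltr_pM2r // ltr_nat.
have dh : j.+1%:R * h - j%:R * h = h by rewrite -mulrBl -natr1 addrAC subrr add0r mul1r.
have countS : count j.+1 = (count j + event_count D cnt (j%:R * h) (j.+1%:R * h) w)%N.
  rewrite /count /event_count -big_split; apply: eq_bigr => c cD /=.
  by rewrite /increment subnKC // mono // ltW.
rewrite /euler_chain /mkseq -addn1 iotaD map_cat foldl_cat add0n -/(mkseq _ j).
rewrite addn1 [foldl _ _ [seq _ | i <- iota j 1]]/= -/(euler_chain j).
set A := (1 + sigma * K) ^+ j * (1 + K) ^+ count j in IH.
have A1 : 1 <= A by rewrite mulr_ege1 // exprn_ege1.
set e := `|S (j%:R * h) - euler_chain j| in IH.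
set F := j%:R * eps + (count j)%:R * (B * (1 + K) * h) in IH.
have F0 : 0 <= F by rewrite addr_ge0 // mulr_ge0.
have AF : 0 <= A * F by rewrite mulr_ge0 // (le_trans ler01).
have [cz|[c cD cu]] := (event_count_le1P _ _ _ _ _).1 (good jm).
- have e0 : event_count D cnt (j%:R * h) (j.+1%:R * h) w = 0%N.
    by apply/eqP; rewrite -cell_eq0 cz.
  have hc := no_event_cell (jh0 j) jlt jT e0; rewrite dh in hc.
  rewrite countS e0 addn0 /chain_step cz single_event_None; last first.
    apply/negP => /imsetP[c cD /ffunP/(_ c)]; rewrite !ffunE eqxx.
    by move=> /(congr1 val); rewrite /= inordK.
  have tT : j%:R * h <= Tm by apply: le_trans jT; exact: ltW.
  (* Local Euler error, inherited error, mismatch of the step lengths, and difference of the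
     drifts. *)
  have -> : S (j.+1%:R * h) - (euler_chain j + sigma *: b (euler_chain j)) =
      (S (j.+1%:R * h) - S (j%:R * h) - h *: b (S (j%:R * h)))
      + (S (j%:R * h) - euler_chain j) + (h - sigma) *: b (S (j%:R * h))
      + sigma *: (b (S (j%:R * h)) - b (euler_chain j)).
    move: (S (j.+1%:R * h)) (S (j%:R * h)) (euler_chain j) => x y z.
    move: (b y) (b z) => u v; rewrite scalerBl scalerBr opprD addrA.
    rewrite (addrAC x (- y)) [X in _ = X + _ + _]addrA subrK.
    rewrite [X in _ = X + _ + _]addrAC [X in _ = X + _]addrA subrK.
    by rewrite [RHS]addrA subrK.
  apply: (le_trans (ler_normD _ _)); apply: (@le_trans _ _ (eps + (1 + sigma * K) * e)).
    rewrite mulrDl mul1r [leRHS]addrA; apply: lerD; last first.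
      by rewrite normrZ ger0_norm // -mulrA ler_wpM2l.
    apply: (le_trans (ler_normD _ _)).
    rewrite /eps [leRHS]addrAC; apply: lerD.
      by apply: (le_trans (ler_normD _ _)); exact: (lerD hc (lexx _)).
    by rewrite normrZ ler_wpM2l // bB.
  rewrite [leRHS](_ : _ = A * (1 + sigma * K) * eps + (1 + sigma * K) * (A * F));
    last by rewrite -natr1 exprSr /F /A; ring.
  apply: lerD; last by rewrite ler_wpM2l // (le_trans ler01).
  by rewrite -[leLHS]mul1r ler_wpM2r // mulr_ege1.
- have [c1 c0] := cell_unit cD cu.
  have hc := event_cell (jh0 j) jlt jT cD c1 c0; rewrite dh in hc.
  have e1 : event_count D cnt (j%:R * h) (j.+1%:R * h) w = 1%N.
    by rewrite /event_count (bigD1 c) //= c1 big1 // => c' /andP[c'D ne]; exact: c0.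
  rewrite countS e1 addn1 /chain_step cu single_event_unit //.
  have -> : S (j.+1%:R * h) - (euler_chain j + J c (euler_chain j)) =
      (S (j.+1%:R * h) - S (j%:R * h) - J c (S (j%:R * h)))
      + (S (j%:R * h) - euler_chain j)
      + (J c (S (j%:R * h)) - J c (euler_chain j)).
    move: (S (j.+1%:R * h)) (S (j%:R * h)) (euler_chain j) => x y z.
    move: (J c y) (J c z) => u v; rewrite opprD addrA.
    rewrite (addrAC x (- y)) [X in _ = X + _]addrA subrK.
    by rewrite [X in _ = X + _]addrAC [RHS]addrA subrK.
  apply: (le_trans (ler_normD _ _)).
  apply: (@le_trans _ _ (B * (1 + K) * h + (1 + K) * e)).
    rewrite mulrDl mul1r [leRHS]addrA; apply: lerD; last exact: J_lip.
    by apply: (le_trans (ler_normD _ _)); exact: (lerD hc (lexx _)).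
  rewrite -!natr1 !exprSr.
  have -> : (1 + sigma * K) ^+ j * (1 + sigma * K) * ((1 + K) ^+ count j * (1 + K)) *
      ((j%:R + 1) * eps + ((count j)%:R + 1) * (B * (1 + K) * h)) =
    (1 + sigma * K) * (A * (1 + K) * eps) +
    ((1 + sigma * K) * (A * (1 + K)) * (B * (1 + K) * h)
     + (1 + sigma * K) * ((1 + K) * (A * F))) by rewrite /F /A; ring.
  have AK1 : 1 <= A * (1 + K) by rewrite mulr_ege1.
  rewrite -[leLHS]add0r; apply: lerD.
    have A0 := le_trans ler01 A1; have sK0 := le_trans ler01 sK.
    have K10 := le_trans ler01 K1.
    exact: (mulr_ge0 sK0 (mulr_ge0 (mulr_ge0 A0 K10) eps0)).
  apply: lerD; first by rewrite -[leLHS]mul1r ler_wpM2r // mulr_ege1.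
  rewrite -[leLHS]mul1r; apply: ler_pM => //.
    by apply: mulr_ge0; [exact: le_trans ler01 K1|exact: normr_ge0].
  by rewrite ler_wpM2l // (le_trans ler01).
Qed.
End Cell.

Lemma euler_chain_cvg (Tm : R) (sigma : nat -> R) : 0 < Tm ->
  (forall k, 0 <= sigma k) -> (2 ^ k)%:R * sigma k @[k --> \oo] --> Tm ->
  (exists k0, forall k, (k0 <= k)%N -> good_grid D cnt Tm k w) ->
  euler_chain (Tm / (2 ^ k)%:R) (sigma k) (2 ^ k) @[k --> \oo] --> S Tm.
Proof.
move=> T0 s0 cs [k0 good].
have [M SM] := cadlag_bounded (ltW T0) cadlag_S.
pose B := `|b 0| + K * M.
have bB t : 0 <= t -> t <= Tm -> `|b (S t)| <= B.
  move=> t0 tT; have -> : b (S t) = b 0 + (b (S t) - b 0) by rewrite addrC subrK.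
  apply: (le_trans (ler_normD _ _)); rewrite lerD2l (le_trans (b_lip _ _)) //.
  by rewrite subr0 ler_wpM2l // SM.
have B0 : 0 <= B by apply: le_trans (bB 0 (lexx 0) (ltW T0)).
clearbody B.
(* The number of events up to [Tm] is fixed by the path, so the factor (1 + K)^N does not grow with
   the grid. *)
pose N := (\sum_(c in D) cnt c Tm w)%N.
pose h k := Tm / (2 ^ k)%:R.
have m0 k : 0 < (2 ^ k)%:R :> R by rewrite ltr0n expn_gt0.
have mh k : (2 ^ k)%:R * h k = Tm by rewrite /h; field; rewrite gt_eqF.
have h0 k : 0 < h k by rewrite divr_gt0.
pose bound k := expR (K * ((2 ^ k)%:R * sigma k)) * (1 + K) ^+ N *
  (K * B * Tm * h k + `|Tm - (2 ^ k)%:R * sigma k| * B + N%:R * (B * (1 + K)) * h k).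
have err k : (k0 <= k)%N ->
    `|S Tm - euler_chain (h k) (sigma k) (2 ^ k)| <= bound k.
  move=> kk; have hT : (2 ^ k)%:R * h k <= Tm by rewrite mh.
  have := euler_chain_error bB (h0 k) hT (s0 k) (good k kk) (leqnn _).
  rewrite mh -/N => /le_trans; apply.
  have -> : (2 ^ k)%:R * (K * B * h k ^+ 2 + `|h k - sigma k| * B) +
      N%:R * (B * (1 + K) * h k) =
     K * B * Tm * h k + `|Tm - (2 ^ k)%:R * sigma k| * B + N%:R * (B * (1 + K)) * h k.
    have -> : Tm - (2 ^ k)%:R * sigma k = (2 ^ k)%:R * (h k - sigma k) by rewrite mulrBr mh.
    by rewrite normrM (gtr0_norm (m0 k)) -(mh k); ring.
  rewrite ler_wpM2r //.
    have h0' := ltW (h0 k); have T0' := ltW T0.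
    by rewrite !addr_ge0 ?mulr_ge0 ?addr_ge0.
  rewrite ler_wpM2r ?exprn_ge0 ?addr_ge0 //.
  rewrite mulrCA expRM_natl (mulrC K) lerXn2r ?nnegrE ?expR_ge0 //.
    by rewrite addr_ge0 // mulr_ge0.
  exact: expR_ge1Dx.
have h_cvg : h k @[k --> \oo] --> (0 : R) := cvg_dyadic_step Tm.
have bound_cvg : bound k @[k --> \oo] --> (0 : R).
  rewrite -(mulr0 (expR (K * Tm) * (1 + K) ^+ N)); apply: cvgM.
    apply: cvgM; last exact: cvg_cst.
    have hc : K * ((2 ^ k)%:R * sigma k) @[k --> \oo] --> K * Tm.
      by apply: cvgM; [exact: cvg_cst|exact: cs].
    exact: (cvg_comp _ expR hc (@continuous_expR R _)).
  have -> : (0 : R) = K * B * Tm * 0 + `|Tm - Tm| * B + N%:R * (B * (1 + K)) * 0.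
    by rewrite subrr normr0; ring.
  apply: cvgD; first (apply: cvgD).
  - by apply: cvgM; [exact: cvg_cst|].
  - by apply: cvgM; [apply: cvg_norm; apply: cvgB; [exact: cvg_cst|]|exact: cvg_cst].
  - by apply: cvgM; [exact: cvg_cst|].
apply/cvgrPdist_lt => e e0.
move/cvgrPdist_lt/(_ e e0) : bound_cvg => H.
near=> k.
apply: (@le_lt_trans _ _ (bound k)); first by apply: err; near: k; exact: nbhs_infty_ge.
have : `|0 - bound k| < e by near: k.
by rewrite sub0r normrN; apply: le_lt_trans; exact: ler_norm.
Unshelve. all: by end_near.
Qed.

End Path.

(** * Product spaces and Lipschitz maps *)

Section PairPaths.
Variables (R : realType) (U V : normedModType R).

Lemma is_derive_pair (u : R -> U) (v : R -> V) (du : U) (dv : V) (t : R) :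
  is_derive t 1 u du -> is_derive t 1 v dv ->
  is_derive t 1 (fun s => (u s, v s)) (du, dv).
Proof.
move=> [du1 du2] [dv1 dv2].
have cu : (fun h => h^-1 *: (u (h *: 1 + t) - u t)) @ (0 : R)^' --> du by rewrite -du2.
have cv : (fun h => h^-1 *: (v (h *: 1 + t) - v t)) @ (0 : R)^' --> dv by rewrite -dv2.
have h : (fun h => h^-1 *: ((u (h *: 1 + t), v (h *: 1 + t)) - (u t, v t) : U * V))
    @ (0 : R)^' --> (du, dv) by exact: cvg_pair cu cv.
by apply: DeriveDef; [apply/cvg_ex; exists (du, dv)|apply/cvg_lim].
Qed.

Lemma left_limit_pair (u : R -> U) (v : R -> V) (t : R) :
  cvg (u s @[s --> t^'-]) -> cvg (v s @[s --> t^'-]) ->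
  left_limit (fun s => (u s, v s)) t = (left_limit u t, left_limit v t).
Proof. by move=> cu cv; apply/cvg_lim => //; apply: cvg_pair. Qed.

Lemma jump_ode_pair (event : R -> Prop) (u du iu : R -> U) (v dv iv : R -> V) :
  jump_ode event u du iu -> jump_ode event v dv iv ->
  jump_ode event (fun s => (u s, v s)) (fun s => (du s, dv s)) (fun s => (iu s, iv s)).
Proof.
move=> [[ur ul] ud uj] [[vr vl] vd vj]; split.
- split=> t t0; first by apply: cvg_pair; [exact: ur|exact: vr].
  apply/cvg_ex; exists (left_limit u t, left_limit v t).
  by apply: cvg_pair; [exact: ul|exact: vl].
- by move=> t t0 nt; apply: is_derive_pair; [exact: ud|exact: vd].
- move=> t t0; rewrite /jump left_limit_pair; [|exact: ul|exact: vl].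
  by rewrite -uj // -vj.
Qed.

End PairPaths.

Section Lipschitz.
Variables (R : realType).

Definition lipschitz_fun (U V : normedModType R) (F : U -> V) :=
  exists2 K : R, 0 <= K & forall u v, `|F u - F v| <= K * `|u - v|.

Variable U : normedModType R.

Lemma lipschitz_fun_cst (V : normedModType R) (c : V) : lipschitz_fun (fun _ : U => c).
Proof. by exists 0 => // u v; rewrite subrr normr0 mul0r. Qed.

Lemma lipschitzD (V : normedModType R) (F G : U -> V) :
  lipschitz_fun F -> lipschitz_fun G -> lipschitz_fun (fun u => F u + G u).
Proof.
move=> [K K0 FK] [K' K'0 GK]; exists (K + K'); first exact: addr_ge0.
move=> u v; rewrite opprD addrACA mulrDl (le_trans (ler_normD _ _)) //.
by rewrite lerD.
Qed.

Lemma lipschitzZ (V : normedModType R) c (F : U -> V) :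
  lipschitz_fun F -> lipschitz_fun (fun u => c *: F u).
Proof.
move=> [K K0 FK]; exists (`|c| * K); first exact: mulr_ge0.
by move=> u v; rewrite -scalerBr normrZ -mulrA ler_wpM2l.
Qed.

Lemma lipschitzN (V : normedModType R) (F : U -> V) :
  lipschitz_fun F -> lipschitz_fun (fun u => - F u).
Proof.
move=> [K K0 FK]; exists K => // u v.
by rewrite -opprD normrN.
Qed.

Lemma lipschitzB (V : normedModType R) (F G : U -> V) :
  lipschitz_fun F -> lipschitz_fun G -> lipschitz_fun (fun u => F u - G u).
Proof. by move=> lF lG; apply: lipschitzD => //; exact: lipschitzN. Qed.

Lemma lipschitz_pair (V W : normedModType R) (F : U -> V) (G : U -> W) :
  lipschitz_fun F -> lipschitz_fun G -> lipschitz_fun (fun u => (F u, G u)).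
Proof.
move=> [K K0 FK] [K' K'0 GK]; exists (K + K'); first exact: addr_ge0.
move=> u v; rewrite prod_normE /= ge_max; apply/andP; split.
  by apply: (le_trans (FK u v)); rewrite ler_wpM2r // lerDl.
by apply: (le_trans (GK u v)); rewrite ler_wpM2r // lerDr.
Qed.

Lemma lipschitz_fst (V W : normedModType R) (F : U -> V * W) :
  lipschitz_fun F -> lipschitz_fun (fun u => (F u).1).
Proof.
move=> [K K0 FK]; exists K => // u v; apply: le_trans (FK u v).
by rewrite prod_normE le_max lexx.
Qed.

Lemma lipschitz_snd (V W : normedModType R) (F : U -> V * W) :
  lipschitz_fun F -> lipschitz_fun (fun u => (F u).2).
Proof.
move=> [K K0 FK]; exists K => // u v; apply: le_trans (FK u v).
by rewrite prod_normE le_max lexx orbT.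
Qed.

Lemma lipschitz_fun_id : lipschitz_fun (fun u : U => u).
Proof. by exists 1 => // u v; rewrite mul1r. Qed.

Lemma entry_le_norm m n (A : 'M[R]_(m, n)) i j : `|A i j| <= `|A|.
Proof.
rewrite [leRHS]mx_normrE.
by apply: (le_bigmax _ (fun ij : 'I_m * 'I_n => `|A ij.1 ij.2|) (i, j)).
Qed.

Lemma norm_mx_le m n (A : 'M[R]_(m, n)) (c : R) : 0 <= c ->
  (forall i j, `|A i j| <= c) -> `|A| <= c.
Proof.
move=> c0 Ac; rewrite [leLHS]mx_normrE; by apply/bigmax_leP; split=> // -[i j] _ /=.
Qed.

Lemma norm_le_frob m n (A : 'M[R]_(m, n)) : `|A| <= frob A.
Proof.
apply: norm_mx_le => [|i j]; first exact: frob_ge0.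
rewrite -ler_sqr ?nnegrE ?frob_ge0 // frob_sqr /dot (bigD1 i) //= (bigD1 j) //=.
rewrite real_normK ?num_real // expr2 -addrA lerDl addr_ge0 //.
  by apply: sumr_ge0 => k _; rewrite -expr2 sqr_ge0.
by apply: sumr_ge0 => l _; apply: sumr_ge0 => k _; rewrite -expr2 sqr_ge0.
Qed.

(** The square root of m n would do; 1 + m n is cruder but avoids square roots, and any constant
    serves for Lipschitz continuity. *)
Lemma frob_le_norm m n (A : 'M[R]_(m, n)) : frob A <= (1 + m%:R * n%:R) * `|A|.
Proof.
have c0 : 0 <= (1 + m%:R * n%:R) * `|A| by rewrite mulr_ge0 // addr_ge0 // mulr_ge0.
rewrite -ler_sqr ?nnegrE ?frob_ge0 // frob_sqr /dot.
apply: (@le_trans _ _ (\sum_(i < m) \sum_(j < n) `|A| ^+ 2)).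
  apply: ler_sum => i _; apply: ler_sum => j _; rewrite -expr2.
  by rewrite -[leLHS]real_normK ?num_real // ler_sqr ?nnegrE // entry_le_norm.
rewrite sumr_const sumr_const !card_ord -mulrnA -[leLHS]mulr_natl exprMn.
rewrite ler_wpM2r ?sqr_ge0 // natrM expr2.
have x0 : 0 <= m%:R * n%:R :> R by rewrite mulr_ge0.
move: (m%:R * n%:R) x0 (n%:R * m%:R) (mulrC m%:R n%:R : _ = _ :> R) => x x0 y <-.
by nra.
Qed.

Lemma lipschitz_mulmx m n p (K : 'M[R]_(p, m)) (F : U -> 'M[R]_(m, n)) :
  lipschitz_fun F -> lipschitz_fun (fun u => K *m F u).
Proof.
move=> [C C0 FC]; exists (m%:R * `|K| * C); first by rewrite !mulr_ge0.
move=> u v; rewrite -mulmxBr; apply: norm_mx_le => [|i j]; first by rewrite !mulr_ge0.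
rewrite mxE; apply: (le_trans (ler_norm_sum _ _ _)).
apply: (@le_trans _ _ (\sum_(k < m) `|K| * (C * `|u - v|))).
  apply: ler_sum => k _; rewrite normrM ler_pM // ?entry_le_norm //.
  exact: le_trans (entry_le_norm _ _ _) (FC u v).
by rewrite sumr_const card_ord -[leLHS]mulr_natl !mulrA.
Qed.

Lemma lipschitz_gradient_rows n d (L : R) (f : 'I_n -> 'rV[R]_d -> R)
    (F : U -> 'M[R]_(n, d)) : 0 <= L -> (forall i, smooth L (f i)) ->
  lipschitz_fun F -> lipschitz_fun (fun u => gradient_rows f (F u)).
Proof.
move=> L0 sf [C C0 FC]; exists (L * (1 + 1%:R * d%:R) * C).
  by rewrite !mulr_ge0 // addr_ge0.
move=> u v; apply: norm_mx_le => [|i j].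
  by rewrite !mulr_ge0 // addr_ge0.
have [_ /(_ (row i (F u)) (row i (F v))) h] := sf i.
have -> : (gradient_rows f (F u) - gradient_rows f (F v)) i j =
    (gradient (f i) (row i (F u)) - gradient (f i) (row i (F v))) 0 j.
  by rewrite !mxE.
apply: (le_trans (entry_le_norm _ _ _)); apply: (le_trans (norm_le_frob _)).
apply: (le_trans h); rewrite -!mulrA ler_wpM2l // -linearB.
apply: (le_trans (frob_le_norm _)); rewrite ler_wpM2l ?addr_ge0 ?mulr_ge0 //.
apply: le_trans (FC u v); apply: norm_mx_le => // k l.
by rewrite mxE entry_le_norm.
Qed.

End Lipschitz.

Section DynamicsPaths.
Variables (R : realType) (n d : nat) (p : params R) (L : R).
Variable f : 'I_n -> 'rV[R]_d -> R.
Hypothesis L0 : 0 < L.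
Hypothesis smooth_f : forall i, smooth L (f i).

Lemma lipschitz_drift : lipschitz_fun (drift p : state R n d -> state R n d).
Proof.
have l : lipschitz_fun (fun S : state R n d => S) by exact: lipschitz_fun_id.
have lx := lipschitz_fst (lipschitz_fst (lipschitz_fst (lipschitz_fst (lipschitz_fst l)))).
have lx' := lipschitz_snd (lipschitz_fst (lipschitz_fst (lipschitz_fst (lipschitz_fst l)))).
have ly' := lipschitz_snd (lipschitz_fst (lipschitz_fst (lipschitz_fst l))).
have ly := lipschitz_snd (lipschitz_fst (lipschitz_fst l)).
have lz := lipschitz_snd (lipschitz_fst l).
have lz' := lipschitz_snd l.
rewrite /drift; apply: lipschitz_pair; last by apply: lipschitzZ; exact: lipschitzB.
apply: lipschitz_pair; last by apply: lipschitzZ; exact: lipschitzB.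
apply: lipschitz_pair; last by apply: lipschitzZ; exact: lipschitzB.
apply: lipschitz_pair; last first.
  apply: lipschitzN; apply: lipschitzZ; apply: lipschitzD; first exact: lipschitzD.
  exact: lipschitzZ.
by apply: lipschitz_pair; apply: lipschitzZ; exact: lipschitzB.
Qed.

Lemma lipschitz_clock_jump c :
  lipschitz_fun (clock_jump p f c : state R n d -> state R n d).
Proof.
have l : lipschitz_fun (fun S : state R n d => S) by exact: lipschitz_fun_id.
have lx := lipschitz_fst (lipschitz_fst (lipschitz_fst (lipschitz_fst (lipschitz_fst l)))).
have ly' := lipschitz_snd (lipschitz_fst (lipschitz_fst (lipschitz_fst l))).
have ly := lipschitz_snd (lipschitz_fst (lipschitz_fst l)).
have lz := lipschitz_snd (lipschitz_fst l).
have l0 := @lipschitz_fun_cst _ (state R n d) _ (0 : 'M[R]_(n, d)).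
case: c => [i|e] /=.
  have lo : lipschitz_fun (fun S : state R n d => row_only i (oracle p f S)).
    apply: lipschitz_mulmx; apply: lipschitzB; last exact: ly'.
    apply: lipschitzB; last by apply: lipschitzZ; exact: lx.
    by apply: (lipschitz_gradient_rows (ltW L0)) => //; exact: lx.
  rewrite /oracle_jump; do 3 (apply: lipschitz_pair; last exact: l0).
  apply: lipschitz_pair; last exact: lipschitzZ.
  by apply: lipschitz_pair; apply: lipschitzN; exact: lipschitzZ.
have lo : lipschitz_fun (fun S : state R n d =>
    edge_mx R e *m (S.1.1.2 + S.1.2)).
  by apply: lipschitz_mulmx; exact: lipschitzD.
rewrite /gossip_jump.
do 2 (apply: lipschitz_pair; last by apply: lipschitzN; exact: lipschitzZ).
by do 3 (apply: lipschitz_pair; last exact: l0); exact: l0.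
Qed.

Lemma lipschitz_dynamics : exists K, [/\ 0 <= K,
  forall u v : state R n d, `|drift p u - drift p v| <= K * `|u - v| &
  forall c (u v : state R n d),
    `|clock_jump p f c u - clock_jump p f c v| <= K * `|u - v|].
Proof.
have [K0 K00 dK] := lipschitz_drift.
have [K HK] := choice (fun c => let: ex_intro2 K h1 h2 := lipschitz_clock_jump c in
  ex_intro (fun K : R => 0 <= K /\ forall u v : state R n d,
    `|clock_jump p f c u - clock_jump p f c v| <= K * `|u - v|) K (conj h1 h2)).
have Kge0 c : 0 <= K c by have [] := HK c.
exists (K0 + \sum_c K c); split.
- by rewrite addr_ge0 // sumr_ge0.
- move=> u v; apply: (le_trans (dK u v)); rewrite ler_wpM2r // lerDl.
  by rewrite sumr_ge0.
- move=> c u v; have [_ /(_ u v) h] := HK c; apply: (le_trans h).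
  rewrite ler_wpM2r // (bigD1 c) //= addrCA lerDl addr_ge0 //.
  by rewrite sumr_ge0.
Qed.

Variables (dT : measure_display) (T : measurableType dT).
Variables (E : {set 'I_n * 'I_n}).
Variables (N : 'I_n -> R -> T -> nat) (M : 'I_n * 'I_n -> R -> T -> nat).

Definition clocks : {set 'I_n + 'I_n * 'I_n} :=
  [set c : 'I_n + 'I_n * 'I_n | if c is inr e then e \in E else true]%SET.

Definition clock_count (c : 'I_n + 'I_n * 'I_n) : R -> T -> nat :=
  match c with inl i => N i | inr e => M e end.

Variables (w : T) (x x' y' y z z' : R -> 'M[R]_(n, d)).
Hypothesis path : dadao_path p f E (fun i => real_path (N i) w)
  (fun e => real_path (M e) w) x x' y' y z z'.

Let S t : state R n d := (x t, x' t, y' t, y t, z t, z' t).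
Let jmp c t := jump (real_path (R := R) (clock_count c) w) t.
Let event t := exists2 c, c \in clocks & jmp c t != 0.

(** The six equations share one event predicate, so pairing them yields a single jump equation in
    the product space, the form required by the pathwise convergence. *)
Lemma dadao_path_state :
  [/\ cadlag S,
      forall t, 0 < t -> ~ event t -> is_derive t 1 S (drift p (S t)),
      forall t, 0 < t -> ~ event t -> jump S t = 0
    & forall t c, 0 < t -> c \in clocks -> jmp c t = 1 ->
        (forall c', c' \in clocks -> c' != c -> jmp c' t = 0) ->
        jump S t = clock_jump p f c (left_limit S t)].
Proof.
move: path; rewrite /dadao_path.
set ev := (fun t : R => _ \/ _).
move=> [jx [jx' [jy' [jy [jz jz']]]]].
have j2 := jump_ode_pair jx jx'; have j3 := jump_ode_pair j2 jy'.
have j4 := jump_ode_pair j3 jy; have j5 := jump_ode_pair j4 jz.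
have jS := jump_ode_pair j5 jz'.
have evE t : ~ event t -> ~ ev t.
  move=> ne [[i ji]|[e eE je]]; apply: ne.
    by exists (inl i) => //; rewrite inE.
  by exists (inr e) => //; rewrite inE.
have lS t : 0 < t -> left_limit S t =
    (left_limit x t, left_limit x' t, left_limit y' t, left_limit y t,
     left_limit z t, left_limit z' t).
  move=> t0.
  have cv (V : normedModType R) (u du iu : R -> V) :
      jump_ode ev u du iu -> cvg (u s @[s --> t^'-]).
    by move=> [[_ /(_ t t0)]].
  rewrite (left_limit_pair (cv _ _ _ _ j5) (cv _ _ _ _ jz')).
  rewrite (left_limit_pair (cv _ _ _ _ j4) (cv _ _ _ _ jz)).
  rewrite (left_limit_pair (cv _ _ _ _ j3) (cv _ _ _ _ jy)).
  rewrite (left_limit_pair (cv _ _ _ _ j2) (cv _ _ _ _ jy')).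
  by rewrite (left_limit_pair (cv _ _ _ _ jx) (cv _ _ _ _ jx')).
have [cS dS iS] := jS.
have dN0 t (g : 'M[R]_(n, d)) : (forall i, jmp (inl i) t = 0) ->
    \matrix_(i < n) (jump (real_path (R := R) (N i) w) t *: row i g) = 0.
  move=> h; apply/matrixP => i j; rewrite !mxE.
  by have := h i; rewrite /jmp /= => ->; rewrite mul0r.
have gs0 t : (forall e, e \in E -> jmp (inr e) t = 0) ->
    \sum_(e in E) jump (real_path (R := R) (M e) w) t *:
                    (edge_mx R e *m (left_limit y t + left_limit z t)) = 0.
  move=> h; rewrite big1 // => e eE.
  by have := h e eE; rewrite /jmp /= => ->; rewrite scale0r.
split=> //.
- by move=> t t0 ne; apply: dS => //; exact: evE.
- move=> t t0 ne.
  have z0 c : c \in clocks -> jmp c t = 0.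
    by move=> cD; apply/eqP/negPn/negP => h; apply: ne; exists c.
  rewrite (iS t t0) dN0 => [|i]; last by apply: z0; rewrite inE.
  rewrite gs0 => [|e eE]; last by apply: z0; rewrite inE.
  by rewrite !scaler0 !oppr0.
- move=> t [i|e] t0 cD j1 j0; rewrite (iS t t0) lS //=.
    rewrite gs0 => [|e eE]; last by apply: j0 => //; rewrite inE.
    rewrite !scaler0 !oppr0 /oracle_jump row_onlyE.
    have -> : (\matrix_i0 (jump (real_path (R := R) (N i0) w) t *:
        row i0 (gradient_rows f (left_limit x t) - p_nu p *: left_limit x t -
           left_limit y' t))) =
      \matrix_k ((k == i)%:R *: row k (oracle p f (left_limit x t, left_limit x' t,
        left_limit y' t, left_limit y t, left_limit z t, left_limit z' t))).
      apply/matrixP => k l; rewrite !mxE; congr (_ * _).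
      have [->|ki] := eqVneq k i; first exact: j1.
      by apply: (j0 (inl k)); rewrite ?inE //; apply: contra ki => /eqP[->].
    by [].
  rewrite dN0 => [|i]; last by apply: j0 => //; rewrite inE.
  rewrite !scaler0 !oppr0 /gossip_jump.
  rewrite (bigD1 e) /=; last by move: cD; rewrite inE.
  rewrite big1 ?addr0 => [|e' /andP[e'E ne]].
    by have := j1; rewrite /jmp /= => ->; rewrite scale1r.
  have := j0 (inr e'); rewrite inE e'E => /(_ erefl).
  rewrite /jmp /= => ->; first by rewrite scale0r.
  by apply: contra ne => /eqP[->].
Qed.

End DynamicsPaths.

(** * Expectations *)

Lemma sum_poisson_pmf (R : realType) (r : R) : 0 < r ->
  (\sum_(0 <= k <oo) (poisson_pmf r k)%:E = 1)%E.
Proof.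
move=> r0; rewrite nneseries_esumT; last by move=> *; rewrite lee_fin poisson_pmf_ge0.
have h : (poisson_prob r 0%N setT = 1)%E := probability_setT _.
by move: h; rewrite /poisson_prob r0.
Qed.

Lemma sum_natmul_poisson_pmf (R : realType) (r : R) : 0 < r ->
  (\sum_(0 <= k <oo) (k%:R * poisson_pmf r k)%:E = r%:E)%E.
Proof.
move=> r0; have p0 k : (0 <= (k%:R * poisson_pmf r k)%:E)%E.
  by rewrite lee_fin mulr_ge0 // poisson_pmf_ge0.
rewrite nneseries_recl //= mul0r add0e -(nneseries_addn 1) //=.
(* The identity k p(k) = r p(k - 1) reduces the mean to the total mass. *)
have E k : (k + 1)%:R * poisson_pmf r (k + 1) = r * poisson_pmf r k.
  rewrite addn1 /poisson_pmf r0 exprS factS natrM.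
  by field; rewrite pnatr_eq0 -lt0n fact_gt0 /= addrC natr1 pnatr_eq0.
under eq_eseriesr do rewrite E EFinM.
rewrite nneseriesZl; last by move=> *; rewrite lee_fin poisson_pmf_ge0.
by rewrite sum_poisson_pmf // mule1.
Qed.

Lemma poisson_process_mean (R : realType) (dT : measure_display)
    (T : measurableType dT) (P : probability T R) (rate : R) (N : R -> T -> nat) :
  0 < rate -> poisson_process P rate N -> forall t, 0 <= t ->
  (\int[P]_w ((N t w)%:R : R)%:E = (rate * t)%:E)%E.
Proof.
move=> r0 [mN N0 lawN _] t; rewrite le_eqVlt => /orP[/eqP <-|t0].
  rewrite mulr0; under eq_integral => w _ do have [-> _ _] := N0 w.
  by rewrite integral0.
have mA k : measurable [set w | N t w = k].
  rewrite -[X in measurable X]setTI.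
  exact: (mN t (ltW t0) measurableT [set k]).
have -> : (fun w => ((N t w)%:R : R)%:E) =
    (fun w => \sum_(0 <= k <oo) (k%:R * \1_[set w | N t w = k] w)%:E)%E.
  apply/funext => w.
  rewrite (@nneseriesD1 _ _ (N t w)) //=.
  rewrite eseries0 ?adde0 => [|k _ /= ne]; first by rewrite indicE mem_set // mulr1.
  rewrite indicE memNset ?mulr0 //= => h; by rewrite h eqxx in ne.
rewrite integral_nneseries //; last first.
  by move=> k; apply/measurable_EFinP; apply: measurable_funM.
rewrite -[RHS]sum_natmul_poisson_pmf ?mulr_gt0 //.
apply: eq_eseriesr => k _.
rewrite (integralZl_indic measurableT (fun=> [set w | N t w = k])) //; last first.
  by move=> h; have := lt_le_trans h (ler0n R k); rewrite ltxx.
rewrite integral_indic // setIT EFinM; congr (_ * _)%E.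
have := lawN 0 t k (lexx _) t0; rewrite subr0 => <-.
congr (P _); apply/seteqP; split=> w /=; have [-> _ _] := N0 w; by rewrite subn0.
Qed.

Section StepSize.
Variables (R : realType) (lambda : R).

(* Times the rate of a clock, this is the probability that a cell of length h
   contains exactly one event and that it belongs to this clock. *)
Definition jump_weight (h : R) : R := h * expR (- (lambda * h)).

Definition stay_prob (h : R) : R := 1 - lambda * jump_weight h.

(** Division by [stay_prob] makes up for the cells in which the chain jumps instead of drifting. *)
Definition drift_step (h : R) : R := jump_weight h / stay_prob h.

Lemma stay_prob_gt0 h : 0 < stay_prob h.
Proof.
rewrite /stay_prob /jump_weight mulrA expRN subr_gt0.
rewrite ltr_pdivrMr ?expR_gt0 // mul1r.
by apply: lt_le_trans (expR_ge1Dx _); rewrite ltrDr.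
Qed.

Lemma jump_weight_ge0 h : 0 <= h -> 0 <= jump_weight h.
Proof. by move=> h0; rewrite mulr_ge0 // expR_ge0. Qed.

Lemma drift_step_ge0 h : 0 <= h -> 0 <= drift_step h.
Proof. by move=> h0; rewrite divr_ge0 ?jump_weight_ge0 // ltW // stay_prob_gt0. Qed.

Lemma stay_prob_drift_step h : stay_prob h * drift_step h = jump_weight h.
Proof.
by rewrite /drift_step mulrC divfK // gt_eqF // stay_prob_gt0.
Qed.

Variable t : R.
Let h k : R := t / (2 ^ k)%:R.

Let cvg_exp : expR (- (lambda * h k)) @[k --> \oo] --> (1 : R).
Proof.
have hc : - (lambda * h k) @[k --> \oo] --> (0 : R).
  rewrite -[X in _ --> X]oppr0 -(mulr0 lambda); apply: cvgN; apply: cvgM.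
    exact: cvg_cst.
  exact: cvg_dyadic_step.
by rewrite -expR0; exact: (cvg_comp _ expR hc (@continuous_expR R _)).
Qed.

Lemma cvg_jump_weight : (2 ^ k)%:R * jump_weight (h k) @[k --> \oo] --> t.
Proof.
have -> : (fun k => (2 ^ k)%:R * jump_weight (h k)) =
    (fun k => t * expR (- (lambda * h k))).
  apply/funext => k; rewrite /jump_weight mulrA; congr (_ * _).
  by rewrite /h; field; rewrite pnatr_eq0 expn_eq0.
by rewrite -[X in _ --> X]mulr1; apply: cvgM; [exact: cvg_cst|exact: cvg_exp].
Qed.

Lemma cvg_stay_prob : stay_prob (h k) @[k --> \oo] --> (1 : R).
Proof.
rewrite -[X in _ --> X]subr0 -[X in _ - X](mulr0 lambda).
apply: cvgB; first exact: cvg_cst.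
apply: cvgM; first exact: cvg_cst.
rewrite -[X in _ --> X](mulr1 0); apply: cvgM; first exact: cvg_dyadic_step.
exact: cvg_exp.
Qed.

Lemma cvg_drift_step : (2 ^ k)%:R * drift_step (h k) @[k --> \oo] --> t.
Proof.
have -> : (fun k => (2 ^ k)%:R * drift_step (h k)) =
    (fun k => ((2 ^ k)%:R * jump_weight (h k)) * (stay_prob (h k))^-1).
  by apply/funext => k; rewrite /drift_step mulrA.
rewrite -[X in _ --> X]mulr1 -[X in _ * X]invr1; apply: cvgM; first exact: cvg_jump_weight.
by apply: cvgV; [exact: oner_neq0|exact: cvg_stay_prob].
Qed.

(** Over 2^k cells the jump weights add up to t in the limit, while the products of jump weight and
    drift step are of second order in the mesh and their sum vanishes. *)
Lemma cvg_decay (c K : R) :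
  expR (- c * jump_weight (h k) + K * jump_weight (h k) * drift_step (h k)) ^+ (2 ^ k)
    @[k --> \oo] --> expR (- (c * t)).
Proof.
have -> : (fun k => expR (- c * jump_weight (h k) +
      K * jump_weight (h k) * drift_step (h k)) ^+ (2 ^ k)) =
    (fun k => expR (- c * ((2 ^ k)%:R * jump_weight (h k)) +
      K * jump_weight (h k) * ((2 ^ k)%:R * drift_step (h k)))).
  by apply/funext => k; rewrite -expRM_natl; congr expR; ring.
have hc : - c * ((2 ^ k)%:R * jump_weight (h k)) +
      K * jump_weight (h k) * ((2 ^ k)%:R * drift_step (h k)) @[k --> \oo]
    --> - c * t + K * (0 * 1) * t.
  apply: cvgD.
    by apply: cvgM; [exact: cvg_cst|exact: cvg_jump_weight].
  apply: cvgM; last exact: cvg_drift_step.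
  apply: cvgM; first exact: cvg_cst.
  by apply: cvgM; [exact: cvg_dyadic_step|exact: cvg_exp].
have -> : - (c * t) = - c * t + K * (0 * 1) * t by ring.
exact: (cvg_comp _ expR hc (@continuous_expR R _)).
Qed.

End StepSize.

Lemma limn_einf_le (R : realType) (u v : (\bar R)^nat) :
  (forall k, (u k <= v k)%E) -> (limn_einf u <= limn_einf v)%E.
Proof.
move=> uv; rewrite !limn_einf_lim; apply: lee_lim; [exact/is_cvg_einfs..|].
apply: nearW => k; apply: le_ereal_inf_tmp => _ [m /= km <-].
by apply: le_trans (uv m); apply: ereal_inf_lbound; exists m.
Qed.

Lemma measurable_limn_einf (R : realType) (dT : measure_display)
    (T : measurableType dT) (g : (T -> \bar R)^nat) :
  (forall k, measurable_fun setT (g k)) ->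
  measurable_fun setT (fun w => limn_einf (g ^~ w)).
Proof.
move=> mg; rewrite (_ : (fun w => _) = (fun w => - limn_esup ((fun k w => - g k w) ^~ w))%E).
  apply: measurableT_comp => //; apply: measurable_fun_limn_esup => k.
  exact: measurableT_comp.
by apply/funext => w; rewrite -limn_einfN; congr (limn_einf _); apply/funext => k;
  rewrite /= oppeK.
Qed.

Lemma cvg_finite_sum (R : realType) (I : Type) (r : seq I) (F : nat -> I -> R) (l : I -> R) :
  (forall i, F k i @[k --> \oo] --> l i) ->
  \sum_(i <- r) F k i @[k --> \oo] --> \sum_(i <- r) l i.
Proof.
move=> Fl; elim: r => [|i r IH].
  by rewrite big_nil; under eq_fun do rewrite big_nil; exact: cvg_cst.
rewrite big_cons; under eq_fun do rewrite big_cons.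
by apply: cvgD.
Qed.

Lemma cvg_dot_subr (R : realType) (n d : nat) (Y : nat -> 'M[R]_(n, d)) (A B : 'M[R]_(n, d)) :
  Y k @[k --> \oo] --> A ->
  dot (Y k - B) (Y k - B) @[k --> \oo] --> dot (A - B) (A - B).
Proof.
move=> YA; have entry i j : Y k i j @[k --> \oo] --> A i j.
  apply/cvgrPdist_lt => e e0; move/cvgrPdist_lt/(_ e e0) : YA; apply: filterS => k.
  by apply: le_lt_trans; have := entry_le_norm (A - Y k) i j; rewrite !mxE.
rewrite /dot; apply: cvg_finite_sum => i; apply: cvg_finite_sum => j.
have h : (Y k - B) i j @[k --> \oo] --> (A - B) i j.
  rewrite [X in _ --> X]mxE [in X in _ --> X]mxE.
  under eq_fun do rewrite mxE [in X in _ + X]mxE.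
  by apply: cvgB; [exact: entry|exact: cvg_cst].
exact: cvgM.
Qed.

Lemma measurable_dot_subr (R : realType) (dT : measure_display)
    (T : measurableType dT) (n d : nat) (X : T -> 'M[R]_(n, d)) (A : 'M[R]_(n, d)) :
  (forall i j, measurable_fun setT (fun w => X w i j)) ->
  measurable_fun setT (fun w => dot (X w - A) (X w - A)).
Proof.
move=> mX; apply: measurable_sum => i; apply: measurable_sum => j.
have me : measurable_fun setT (fun w => (X w - A) i j).
  under eq_fun do rewrite mxE [in X in _ + X]mxE.
  exact: measurable_funB.
exact: measurable_funM.
Qed.

Section Expectation.
Variables (R : realType) (dT : measure_display) (T : measurableType dT).
Variable P : probability T R.
Variables (n d : nat) (L q chi_1 : R).
Variable f : 'I_n -> 'rV[R]_d -> R.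
Variable E : {set 'I_n * 'I_n}.
Variable lam : 'I_n * 'I_n -> R.
Variable ustar : 'rV[R]_d.
Hypothesis n2 : (2 <= n)%N.
Hypothesis L0 : 0 < L.
Hypothesis q0 : 0 < q.
Hypothesis q1 : q <= 1.
Hypothesis convex_f : forall i, strongly_convex (2 * (L * q ^+ 2)) (f i).
Hypothesis smooth_f : forall i, smooth L (f i).
Hypothesis hE : forall e, e \in E -> e.1 != e.2.
Hypothesis hlam : forall e, e \in E -> 0 < lam e.
Hypothesis hchi1 : chi1 (laplacian E lam) = chi_1%:E.
Hypothesis hchi : 2 * chi_1 * chi2 E (laplacian E lam) <= 1.
Hypothesis min_ustar : forall u, \sum_(i < n) f i ustar <= \sum_(i < n) f i u.
Variables (N : 'I_n -> R -> T -> nat) (M : 'I_n * 'I_n -> R -> T -> nat).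
Hypothesis hclocks : poisson_clocks P E lam N M.

Let p := dadao_params L q chi_1.
Let D := clocks E.
Let cnt := clock_count N M.
Let pt := @pot R n d L q chi_1 f E lam ustar.

Definition clock_rate (c : 'I_n + 'I_n * 'I_n) : R :=
  if c is inr e then lam e else 1.

Lemma clock_poisson c : c \in D -> poisson_process P (clock_rate c) (cnt c).
Proof.
have [hN hM _] := hclocks; case: c => [i|e] cD; first exact: hN.
by apply: hM; move: cD; rewrite inE.
Qed.

Lemma clock_rate_gt0 c : c \in D -> 0 < clock_rate c.
Proof. by case: c => [i|e] //; rewrite inE; exact: hlam. Qed.

Lemma clock_indep :
  mutually_independent P D (fun c => generated_by_process (cnt c)).
Proof.
have [_ _ h] := hclocks; rewrite (_ : (fun c => _) = (fun c => match c with
  | inl i => generated_by_process (N i) | inr e => generated_by_process (M e) end)) //.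
by apply/funext => -[].
Qed.

Let Lam := total_rate D clock_rate.

Lemma sum_clocks (F : 'I_n + 'I_n * 'I_n -> R) :
  \sum_(c in D) clock_rate c * F c =
  \sum_(i < n) F (inl i) + \sum_(e in E) lam e * F (inr e).
Proof.
rewrite big_sumType /=; congr (_ + _).
  by apply: eq_big => [i|i _]; rewrite ?inE ?mul1r.
by apply: eq_bigl => e; rewrite inE.
Qed.

Let next (s : R) := chain_step D (fun c S => S + clock_jump p f c S)
  (fun S : state R n d => S + s *: drift p S).

Lemma pot_chain_decay : exists K, forall h m S, 0 <= h -> centered S ->
  \sum_(t : m.-tuple {ffun _ -> 'I_3})
    (\prod_(v <- t) cell_law D clock_rate h v) *
      pt (foldl (next (drift_step Lam h)) S t) <=
  expR (- (q / 8) * jump_weight Lam h + K * jump_weight Lam h * drift_step Lam h) ^+ m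
    * pt S.
Proof.
have [K K0 hK] := pot_step n2 L0 q0 q1 convex_f smooth_f hE hlam hchi1 hchi min_ustar.
exists K => h m S h0 cS.
apply: (expect_chain clock_rate_gt0 (inv := @centered R n d)) => //.
  move=> S' v cS'; rewrite /next /chain_step; case: (single_event _ _) => [c|].
    exact: centered_jump.
  exact: centered_drift.
move=> S' cS'; rewrite expect_chain_step -/(jump_weight _ _) -/Lam -/(stay_prob _ _).
rewrite (sum_clocks (fun c => pt (S' + clock_jump p f c S') - pt S')) mulrDr.
have pS0 : 0 <= pt S' by exact: pot_ge0.
have h1 := hK S' (stay_prob Lam h) (jump_weight Lam h) (drift_step Lam h) cS'
  (ltW (stay_prob_gt0 Lam h)) (jump_weight_ge0 Lam h0) (drift_step_ge0 Lam h0)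
  (stay_prob_drift_step Lam h).
rewrite -/pt in h1.
(* Bounding 1 + a by exp(a) keeps the factor nonnegative for the iteration and turns its powers into
   sums in the exponent. *)
apply: (@le_trans _ _ ((1 + (- (q / 8) * jump_weight Lam h
  + K * jump_weight Lam h * drift_step Lam h)) * pt S')).
  by rewrite [leRHS]mulrDl mul1r -[leLHS]addrA lerD2l.
by rewrite ler_wpM2r // expR_ge1Dx.
Qed.

Variables (x0 : 'M[R]_(n, d)) (x x' y' y z z' : R -> T -> 'M[R]_(n, d)).
Hypothesis mx : random_matrices x.
Let S0 := initial_state L q f x0.
Hypothesis init : {ae P, forall w,
  (x 0 w, x' 0 w, y' 0 w, y 0 w, z 0 w, z' 0 w) = S0}.
Hypothesis path : {ae P, forall w,
  dadao_path p f E (fun i => real_path (N i) w) (fun e => real_path (M e) w)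
    (x ^~ w) (x' ^~ w) (y' ^~ w) (y ^~ w) (z ^~ w) (z' ^~ w)}.

Let chain (t : R) (k : nat) (w : T) : state R n d :=
  let h := t / (2 ^ k)%:R in
  foldl (next (drift_step Lam h)) S0 (cells D cnt 0 h (2 ^ k) w).

Lemma ae_chain_cvg t : 0 < t ->
  {ae P, forall w, st_x (chain t k w) @[k --> \oo] --> x t w}.
Proof.
move=> t0.
have good := ae_good_grid clock_poisson clock_rate_gt0 clock_indep t0.
apply: filterS3 init path good => w iw pw gw.
have [cS dS nS jS] := dadao_path_state pw.
have [K [K0 bK JK]] := lipschitz_dynamics p L0 smooth_f.
have mono c : c \in D -> forall s t, 0 <= s -> s <= t -> (cnt c s w <= cnt c t w)%N.
  by move=> cD s u; have [_ /(_ w)[_ h _] _ _] := clock_poisson cD; exact: h.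
have cad c : c \in D -> cadlag (real_path (R := R) (cnt c) w).
  by move=> cD; have [_ /(_ w)[_ _ h] _ _] := clock_poisson cD.
have h0 k : 0 <= t / (2 ^ k)%:R by rewrite divr_ge0 // ltW.
have := euler_chain_cvg mono cad cS dS nS jS K0 bK JK t0
  (fun k => drift_step_ge0 Lam (h0 k)) (cvg_drift_step Lam (t := t)) gw.
have chainE k : euler_chain D cnt w
    (fun s => (x s w, x' s w, y' s w, y s w, z s w, z' s w)) (drift p)
    (clock_jump p f) (t / (2 ^ k)%:R) (drift_step Lam (t / (2 ^ k)%:R)) (2 ^ k) =
  chain t k w.
  rewrite /euler_chain iw /chain /next; congr foldl.
  rewrite /cells /= /mkseq -val_enum_ord -map_comp; apply: eq_map => j /=.
  by rewrite !add0r.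
under eq_fun do rewrite chainE.
move=> /cvgrPdist_lt cY; apply/cvgrPdist_lt => e e0.
move: (cY e e0); apply: filterS => k; apply: le_lt_trans.
(* The product norm is a maximum, and [x] is the innermost first component of the nested pairs. *)
do 5 (rewrite [leRHS]prod_normE; rewrite le_max; apply/orP; left).
exact: lexx.
Qed.

Lemma expected_sqdist t : 0 < t ->
  ('E_P[fun w => (frob (x t w - xs n ustar) ^+ 2)%R] <=
   (((2 * (L * q ^+ 2) * L + 4 * L ^+ 2 + (7 / 4 + 2 / q ^+ 2) * L ^+ 2) /
     (4 * (L * q ^+ 2) * L) * frob (x0 - xs n ustar) ^+ 2
    * expR (- (q / 8 * t)))%R)%:E)%E.
Proof.
move=> t0; have [K decay] := pot_chain_decay.
pose c := 4 * (L * q ^+ 2) * L.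
have c0 : 0 < c by rewrite !mulr_gt0 // exprn_gt0.
have h0 k : 0 < t / (2 ^ k)%:R by rewrite divr_gt0 // ltr0n expn_gt0.
(* Fatou is applied to the lower bound of [pot] that involves [x] alone, a continuous function of
   [x]; only [x] has to converge and be measurable at the limit. *)
pose g (k : nat) (w : T) : \bar R :=
  (c * dot (st_x (chain t k w) - xs n ustar) (st_x (chain t k w) - xs n ustar))%:E.
have g0 k w : (0 <= g k w)%E by rewrite lee_fin mulr_ge0 ?dot_ge0 // ltW.
have mg k : measurable_fun setT (g k).
  apply/measurable_EFinP; pose G (tup : (2 ^ k).-tuple {ffun _ -> 'I_3}) :=
    c * dot (st_x (foldl (next (drift_step Lam (t / (2 ^ k)%:R))) S0 tup) - xs n ustar)
        (st_x (foldl (next (drift_step Lam (t / (2 ^ k)%:R))) S0 tup) - xs n ustar).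
  exact: (measurable_cells_fun clock_poisson clock_rate_gt0 clock_indep G
    (lexx 0) (h0 k)).
have int_g k : (\int[P]_w g k w <= (expR (- (q / 8) * jump_weight Lam (t / (2 ^ k)%:R)
    + K * jump_weight Lam (t / (2 ^ k)%:R) * drift_step Lam (t / (2 ^ k)%:R))
    ^+ (2 ^ k) * pt S0)%:E)%E.
  pose G (tup : (2 ^ k).-tuple {ffun _ -> 'I_3}) :=
    c * dot (st_x (foldl (next (drift_step Lam (t / (2 ^ k)%:R))) S0 tup) - xs n ustar)
        (st_x (foldl (next (drift_step Lam (t / (2 ^ k)%:R))) S0 tup) - xs n ustar).
  have G0 tup : 0 <= G tup by rewrite mulr_ge0 ?dot_ge0 // ltW.
  rewrite (integral_cells clock_poisson clock_rate_gt0 clock_indep (g := G)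
    (lexx 0) (h0 k) G0) lee_fin.
  apply: le_trans (decay _ (2 ^ k)%N S0 (ltW (h0 k)) _); last first.
    exact: centered_initial_state.
  apply: ler_sum => tup _; rewrite ler_wpM2l //.
    by apply: prodr_ge0 => v _; apply: (cell_law_ge0 clock_rate_gt0); exact: ltW.
  exact: (pot_lb ustar n2 L0 q0 convex_f smooth_f hlam hchi1).
have fat := fatou P measurableT mg (fun k w _ => g0 k w).
have lim_bound : (limn_einf (fun k => \int[P]_w g k w) <=
    (expR (- (q / 8 * t)) * pt S0)%:E)%E.
  apply: (le_trans (limn_einf_le int_g)).
  have cv : (expR (- (q / 8) * jump_weight Lam (t / (2 ^ k)%:R)
    + K * jump_weight Lam (t / (2 ^ k)%:R) * drift_step Lam (t / (2 ^ k)%:R))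
    ^+ (2 ^ k) * pt S0)%:E @[k --> \oo] --> (expR (- (q / 8 * t)) * pt S0)%:E.
    apply: cvg_EFin; first exact: nearW.
    apply: cvgM; last exact: cvg_cst.
    exact: cvg_decay.
  by have [-> _] := cvg_limn_einf_sup cv.
have mX : measurable_fun setT (fun w =>
    dot (x t w - xs n ustar) (x t w - xs n ustar)).
  exact: measurable_dot_subr (mx (ltW t0)).
have le_lim : (\int[P]_w (c * dot (x t w - xs n ustar) (x t w - xs n ustar))%:E <=
    \int[P]_w limn_einf (g ^~ w))%E.
  apply: ae_ge0_le_integral => //.
  - by move=> w _; rewrite lee_fin mulr_ge0 ?dot_ge0 // ltW.
  - by apply/measurable_EFinP; apply: measurable_funM.
  - move=> w _; rewrite limn_einf_lim; apply: lime_ge; first exact: is_cvg_einfs.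
    by apply: nearW => k; apply: le_ereal_inf_tmp => _ [m /= _ <-].
  - exact: measurable_limn_einf.
  apply: filterS (ae_chain_cvg t0) => w cw _.
  have cg : g k w @[k --> \oo] -->
      (c * dot (x t w - xs n ustar) (x t w - xs n ustar))%:E.
    apply: cvg_EFin; first exact: nearW.
    apply: cvgM; first exact: cvg_cst.
    exact: cvg_dot_subr.
  by have [-> _] := cvg_limn_einf_sup cg.
have := le_trans le_lim (le_trans fat lim_bound).
under eq_integral do rewrite EFinM.
rewrite ge0_integralZl_EFin //; last 3 first.
- by move=> w _; rewrite lee_fin dot_ge0.
- exact/measurable_EFinP.
- exact: ltW.
rewrite unlock; under [X in _ -> (X <= _)%E]eq_integral do rewrite frob_sqr.
rewrite muleC -lee_pdivlMr // => /le_trans; apply.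
have h1 := pot_initial_state n2 L0 q0 convex_f smooth_f hlam hchi1 min_ustar x0.
rewrite lee_fin -/c frob_sqr.
move: h1; set Q := (_ + _ + _); set X := dot _ _ => h1.
rewrite [leRHS](_ : _ = expR (- (q / 8 * t)) * (Q * X) / c); last by ring.
by rewrite ler_wpM2r ?invr_ge0 ?(ltW c0) // ler_wpM2l // expR_ge0.
Qed.

End Expectation.

Lemma expectation_sum_poisson (R : realType) (dT : measure_display)
    (T : measurableType dT) (P : probability T R) (I : finType) (A : {set I})
    (rate : I -> R) (N : I -> R -> T -> nat) :
  (forall i, i \in A -> 0 < rate i) ->
  (forall i, i \in A -> poisson_process P (rate i) (N i)) ->
  forall t, 0 <= t ->
  ('E_P[fun w => (\sum_(i in A) N i t w)%N%:R%R] =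
   ((\sum_(i in A) rate i) * t)%R%:E)%E.
Proof.
move=> r0 pN t t0; rewrite unlock.
pose F i w : \bar R := if i \in A then ((N i t w)%:R : R)%:E else 0%E.
have -> : (fun w => ((\sum_(i in A) N i t w)%N%:R : R)%:E) = (fun w => \sum_i F i w)%E.
  apply/funext => w; rewrite natr_sum -sumEFin big_mkcond /F.
  by apply: eq_bigr => i _; case: ifP.
rewrite ge0_integral_sum //.
- rewrite mulr_suml -sumEFin [RHS]big_mkcond; apply: eq_bigr => i _.
  rewrite /F; case: (boolP (i \in A)) => iA; last by rewrite integral0.
  exact: poisson_process_mean (r0 i iA) (pN i iA) t t0.
- move=> i; rewrite /F; case: (boolP (i \in A)) => iA; last exact: measurable_cst.
  apply/measurable_EFinP; have [mN _ _ _] := pN i iA.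
  by apply: measurableT_comp => //; exact: mN.
- by move=> i w _; rewrite /F; case: ifP.
Qed.

Lemma trace_laplacian (R : realType) (n : nat) (E : {set 'I_n * 'I_n})
    (lam : 'I_n * 'I_n -> R) : (forall e, e \in E -> e.1 != e.2) ->
  \tr (laplacian E lam) = 2 * \sum_(e in E) lam e.
Proof.
move=> hE; rewrite /laplacian linear_sum mulr_sumr; apply: eq_bigr => e eE.
rewrite linearZ /= /edge_mx mxtrace_mulC edge_vec_sqr ?hE // mxtrace_scalar.
by rewrite mulrC.
Qed.

Theorem theorem3p6 (R : realType) (dT : measure_display)
    (T : measurableType dT) (P : probability T R)
    (n d : nat) (hn : (2 <= n)%N) (hd : (1 <= d)%N)
    (mu L : R) (hmu : 0 < mu) (hmuL : mu <= L)
    (f : 'I_n -> 'rV[R]_d -> R)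
    (hconvex : forall i, strongly_convex mu (f i))
    (hsmooth : forall i, smooth L (f i))
    (E : {set 'I_n * 'I_n}) (hE : forall e, e \in E -> e.1 != e.2)
    (hconn : connected_graph E)
    (lam : 'I_n * 'I_n -> R) (hlam : forall e, e \in E -> 0 < lam e)
    (chi_1 : R) (hchi1 : chi1 (laplacian E lam) = chi_1%:E)
    (N : 'I_n -> R -> T -> nat) (M : 'I_n * 'I_n -> R -> T -> nat)
    (hclocks : poisson_clocks P E lam N M)
    (hchi : 2 * chi_1 * chi2 E (laplacian E lam) <= 1)
    (ustar : 'rV[R]_d)
    (hustar : forall u, \sum_(i < n) f i ustar <= \sum_(i < n) f i u) :
  let xstar : 'M[R]_(n, d) := \matrix_(i < n) ustar in
  let nu := mu / 2 in
  let p := {| p_nu := nu;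
              p_eta := 1 / 8 * Num.sqrt (nu / L);
              p_eta' := 1 / 8 * Num.sqrt (nu / L);
              p_gamma := 1 / (4 * L);
              p_gamma' := 1 / (4 * Num.sqrt (nu * L));
              p_theta := 1 / 2 * Num.sqrt (L / nu);
              p_delta := 1 / 4 * Num.sqrt (nu / L);
              p_delta' := 1;
              p_alpha := 1 / 4 * Num.sqrt (nu / L);
              p_alpha' := 1 / 8 * Num.sqrt (nu / L);
              p_beta := 1 / 2;
              p_beta' := 2 * chi_1 * Num.sqrt (L / nu) |} in
  (forall (x0 : 'M[R]_(n, d)) (x x' y' y z z' : R -> T -> 'M[R]_(n, d)),
     centering R n *m x0 = 0 ->
     dadao_process P p mu f E N M x0 x x' y' y z z' ->
     forall t : R, 0 <= t ->
       ('E_P[fun w => (frob (x t w - xstar) ^+ 2)%R] <=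
        ((1 / 2 + 23 / 8 * (L / mu) + 2 * (L ^+ 2 / mu ^+ 2))
         * frob (x0 - xstar) ^+ 2
         * expR (- (t / (8 * Num.sqrt 2) * Num.sqrt (mu / L))))%R%:E)%E) /\
  (forall t : R, 0 <= t ->
     ('E_P[fun w => (\sum_(i < n) N i t w)%N%:R%R] = (n%:R * t)%R%:E)%E) /\
  (forall t : R, 0 <= t ->
     ('E_P[fun w => (\sum_(e in E) M e t w)%N%:R%R] =
       (t / 2 * \tr (laplacian E lam))%R%:E)%E).
Proof.
move=> xstar nu p.
have L0 : 0 < L by lra.
have nu0 : 0 < nu by rewrite divr_gt0.
pose q := Num.sqrt (nu / L).
have q0 : 0 < q by rewrite sqrtr_gt0 divr_gt0.
have q2 : q ^+ 2 = nu / L by rewrite sqr_sqrtr // ltW // divr_gt0.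
have q1 : q <= 1.
  rewrite -sqrtr1 ler_sqrt // ler_pdivrMr // mul1r /nu; lra.
have Lq : L * q ^+ 2 = nu by rewrite q2 mulrC divfK // gt_eqF.
(* The radicals become sqrt(L / nu) = 1 / q and sqrt(nu L) = L q. *)
have pE : p = dadao_params L q chi_1.
  have sLnu : Num.sqrt (L / nu) = q^-1.
    by rewrite -[L / nu]invf_div sqrtrV // ltW // divr_gt0.
  have snuL : Num.sqrt (nu * L) = L * q.
    rewrite -[nu * L](_ : (L * q) ^+ 2 = _); last by rewrite exprMn expr2 -mulrA Lq mulrC.
    by rewrite sqrtr_sqr ger0_norm // ltW // mulr_gt0.
  rewrite /p /dadao_params -/nu sLnu snuL -/q Lq.
  have qn : q != 0 by rewrite gt_eqF.
  have Ln : L != 0 by rewrite gt_eqF.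
  by congr Params; field; rewrite ?qn ?Ln.
split; last split.
- move=> x0 x x' y' y z z' _ [[mx _] init path] t t0.
  have kE : 1 / 2 + 23 / 8 * (L / mu) + 2 * (L ^+ 2 / mu ^+ 2) =
      (2 * (L * q ^+ 2) * L + 4 * L ^+ 2 + (7 / 4 + 2 / q ^+ 2) * L ^+ 2) /
      (4 * (L * q ^+ 2) * L).
    by rewrite q2 /nu; field; rewrite !gt_eqF.
  have rE : t / (8 * Num.sqrt 2) * Num.sqrt (mu / L) = q / 8 * t.
    have -> : Num.sqrt (mu / L) = Num.sqrt 2 * q.
      rewrite /q -sqrtrM //; congr Num.sqrt; rewrite /nu; field.
      by rewrite gt_eqF.
    by field; rewrite gt_eqF // sqrtr_gt0.
  rewrite kE rE.
  (* At time 0 the grid has no positive mesh; there the bound only says that the prefactor is at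
     least 1, which follows from L / mu >= 1. *)
  move: t0; rewrite le_eqVlt => /orP[/eqP <-|t0]; last first.
    apply: (expected_sqdist hn L0 q0 q1 _ hsmooth hE hlam hchi1 hchi hustar hclocks
      (x' := x') (y' := y') (y := y) (z := z) (z' := z') mx _ _ t0).
    + by move=> i; rewrite Lq mulrC divfK //.
    + apply: filterS init => w [-> [-> [-> [-> [-> ->]]]]].
      by rewrite /initial_state /shifted_grad Lq.
    + by rewrite -pE.
  rewrite mulr0 oppr0 expR0 mulr1 -kE.
  rewrite unlock (ae_eq_integral (fun _ => (frob (x0 - xstar) ^+ 2)%:E)) //.
  + rewrite integral_cst //= probability_setT mule1 lee_fin.
    rewrite -[leLHS]mul1r ler_wpM2r // ?sqr_ge0 //.
    have : 1 <= L / mu by rewrite ler_pdivlMr // mul1r.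
    have : 0 <= L ^+ 2 / mu ^+ 2 by rewrite divr_ge0 // sqr_ge0.
    lra.
  + apply/measurable_EFinP; under eq_fun do rewrite frob_sqr.
    exact: measurable_dot_subr (mx 0 (lexx 0)).
  + by apply: filterS init => w [-> _] _.
- move=> t t0.
  have [hN _ _] := hclocks.
  have := @expectation_sum_poisson _ _ _ P _ [set: 'I_n]%SET (fun=> 1) N
    (fun _ _ => ltr01) (fun i _ => hN i) t t0.
  rewrite sumr_const cardsT card_ord => <-; congr (expectation P _); apply/funext => w.
  by congr (_%:R); apply: eq_bigl => i; rewrite inE.
- move=> t t0; have [_ hM _] := hclocks.
  rewrite (expectation_sum_poisson hlam hM t0) trace_laplacian //.
  by congr (_%:E); rewrite mulrA divfK // mulrC.
Qed.
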